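(* Let $X_1,X_2,\ldots$ be i.i.d. with distribution function $F$ such that $1-F(x)=e(x)x^{-\gamma}$ for $x>0$, where $\gamma>0$ and $e$ is slowly varying at infinity. Suppose that there are $\rho<0$ and a function $A$ with $A(t)\to0$ as $t\to\infty$ such that, for all $x>0$, $$\lim_{t\to\infty}\frac{U(tx)/U(t)-x^{1/\gamma}}{A(t)}=x^{1/\gamma}\,\frac{x^{\rho}-1}{\rho}.$$ Let $p_n\in(0,1)$ with $p_n\to0$, and let $k=k(n)$ be integers with $k\to\infty$ and $k/n\to0$. Assume that, as $n\to\infty$, $\sqrt{k}\,A(n/k)\to0$, $np_n=o(k)$ and $\log\big(\tfrac{k}{np_n}\big)/\sqrt{k}\to0$. With $\bar\gamma(\lambda)$, $\bar c(\lambda)$ and $l(x_p)$ as defined in the context (for a candidate value $x_p>0$), there exists a unique solution $\lambda=\hat\lambda(x_p)$ to $$\bar\gamma(\lambda)\log x_p+\log\left(\frac{p_n}{\bar c(\lambda)}\right)=0,\qquad \bar\gamma(\lambda)>0\ \text{ and }\ \lambda<k,$$ and $$l(x_{p,0})\xrightarrow{d}\chi^2(1)\qquad(n\to\infty),$$ where $x_{p,0}=(1-F)^{\leftarrow}(p_n)$ is the true value of the quantile and $\lambda=\hat\lambda(x_{p,0})$ is used in the definition of $l_2(x_{p,0})$.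
   Context: $U(x)=\left(\frac1{1-F}\right)^{\leftarrow}(x)=\inf\{y:1/(1-F(y))\ge x\}$ and $(1-F)^{\leftarrow}(p)=\inf\{y:1-F(y)\le p\}$ (generalized inverses). $X_{n,1}\le\cdots\le X_{n,n}$ are the order statistics of $X_1,\ldots,X_n$, and $\delta_i=I(X_i>X_{n,n-k})$. The censored likelihood is $$L(\gamma,c)=\prod_{i=1}^n(c\gamma X_i^{-\gamma-1})^{\delta_i}(1-cX_{n,n-k}^{-\gamma})^{1-\delta_i}.$$ Its maximizer over $\gamma>0,c>0$ is $(\hat\gamma_n,\hat c_n)$ with $\hat\gamma_n=\left\{\frac1k\sum_{i=1}^k\log(X_{n,n-i+1}/X_{n,n-k})\right\}^{-1}$ and $\hat c_n=\frac kn X_{n,n-k}^{\hat\gamma_n}$; put $l_1=\max_{\gamma>0,c>0}\log L(\gamma,c)=\log L(\hat\gamma_n,\hat c_n)$. For a candidate value $x_p$, $l_2(x_p)$ is the maximum of $\log L(\gamma,c)$ subject to $\gamma>0$, $c>0$, $\gamma\log x_p+\log(p_n/c)=0$. It is given by $l_2(x_p)=\log L(\bar\gamma(\lambda),\bar c(\lambda))$, where $$\bar\gamma(\lambda)=\frac{k}{\sum_{i=1}^k(\log X_{n,n-i+1}-\log X_{n,n-k})+\lambda\log X_{n,n-k}-\lambda\log x_p},\qquad \bar c(\lambda)=X_{n,n-k}^{\bar\gamma(\lambda)}\,\frac{k-\lambda}{n-\lambda},$$ and $\lambda$ solves $\bar\gamma(\lambda)\log x_p+\log(p_n/\bar c(\lambda))=0$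 with $\bar\gamma(\lambda)>0$, $\lambda<k$. Finally $l(x_p)=-2(l_2(x_p)-l_1)$. Quantities involving $\log X_{n,n-k}$ or $\hat\gamma_n$ are understood on the event where they are well defined (e.g. $X_{n,n-k}>0$). *)

(* Defs.v *)
From HB Require Import structures.
From mathcomp Require Import all_boot all_order all_algebra.
From mathcomp Require Import all_classical all_reals all_analysis.
Set Implicit Arguments.
Unset Strict Implicit.
Unset Printing Implicit Defensive.
Import Order.TTheory GRing.Theory Num.Theory.
Import numFieldNormedType.Exports.
Local Open Scope classical_set_scope.
Local Open Scope ring_scope.

Section Probability.
Context {d : measure_display} {T : measurableType d} {R : realType}.
Variable P : probability T R.

Definition mutually_independent (X : nat -> {RV P >-> R}) : Prop :=
  forall (s : seq nat) (B : nat -> set R), uniq s ->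
    (forall i, measurable (B i)) ->
    P (\bigcap_(i in [set` s]) (X i @^-1` B i)) =
    (\prod_(i <- s) P (X i @^-1` B i))%E.

Definition iid_with_cdf (X : nat -> {RV P >-> R}) (F : R -> R) : Prop :=
  mutually_independent X /\ forall i x, cdf (X i) x = (F x)%:E.

(* Weak convergence to the law mu of random variables Y n that are only
   meaningful on events E n of probability tending to 1; the values of Y n
   outside E n play no role. The condition mu [set x] = 0 says that the
   distribution function of mu is continuous at x. *)
Definition cvg_in_distribution_on (E : nat -> set T) (Y : nat -> T -> R)
    (mu : set R -> \bar R) : Prop :=
  [/\ forall n, measurable (E n) /\ measurable_fun (E n) (Y n),
      P (E n) @[n --> \oo] --> 1%E
    & forall x, mu [set x] = 0%E ->
        P (E n `&` [set w | Y n w <= x]) @[n --> \oo] --> mu `]-oo, x]%classic ].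

End Probability.

(* The law of the square of a standard normal variable. *)
Definition chi_square1 (R : realType) : set R -> \bar R :=
  pushforward (normal_prob 0 1) (fun z : R => z ^+ 2).

Section Tail.
Context {R : realType}.
Implicit Types (F e : R -> R) (x p : R).

Definition slowly_varying e : Prop :=
  [/\ measurable_fun (`]0, +oo[%classic : set R) e,
      \forall t \near +oo, 0 < e t
    & forall x, 0 < x -> e (t * x) / e t @[t --> +oo] --> (1 : R)].

(* U = (1 / (1 - F))^<-. The real infimum is the intended one when
   1 - F > 0 everywhere and x > 1: the set is then nonempty and bounded
   below. *)
Definition tail_quantile F x : R := inf [set y | x <= (1 - F y)^-1].

(* (1 - F)^<-; the infimum is over a nonempty set bounded below when
   0 < p < 1 and F is a distribution function. *)
Definition survival_inv F p : R := inf [set y | 1 - F y <= p].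

End Tail.

(* A sample X_1, .., X_n is given by the values x 0, .., x n.-1 of a sequence. *)
Section Sample.
Context {R : realType}.
Variables (x : nat -> R) (n k : nat).
Implicit Types (g c p xp lam : R).

(* X_{n,i} for 1 <= i <= n. *)
Definition order_stat (i : nat) : R :=
  nth 0 (sort <=%R (mkseq x n)) i.-1.

Local Notation Xnk := (order_stat (n - k)).

Definition exceeds (i : nat) : bool := Xnk < x i.

Definition censored_lik g c : R :=
  \prod_(i < n) ((c * g * x i `^ (- g - 1)) ^+ exceeds i *
                 (1 - c * Xnk `^ (- g)) ^+ (1 - exceeds i)).

Definition log_excess_sum : R :=
  \sum_(1 <= i < k.+1) ln (order_stat (n - i + 1) / Xnk).

Definition gamma_hat : R := (k%:R^-1 * log_excess_sum)^-1.

Definition c_hat : R := k%:R / n%:R * Xnk `^ gamma_hat.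

(* The samples for which log X_{n,n-k} and gamma_hat are well defined. *)
Definition well_defined_sample : Prop :=
  [/\ (0 < k)%N, (k < n)%N, 0 < Xnk & log_excess_sum != 0].

(* gamma_bar, c_bar: stationary point of the Lagrangian for maximizing the log
   likelihood under g * ln xp + ln (p / c) = 0, as a function of the
   multiplier lam. *)
Definition gamma_bar xp lam : R :=
  k%:R / (\sum_(1 <= i < k.+1) (ln (order_stat (n - i + 1)) - ln Xnk)
          + lam * ln Xnk - lam * ln xp).

Definition c_bar xp lam : R :=
  Xnk `^ gamma_bar xp lam * ((k%:R - lam) / (n%:R - lam)).

Definition multiplier_eq p xp lam : Prop :=
  [/\ gamma_bar xp lam * ln xp + ln (p / c_bar xp lam) = 0,
      0 < gamma_bar xp lam & lam < k%:R].

Definition lambda_hat p xp : R := xget 0 [set lam | multiplier_eq p xp lam].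

(* l1 and l2 are the values of the log likelihood at its unconstrained and
   constrained maximizers over g, c > 0 (with 1 - c * Xnk `^ (- g) > 0),
   in closed form up to the multiplier for l2; the closed forms are the
   maximizers when exactly k observations exceed Xnk. *)
Definition l1 : R := ln (censored_lik gamma_hat c_hat).

Definition l2 p xp : R :=
  ln (censored_lik (gamma_bar xp (lambda_hat p xp))
                   (c_bar xp (lambda_hat p xp))).

Definition log_lik_ratio p xp : R := - 2 * (l2 p xp - l1).

End Sample.

(* Main.v *)
Require Import Defs.
From HB Require Import structures.
From mathcomp Require Import all_boot all_order all_algebra.
From mathcomp Require Import all_classical all_reals all_analysis.
From mathcomp Require Import measurable_realfun zify ring lra.
Set Implicit Arguments.
Unset Strict Implicit.
Unset Printing Implicit Defensive.
Import Order.TTheory GRing.Theory Num.Theory.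
Import numFieldNormedType.Exports.
Local Open Scope classical_set_scope.
Local Open Scope ring_scope.

(** Write [K] for the square root of [k], [S] for the sum of the log excesses over the threshold
    X_{n,n-k}, and [D] for the log of the candidate quantile minus the log of the threshold. Once
    [gamma_bar] and [c_bar] are eliminated, the multiplier equation reads [k D / (S - l D) + ln p -
    ln ((k - l) / (n - l)) = 0], on the interval where [l < k] and [S - l D > 0]. The left side is
    strictly increasing there, nonnegative somewhere and nonpositive somewhere, so there is exactly
    one root ([multiplier_fun_root], [multiplier_eq_unique]).

    For the limit law, insert both closed-form maximizers in the likelihood. With
    [r = S / (S - lam D)] and [N] the number of observations above the threshold, the statistic is
    [-2 (N ln (1 - lam / k) - n ln (1 - lam / n) + N ln r - k (r - 1))] ([log_lik_ratioE]). Put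
    [Z = (gamma S - k) / K] and [L = ln (k / (n p))]. Since [L] tends to infinity and [gamma D - L]
    is of order [1 / K] at the true quantile, the root is of order at most [K / L], the linear terms
    in [lam] cancel, and [r - 1] is close to [Z / K]. Expanding the logarithms leaves the square of
    [Z] ([log_ratio_expansion]).

    The statistic [Z] still involves a random threshold. The second-order condition supplies a
    deterministic level [u] such that [1 - F (u exp (t / gamma))] is [(k / n) exp (- t)] up to a
    factor [exp (+- err)], where [K err] tends to 0 and [t] ranges over a whole half-line
    ([second_order_tail_bounds]). The hypothesis is only pointwise; a measure-theoretic argument
    makes it uniform ([locally_uniform_bound], [second_order_uniform]). Chebyshev's inequality on a
    finite grid of levels around [u] then locates the threshold. Moving the threshold changes
    [gamma S] and the number of exceedances by the same first-order amount, so [Z] is close to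
    [zeta], the sum of [1{X_i > u} (gamma ln (X_i / u) - 1)] divided by [K] ([log_lik_ratio_approx],
    [good_event]).

    The terms of [zeta] behave like centred standard exponentials switched on with probability
    [k / n]: their mean is nearly 0 and their variance nearly [1 / n]. Lindeberg's replacement
    method gives a central limit theorem for this triangular array ([array_clt], [score_clt]), and
    the statistic converges to the square of a standard normal variable
    ([cvg_in_distribution_chi_square1]). *)

(** * Independence: Tonelli for independent variables, and a partial sum against the next term *)

Section Independence.
Context {d : measure_display} {T : measurableType d} {R : realType}.
Variable P : probability T R.

Definition independent2 (S Y : T -> R) : Prop :=
  forall A B, measurable A -> measurable B ->
    P (S @^-1` A `&` Y @^-1` B) = (P (S @^-1` A) * P (Y @^-1` B))%E.

Section Fubini.
Variables (S Y : {mfun T >-> R}).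
Hypothesis indSY : independent2 S Y.

Let SY : T -> R * R := fun w => (S w, Y w).

Let measurable_SY : measurable_fun setT SY.
Proof. by apply/measurable_fun_pairP; split. Qed.

HB.instance Definition _ := isMeasurableFun.Build _ _ _ _ SY measurable_SY.

Let joint_law (C : set (R * R)) : measurable C ->
  (distribution P S \x distribution P Y)%E C = distribution P SY C.
Proof.
by move=> mC; apply: product_measure_unique.
Qed.

(** Uniqueness of product measures identifies the joint law with the product of the marginals; the
    rest is Tonelli and changes of variables. *)
Lemma ge0_integral_independent (g : R * R -> \bar R) :
  measurable_fun [set: R * R] g -> (forall z, 0 <= g z)%E ->
  (\int[P]_w g (S w, Y w) = \int[P]_w \int[P]_w' g (S w, Y w'))%E.
Proof.
move=> mg g0.
transitivity (\int[distribution P S \x distribution P Y]_z g z)%E; last first.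
  rewrite fubini_tonelli1//= /fubini_F ge0_integral_distribution//=; last 2 first.
    exact: measurable_fun_fubini_tonelli_F.
    by move=> y; apply: integral_ge0.
  apply: eq_integral => w _; rewrite ge0_integral_distribution//.
  by apply/measurableT_comp => //; exact: measurable_pair1.
rewrite [RHS](eq_measure_integral (distribution P SY)); last first.
  by move=> C mC _; exact: joint_law.
by rewrite ge0_integral_distribution.
Qed.

End Fubini.

Section Partial_sums.
Variables (X : nat -> {RV P >-> R}) (f : R -> R).
Hypothesis indX : mutually_independent X.
Hypothesis mf : measurable_fun setT f.

Definition partial_sum (j : nat) (w : T) : R := \sum_(i < j) f (X i w).

Lemma measurable_partial_sum j : measurable_fun setT (partial_sum j).
Proof. by apply: measurable_sum => i; exact: measurableT_comp. Qed.

HB.instance Definition _ j :=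
  isMeasurableFun.Build _ _ _ _ (partial_sum j) (measurable_partial_sum j).

Lemma partial_sumS j w : partial_sum j.+1 w = partial_sum j w + f (X j w).
Proof. by rewrite /partial_sum big_ord_recr. Qed.

(** A pi-system generating the sigma-algebra of the first [j] variables. *)
Let cylinders j : set (set T) :=
  [set A | exists2 B : nat -> set R, forall i, measurable (B i) &
    A = \bigcap_(i in [set` iota 0 j]) (X i @^-1` B i)].

Let cylinders_measurable j : cylinders j `<=` measurable.
Proof.
move=> _ [B mB ->]; apply: fin_bigcap_measurable => // i _.
by rewrite -[X in measurable X]setTI; exact: measurable_funP.
Qed.

Let cylindersI j : setI_closed (cylinders j).
Proof.
move=> _ _ [B mB ->] [C mC ->]; exists (fun i => B i `&` C i).
  by move=> i; exact: measurableI.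
by rewrite -bigcapI; apply: eq_bigcapr => i _; rewrite preimage_setI.
Qed.

Let cylindersT j : cylinders j setT.
Proof.
exists (fun=> setT) => //.
by apply/esym/seteqP; split => // w _ i _.
Qed.

Let cylinders_indep j A B : cylinders j A -> measurable B ->
  P (A `&` X j @^-1` B) = (P A * P (X j @^-1` B))%E.
Proof.
move=> [C mC ->] mB.
pose D i := if i == j then B else C i.
have DC i : i \in iota 0 j -> D i = C i.
  by rewrite mem_iota /D add0n => /andP[_ ij]; rewrite lt_eqF.
have DB : D j = B by rewrite /D eqxx.
have mD i : measurable (D i) by rewrite /D; case: ifP.
have := @indX (iota 0 j.+1) D (iota_uniq _ _) mD.
rewrite -addn1 iotaD add0n big_cat/= big_cons big_nil mule1 DB => PD.
have DE : (\prod_(i <- iota 0 j) P (X i @^-1` D i) =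
    \prod_(i <- iota 0 j) P (X i @^-1` C i))%E.
  by apply: eq_big_seq => i ij; rewrite DC.
rewrite DE -(@indX _ _ (iota_uniq _ _) mC) in PD; rewrite -PD.
congr (P _); apply/seteqP; split => [w [wC wB] i /=|w wD].
  rewrite mem_cat => /orP[ij|]; first by have := wC _ ij; rewrite /= DC.
  by rewrite mem_seq1 => /eqP ->; rewrite DB.
split; first move=> i /= ij.
  by have := wD i; rewrite /= mem_cat ij => /(_ isT); rewrite DC.
by have := wD j; rewrite /= mem_cat mem_seq1 eqxx orbT DB => /(_ isT).
Qed.

(** Independence from [X j] passes from the cylinders to the sigma-algebra they generate, and the
    partial sum is measurable for that sigma-algebra. *)
Lemma independent_partial_sum j : independent2 (partial_sum j) (f \o X j).
Proof.
have mX i (B : set R) : measurable B -> measurable (X i @^-1` B).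
  by move=> mB; rewrite -[X in measurable X]setTI; exact: measurable_funP.
have key B E : measurable B -> <<s cylinders j >> E ->
    P (E `&` X j @^-1` B) = (P E * P (X j @^-1` B))%E.
  move=> mB.
  have PBfin : P (X j @^-1` B) \is a fin_num by rewrite fin_num_measure//; exact: mX.
  (* For fixed [B], both sides are finite measures in [E]: a restriction of [P] and a multiple of
     [P]. They agree on the cylinders, hence on the generated sigma-algebra. *)
  pose m1 := mrestr P (mX j B mB).
  have [r r0 rE] : exists2 r : {nonneg R}, r%:num = fine (P (X j @^-1` B)) & True.
    have h : 0 <= fine (P (X j @^-1` B)) by exact: fine_ge0.
    by exists (NngNum h).
  pose m2 := mscale r P.
  have m2E A : m2 A = (P A * P (X j @^-1` B))%E.
    by rewrite /m2 /mscale/= r0 fineK// muleC.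
  move=> sE; rewrite -m2E -[LHS]/(m1 E).
  apply: (g_sigma_algebra_measure_unique (cylinders j)
    (@cylinders_measurable j) (fun=> setT)) => //.
  - by rewrite bigcup_const.
  - by move=> A cA; rewrite [RHS]m2E /m1 /= /mrestr cylinders_indep.
  - by move=> _; rewrite /= /mrestr setTI ltey_eq PBfin.
move=> A B mA mB; 
rewrite (_ : (f \o X j) @^-1` B = X j @^-1` (f @^-1` B))// (key (f @^-1` B))//.
  by rewrite -[X in measurable X]setTI; exact: mf.
have mXi i : (i < j)%N -> @measurable_fun _ _ (g_sigma_algebraType (cylinders j)) R setT (X i).
  move=> ij _ C mC; rewrite setTI; apply: sub_sigma_algebra.
  exists (fun l => if l == i then C else setT); first by move=> l; case: ifP.
  apply/seteqP; split => w /=.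
    by move=> wC l _ /=; case: eqP => // ->.
  by move=> /(_ i); rewrite /= mem_iota add0n ij eqxx; exact.
have : @measurable_fun _ _ (g_sigma_algebraType (cylinders j)) R setT (partial_sum j).
  rewrite (_ : partial_sum j = fun w => \sum_(i < j) f (X i w)) //.
  apply: (@measurable_sum _ (g_sigma_algebraType (cylinders j))) => i.
  by apply: measurableT_comp => //; exact: mXi.
by move=> /(_ measurableT A mA); rewrite setTI.
Qed.

End Partial_sums.
End Independence.

(** * The operator averaging a bounded function over random translates *)

Section Translation_average.
Context {d : measure_display} {T : measurableType d} {R : realType}.
Variable P : probability T R.

Lemma bounded_integrable (f : T -> R) (M : R) :
  measurable_fun setT f -> (forall w, `|f w| <= M) ->
  P.-integrable setT (EFin \o f).
Proof.
move=> mf fM; apply: measurable_bounded_integrable => //.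
  by rewrite (le_lt_trans (probability_le1 _ _)) ?ltry.
by exists M; split; rewrite ?num_real// => y My w _; exact: le_trans (ltW My).
Qed.

Lemma EFin_Rintegral (f : T -> R) : P.-integrable setT (EFin \o f) ->
  (\int[P]_w f w)%:E = (\int[P]_w (f w)%:E)%E.
Proof. by move=> intf; rewrite fineK//; exact: integrable_fin_num. Qed.

Lemma Rintegral_cst_prob (c : R) : \int[P]_w c = c.
Proof. by rewrite Rintegral_cst//= probability_setT mulr1. Qed.

Lemma normr_Rintegral_le (f : T -> R) (M : R) :
  measurable_fun setT f -> (forall w, `|f w| <= M) -> `|\int[P]_w f w| <= M.
Proof.
move=> mf fM; have intf := bounded_integrable mf fM.
rewrite (le_trans (le_normr_Rintegral _ _))// -[leRHS]Rintegral_cst_prob.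
apply: le_Rintegral => //.
- by apply: (@bounded_integrable _ M) => [|w]; rewrite ?normr_id//;
    exact: measurableT_comp.
- exact: finite_measure_integrable_cst.
Qed.

(** The transition operator of a random walk with step [Y]; Lindeberg's method swaps one such
    operator for a Gaussian one. *)
Definition translation_average (Y : T -> R) (g : R -> R) (y : R) : R :=
  \int[P]_w g (y + Y w).

Variable Y : T -> R.
Hypothesis mY : measurable_fun setT Y.

Lemma measurable_translate (g : R -> R) (y : R) :
  measurable_fun setT g -> measurable_fun setT (fun w => g (y + Y w)).
Proof. by move=> mg; apply: measurableT_comp => //; exact: measurable_funD. Qed.

Lemma measurable_translation_average (g : R -> R) (M : R) :
  measurable_fun setT g -> (forall y, `|g y| <= M) ->
  measurable_fun setT (translation_average Y g).
Proof.
move=> mg gM.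
(* Adding [M] makes the integrand nonnegative, so that the measurability part of Tonelli applies. *)
have -> : translation_average Y g =
    (fun y => fine (\int[P]_w (g (y + Y w) + M)%:E) - M).
  apply/funext => y; rewrite -/(Rintegral _ _ _) RintegralD//.
  - by rewrite Rintegral_cst_prob addrK.
  - by apply: (@bounded_integrable _ M) => //; exact: measurable_translate.
  - exact: finite_measure_integrable_cst.
apply: measurable_funB => //; apply: measurableT_comp => //.
apply: (@measurable_fun_fubini_tonelli_F _ _ _ _ _ P
  (fun z : R * T => (g (z.1 + Y z.2) + M)%:E)).
  apply/measurable_EFinP; apply: measurable_funD => //.
  apply: measurableT_comp => //; apply: measurable_funD => //.
  exact: measurableT_comp.
move=> z; rewrite lee_fin -lerBlDr sub0r.
by have := gM (z.1 + Y z.2); rewrite ler_norml => /andP[].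
Qed.

Lemma normr_translation_average (g : R -> R) (M : R) (y : R) :
  measurable_fun setT g -> (forall y, `|g y| <= M) ->
  `|translation_average Y g y| <= M.
Proof.
by move=> mg gM; apply: normr_Rintegral_le => //; exact: measurable_translate.
Qed.

End Translation_average.

(** * Functions with a uniform third-order Taylor bound *)

Section Taylor_class.
Context {R : realType}.

(** Stands for three bounded derivatives. Requiring only the Taylor inequality with some [g1], [g2]
    avoids differentiating under an integral and admits piecewise cubic functions. *)
Definition taylor3 (M : R) (g : R -> R) : Prop :=
  exists g1 g2 : R -> R,
    [/\ measurable_fun setT g /\ (forall y, `|g y| <= M),
        measurable_fun setT g1 /\ (forall y, `|g1 y| <= M),
        measurable_fun setT g2 /\ (forall y, `|g2 y| <= M)
      & forall y h, `|g (y + h) - g y - g1 y * h - g2 y * (h ^+ 2 / 2)| <=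
          M * `|h| ^+ 3].

Section average.
Context {d : measure_display} {T : measurableType d}.
Variables (P : probability T R) (Y : T -> R).
Hypothesis mY : measurable_fun setT Y.

(** Averaging [g], [g1] and [g2] separately keeps every bound with the same [M]; this lets the
    replacement induction use one constant throughout. *)
Lemma taylor3_translation_average (M : R) (g : R -> R) :
  taylor3 M g -> taylor3 M (translation_average P Y g).
Proof.
move=> [g1 [g2 [[mg gM] [mg1 g1M] [mg2 g2M] gT]]].
exists (translation_average P Y g1), (translation_average P Y g2); split.
- by split=> [|y]; [exact: measurable_translation_average gM|
                    exact: normr_translation_average].
- by split=> [|y]; [exact: measurable_translation_average g1M|
                    exact: normr_translation_average].
- by split=> [|y]; [exact: measurable_translation_average g2M|
                    exact: normr_translation_average].
move=> y h.
have i0 z : P.-integrable setT (EFin \o (fun w => g (z + Y w))).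
  by apply: (@bounded_integrable _ _ _ _ _ M) => //; exact: measurable_translate.
have i1 z : P.-integrable setT (EFin \o (fun w => g1 (z + Y w))).
  by apply: (@bounded_integrable _ _ _ _ _ M) => //; exact: measurable_translate.
have i2 z : P.-integrable setT (EFin \o (fun w => g2 (z + Y w))).
  by apply: (@bounded_integrable _ _ _ _ _ M) => //; exact: measurable_translate.
have j1 : P.-integrable setT (EFin \o (fun w => g1 (y + Y w) * h)).
  under eq_fun do rewrite mulrC; exact: (integrableZl measurableT h (i1 y)).
have j2 : P.-integrable setT (EFin \o (fun w => g2 (y + Y w) * (h ^+ 2 / 2))).
  under eq_fun do rewrite mulrC.
  exact: (integrableZl measurableT (h ^+ 2 / 2) (i2 y)).
have j3 : P.-integrable setT (EFin \o (fun w => g (y + h + Y w) - g (y + Y w))).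
  exact: (integrableB measurableT (i0 _) (i0 _)).
have j4 : P.-integrable setT
    (EFin \o (fun w => g (y + h + Y w) - g (y + Y w) - g1 (y + Y w) * h)).
  exact: (integrableB measurableT j3 j1).
rewrite /translation_average -RintegralZr// -RintegralZr// -RintegralB//.
rewrite -RintegralB// -RintegralB//.
apply: normr_Rintegral_le => [|w]; last by rewrite [y + h + _]addrAC.
apply: measurable_funB; last by apply: measurable_funM => //; exact: measurable_translate.
apply: measurable_funB; last by apply: measurable_funM => //; exact: measurable_translate.
by apply: measurable_funB => //; exact: measurable_translate.
Qed.

Lemma taylor3_expectation (M : R) (g g1 g2 : R -> R) (y : R) :
  measurable_fun setT g -> (forall z, `|g z| <= M) ->
  (forall y h, `|g (y + h) - g y - g1 y * h - g2 y * (h ^+ 2 / 2)| <=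
          M * `|h| ^+ 3) ->
  P.-integrable setT (EFin \o Y) ->
  P.-integrable setT (EFin \o (fun w => Y w ^+ 2)) ->
  P.-integrable setT (EFin \o (fun w => `|Y w| ^+ 3)) ->
  `|translation_average P Y g y - g y - g1 y * (\int[P]_w Y w)
     - g2 y / 2 * (\int[P]_w (Y w ^+ 2))| <= M * \int[P]_w (`|Y w| ^+ 3).
Proof.
move=> mg gM gT iY iY2 iY3.
have i0 : P.-integrable setT (EFin \o (fun w => g (y + Y w))).
  by apply: (@bounded_integrable _ _ _ _ _ M) => //; exact: measurable_translate.
have ic : P.-integrable setT (EFin \o (fun w : T => g y)).
  exact: finite_measure_integrable_cst.
have j1 : P.-integrable setT (EFin \o (fun w => g1 y * Y w)).
  exact: (integrableZl measurableT (g1 y) iY).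
have j2 : P.-integrable setT (EFin \o (fun w => g2 y / 2 * Y w ^+ 2)).
  exact: (integrableZl measurableT (g2 y / 2) iY2).
have j3 : P.-integrable setT (EFin \o (fun w => M * `|Y w| ^+ 3)).
  exact: (integrableZl measurableT M iY3).
have k1 : P.-integrable setT (EFin \o (fun w => g (y + Y w) - g y)).
  exact: (integrableB measurableT i0 ic).
have k2 : P.-integrable setT (EFin \o (fun w => g (y + Y w) - g y - g1 y * Y w)).
  exact: (integrableB measurableT k1 j1).
have k3 : P.-integrable setT (EFin \o
    (fun w => g (y + Y w) - g y - g1 y * Y w - g2 y / 2 * Y w ^+ 2)).
  exact: (integrableB measurableT k2 j2).
have -> : translation_average P Y g y - g y - g1 y * (\int[P]_w Y w)
     - g2 y / 2 * (\int[P]_w (Y w ^+ 2)) =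
   \int[P]_w (g (y + Y w) - g y - g1 y * Y w - g2 y / 2 * Y w ^+ 2).
  rewrite RintegralB// RintegralB// RintegralB// Rintegral_cst_prob.
  by rewrite RintegralZl// RintegralZl.
rewrite -RintegralZl//.
rewrite (le_trans (le_normr_Rintegral _ _))//.
apply: le_Rintegral => //.
  rewrite (_ : EFin \o _ = abse \o (EFin \o
    (fun w => g (y + Y w) - g y - g1 y * Y w - g2 y / 2 * Y w ^+ 2)))//.
  exact: integrable_abse.
move=> w _; rewrite (_ : g2 y / 2 * Y w ^+ 2 = g2 y * (Y w ^+ 2 / 2))//.
by rewrite mulrAC -mulrA.
Qed.

End average.
End Taylor_class.

(** * Convolution of centred normal laws *)

Section Normal.
Context {R : realType}.
Local Notation mu := (@lebesgue_measure R).

Lemma ge0_integral_normal_prob (m s : R) (f : R -> \bar R) :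
  measurable_fun [set: R] f -> (forall x, 0 <= f x)%E ->
  (\int[normal_prob m s]_x f x = \int[mu]_x (f x * (normal_pdf m s x)%:E))%E.
Proof.
move=> mf f0.
have dom := normal_prob_dominates m s.
rewrite -(Radon_Nikodym_SigmaFinite.change_of_variables dom)//=.
have intf := Radon_Nikodym_SigmaFinite.f_integrable dom.
have mpdf : measurable_fun setT (fun x => (normal_pdf m s x)%:E).
  by apply/measurable_EFinP; exact: measurable_normal_pdf.
apply: ae_eq_integral => //.
- by apply: emeasurable_funM => //; exact: measurable_int intf.
- exact: emeasurable_funM.
- apply: ae_eqe_mul2l; apply: integral_ae_eq => // A _ mA.
  by rewrite -Radon_Nikodym_SigmaFinite.f_integral.
Qed.

Lemma lebesgue_measure_translation (A : set R) (w : R) : measurable A ->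
  pushforward mu (fun x : measurableTypeR R => (x + w)%R : measurableTypeR R) A = mu A.
Proof.
move=> mA; apply/esym.
have mw : measurable_fun setT (fun x : measurableTypeR R => (x + w)%R : measurableTypeR R).
  exact: measurable_funD.
apply: (lebesgue_measure_unique (mu := pushforward mu _)) => //= _ [[a b]] _ <-.
rewrite /pushforward (_ : _ @^-1` _ = `]a - w, b - w]%classic); last first.
  by apply/seteqP; split => x /=; rewrite !in_itv/= ltrBlDr lerBrDr.
rewrite !lebesgue_measure_itv/= !lte_fin ltrD2r.
by case: ifP => // _; rewrite -!EFinB opprB addrA subrK.
Qed.

Lemma ge0_integral_translation (h : R -> \bar R) (w : R) :
  measurable_fun [set: R] h -> (forall x, 0 <= h x)%E ->
  (\int[mu]_x h (x + w)%R = \int[mu]_x h x)%E.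
Proof.
move=> mh h0.
pose shift (x : measurableTypeR R) : measurableTypeR R := x + w.
have mw : measurable_fun setT shift by exact: measurable_funD.
transitivity (\int[pushforward mu shift]_x h x)%E.
  by rewrite ge0_integral_pushforward.
by apply: eq_measure_integral => A mA _; exact: lebesgue_measure_translation.
Qed.

(** Completing the square: the joint density of a summand and the sum is the density of the sum
    times the conditional density of the summand, which is again normal. *)
Lemma normal_pdf_mul (a b c x w : R) : 0 < a -> 0 < b -> 0 < c ->
  c ^+ 2 = a ^+ 2 + b ^+ 2 ->
  normal_pdf 0 a (x - w) * normal_pdf 0 b w =
  normal_pdf 0 c x * normal_pdf (x * b ^+ 2 / c ^+ 2) (a * b / c) w.
Proof.
move=> a0 b0 c0 c2.
have s0 : 0 < a * b / c by rewrite divr_gt0// mulr_gt0.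
have s2E : (a * b / c) ^+ 2 = a ^+ 2 * b ^+ 2 / c ^+ 2 by rewrite expr_div_n exprMn.
have [A0 B0 C0] : [/\ a ^+ 2 != 0, b ^+ 2 != 0 & c ^+ 2 != 0].
  by rewrite !expf_neq0// gt_eqF.
rewrite !normal_pdfE ?gt_eqF//.
have piE (p : R) : (a ^+ 2 * p *+ 2) * (b ^+ 2 * p *+ 2) =
    (c ^+ 2 * p *+ 2) * ((a * b / c) ^+ 2 * p *+ 2).
  rewrite s2E !mulr2n.
  by move: (a ^+ 2) (b ^+ 2) (c ^+ 2) C0 => A B C C0; field.
have pkE : normal_peak a * normal_peak b = normal_peak c * normal_peak (a * b / c).
  have h y : 0 <= y ^+ 2 * pi *+ 2 :> R by rewrite mulrn_wge0// mulr_ge0 ?pi_ge0// sqr_ge0.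
  by rewrite /normal_peak -!invfM -!sqrtrM ?h// piE.
rewrite mulrACA pkE [RHS]mulrACA; congr (_ * _).
rewrite /normal_fun -!expRD s2E !subr0 !mulr2n; congr expR.
move: (a ^+ 2) (b ^+ 2) (c ^+ 2) A0 B0 C0 c2 => A B C A0 B0 C0 CE.
have AB0 : A + B != 0 by rewrite -CE.
by rewrite CE; field; rewrite -!mulr2n !mulrn_eq0/= mulf_eq0 negb_or A0 B0 AB0.
Qed.

(** After a translation and Tonelli, [normal_pdf_mul] isolates the conditional density, whose
    integral is 1. *)
Lemma normal_prob_convolution (a b y : R) (g : R -> \bar R) : 0 < a -> 0 < b ->
  measurable_fun [set: R] g -> (forall x, 0 <= g x)%E ->
  (\int[normal_prob 0 b]_w \int[normal_prob 0 a]_x g (y + w + x)%R =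
   \int[normal_prob 0 (Num.sqrt (a ^+ 2 + b ^+ 2))]_x g (y + x)%R)%E.
Proof.
move=> a0 b0 mg g0; set c := Num.sqrt _.
have ab0 : 0 < a ^+ 2 + b ^+ 2 by rewrite addr_gt0// exprn_gt0.
have c0 : 0 < c by rewrite sqrtr_gt0.
have c2 : c ^+ 2 = a ^+ 2 + b ^+ 2 by rewrite sqr_sqrtr// ltW.
have mgt z : measurable_fun setT (fun x : R => g (z + x)).
  by apply: measurableT_comp => //; exact: measurable_funD.
have mpdf m s : measurable_fun setT (fun x : R => (normal_pdf m s x)%:E).
  by apply/measurable_EFinP; exact: measurable_normal_pdf.
have pdf0 (m s x : R) : (0 <= (normal_pdf m s x)%:E)%E by rewrite lee_fin normal_pdf_ge0.
have m2 : measurable_fun setT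
    (fun z : R * R => (g (y + z.2)%R * (normal_pdf 0 a (z.2 - z.1))%:E)%E).
  apply: emeasurable_funM.
    by apply: measurableT_comp => //; exact: measurable_funD.
  apply/measurable_EFinP; apply: measurableT_comp; first exact: measurable_normal_pdf.
  exact: measurable_funB.
have m2w w : measurable_fun setT
    (fun x => (g (y + x)%R * (normal_pdf 0 a (x - w))%:E)%E).
  exact: (measurableT_comp m2 (measurable_pair1 w)).
have inner w : (\int[normal_prob 0 a]_x g (y + w + x)%R =
    \int[mu]_x (g (y + x)%R * (normal_pdf 0 a (x - w))%:E))%E.
  rewrite (ge0_integral_normal_prob 0 a (mgt (y + w)) (fun=> g0 _)).
  rewrite -[RHS](ge0_integral_translation w (m2w w) (fun=> mule_ge0 (g0 _) (pdf0 _ _ _))).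
  by apply: eq_integral => x _; rewrite addrK [(x + w)%R]addrC addrA.
have mI : measurable_fun setT
    (fun w : R => (\int[mu]_x (g (y + x)%R * (normal_pdf 0 a (x - w))%:E))%E).
  apply: (@measurable_fun_fubini_tonelli_F _ _ _ _ _ mu
    (fun z : R * R => (g (y + z.2)%R * (normal_pdf 0 a (z.2 - z.1))%:E)%E)).
    exact: m2.
  by move=> z; exact: mule_ge0.
have I0 w : (0 <= \int[mu]_x (g (y + x)%R * (normal_pdf 0 a (x - w))%:E))%E.
  by apply: integral_ge0 => z _; exact: mule_ge0.
transitivity (\int[normal_prob 0 b]_w
    \int[mu]_x (g (y + x)%R * (normal_pdf 0 a (x - w))%:E))%E.
  by apply: eq_integral => w _; exact: inner.
rewrite (ge0_integral_normal_prob 0 b mI I0).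
transitivity (\int[mu]_w \int[mu]_x
    (g (y + x)%R * (normal_pdf 0 a (x - w))%:E * (normal_pdf 0 b w)%:E))%E.
  apply: eq_integral => w _; rewrite ge0_integralZr//.
    exact: m2w.
  by move=> x _; exact: mule_ge0.
rewrite (@fubini_tonelli _ _ _ _ _ mu mu
  (fun z : R * R => (g (y + z.2)%R * (normal_pdf 0 a (z.2 - z.1))%:E *
    (normal_pdf 0 b z.1)%:E)%E)); last 2 first.
- apply: emeasurable_funM; first exact: m2.
  exact: (measurableT_comp (mpdf 0 b) measurable_fst).
- by move=> z; apply: mule_ge0 => //; exact: mule_ge0.
rewrite (ge0_integral_normal_prob 0 c (mgt y) (fun=> g0 _)).
apply: eq_integral => x _ /=.
transitivity (\int[mu]_w (g (y + x)%R * (normal_pdf 0 c x)%:E *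
    (normal_pdf (x * b ^+ 2 / c ^+ 2) (a * b / c) w)%:E))%E.
  apply: eq_integral => w _.
  by rewrite -muleA -EFinM (normal_pdf_mul _ _ a0 b0 c0 c2) EFinM muleA.
rewrite ge0_integralZl//; first by rewrite integral_normal_pdf mule1.
- exact: mpdf.
- exact: mule_ge0.
Qed.

End Normal.

(** * Gaussian moments on the half-line by explicit antiderivatives *)

Section Half_line_integrals.
Context {R : realType}.
Local Notation mu := (@lebesgue_measure R).

Lemma ge0_FTC_half_line (f F : R -> R) :
  (forall x, 0 <= x -> 0 <= f x) -> continuous f ->
  (forall x : R, is_derive x 1 F (f x)) -> F x @[x --> +oo] --> (0 : R) ->
  (\int[mu]_(x in `[0%R, +oo[) (f x)%:E = (- F 0)%:E)%E.
Proof.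
move=> f0 cf dF F0.
rewrite (@ge0_continuous_FTC2y _ f F 0 0)//.
- by rewrite sub0e.
- exact: continuous_subspaceT.
- apply: cvg_at_right_filter; apply: differentiable_continuous.
  by apply/derivable1_diffP; case: (dF 0).
- by move=> x _; rewrite derive1E; case: (dF x).
Qed.

Lemma cvg_expRM n : x ^+ n * expR (- x) @[x --> +oo] --> (0 : R).
Proof.
apply: (@squeeze_cvgr _ _ _ _ (cst 0) (fun x => n.+1`!%:R * x^-1)).
- near=> x; have x0 : 0 < x by near: x; exact: nbhs_pinfty_gt.
  rewrite /=; apply/andP; split.
    by apply: mulr_ge0; [apply: exprn_ge0; exact: ltW|exact: expR_ge0].
  rewrite expRN ler_pdivrMr ?expR_gt0// mulrAC ler_pdivlMr// -exprSr.
  rewrite -ler_pdivrMl ?ltr0n ?fact_gt0//.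
  by rewrite (le_trans _ (expR_ge1Dxn n (ltW x0)))// mulrC lerDr.
- exact: cvg_cst.
- rewrite -[X in _ --> X](mulr0 n.+1`!%:R); apply: cvgM; first exact: cvg_cst.
  by apply/gtr0_cvgV0; [near=> x; near: x; exact: nbhs_pinfty_gt | exact: cvg_id].
Unshelve. all: by end_near. Qed.

Lemma integral_expRN :
  (\int[mu]_(x in `[0%R, +oo[) (expR (- x))%:E = 1)%E.
Proof.
have dF (x : R) : is_derive x 1 (fun x => - expR (- x)) (expR (- x)).
  by apply: is_derive_eq; rewrite mulrN1 opprK.
rewrite (ge0_FTC_half_line _ _ dF).
- by rewrite oppr0 expR0 opprK.
- by move=> x _; exact: expR_ge0.
- by move=> x; apply: continuous_comp; [exact: opp_continuous|exact: continuous_expR].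
- by rewrite -oppr0; apply: cvgN; exact: cvgr_expR.
Qed.

Lemma is_derive_poly_expRN (p q : {poly R}) (x : R) :
  is_derive x 1 (fun x => p.[x] * expR (- q.[x]))
    ((p^`().[x] - p.[x] * q^`().[x]) * expR (- q.[x])).
Proof.
have dq : is_derive x 1 (fun x => expR (- q.[x])) (expR (- q.[x]) * (- q^`().[x])).
  by apply: is_derive_eq.
apply: (is_derive_eq (is_deriveM (is_derive_poly p x) dq)).
by rewrite /GRing.scale/=; ring.
Qed.

Lemma continuous_poly_expRN (p q : {poly R}) :
  continuous (fun x => p.[x] * expR (- q.[x])).
Proof.
move=> x; apply: differentiable_continuous; apply/derivable1_diffP.
by case: (is_derive_poly_expRN p q x).
Qed.

Section gauss.
Variable s : R.
Hypothesis s0 : 0 < s.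
Let sn0 : s != 0. Proof. by rewrite gt_eqF. Qed.
Let q : {poly R} := (2 * s ^+ 2)^-1 *: 'X ^+ 2.

Let qE x : q.[x] = x ^+ 2 / (2 * s ^+ 2).
Proof. by rewrite /q hornerZ hornerXn mulrC. Qed.

Let dqE x : q^`().[x] = x / s ^+ 2.
Proof.
rewrite /q derivZ derivXn hornerZ hornerMn hornerXn expr1 -mulr_natl.
by field; rewrite ?sn0.
Qed.

Let normalE x : normal_fun 0 s x = expR (- q.[x]).
Proof. by rewrite /normal_fun qE subr0 mulNr -[_ ^+ _ *+ 2]mulr_natl. Qed.

Let q_oo : q.[x] @[x --> +oo] --> +oo.
Proof.
apply/cvgryPge => A; near=> x.
have s20 : 0 < 2 * s ^+ 2 by rewrite mulr_gt0// exprn_gt0.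
have x1 : 1 <= x by near: x; apply: nbhs_pinfty_ge; rewrite num_real.
have xA : A * (2 * s ^+ 2) <= x by near: x; apply: nbhs_pinfty_ge; rewrite num_real.
rewrite qE ler_pdivlMr// (le_trans xA)// expr2 ler_peMr//.
Unshelve. all: by end_near. Qed.

Let cvg_qM n : q.[x] ^+ n * expR (- q.[x]) @[x --> +oo] --> (0 : R).
Proof.
apply: (@cvg_comp _ _ _ (horner q) (fun t => t ^+ n * expR (- t))).
  exact: q_oo.
exact: cvg_expRM.
Qed.

Lemma integral_gauss_moment3 :
  (\int[mu]_(x in `[0%R, +oo[) (x ^+ 3 * normal_fun 0 s x)%:E =
   (2 * s ^+ 4)%:E)%E.
Proof.
(* The polynomial factor of the antiderivative, as obtained from integration by parts. *)
pose p : {poly R} := - (s ^+ 2 *: 'X^2 + (2 * s ^+ 4)%:P).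
have pE x : p.[x] = - (s ^+ 2 * x ^+ 2 + 2 * s ^+ 4).
  by rewrite /p hornerN hornerD hornerZ hornerXn hornerC.
have dpE x : p^`().[x] = - (2 * s ^+ 2 * x).
  rewrite /p derivN derivD derivZ derivXn derivC addr0 hornerN hornerZ hornerMn.
  by rewrite hornerXn expr1 -mulr_natl; ring.
have dF (x : R) : is_derive x 1 (fun x => p.[x] * expR (- q.[x]))
    (x ^+ 3 * normal_fun 0 s x).
  apply: (is_derive_eq (is_derive_poly_expRN p q x)).
  by rewrite normalE pE dpE dqE; field; rewrite ?sn0.
rewrite (ge0_FTC_half_line _ _ dF).
- by rewrite pE qE !expr0n/= mulr0 mul0r oppr0 expR0 add0r mulr1 opprK.
- by move=> x x0; rewrite mulr_ge0 ?exprn_ge0// normal_fun_ge0.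
- under eq_fun do rewrite normalE -[_ ^+ 3]hornerXn.
  exact: continuous_poly_expRN.
- rewrite (_ : (fun x => _) = (fun x => - (2 * s ^+ 4 * (q.[x] ^+ 1 * expR (- q.[x])) +
     2 * s ^+ 4 * (q.[x] ^+ 0 * expR (- q.[x]))))); last first.
    by apply/funext => x; rewrite pE expr1 expr0; set e := expR _; rewrite qE; field; rewrite ?sn0.
  rewrite -oppr0; apply: cvgN; rewrite -[X in _ --> X](addr0 0).
  by rewrite -[X in _ --> X + X](mulr0 (2 * s ^+ 4)); apply: cvgD; apply: cvgMr; exact: cvg_qM.
Qed.

Lemma integral_gauss_moment2 :
  (\int[mu]_(x in `[0%R, +oo[) (x ^+ 2 * normal_fun 0 s x)%:E =
   (s ^+ 2)%:E * \int[mu]_(x in `[0%R, +oo[) (normal_fun 0 s x)%:E)%E.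
Proof.
(* The natural integrand [x ^ 2 - s ^ 2] times the Gaussian changes sign, whereas
   [ge0_FTC_half_line] asks for a nonnegative one. The added term [C exp (- x)] dominates the
   negative part, since [(x - s ^ 2) ^ 2 >= 0]; its integral is [C] and is removed at the end. *)
pose C := s ^+ 2 * expR (s ^+ 2 / 2).
have C0 : 0 <= C by rewrite mulr_ge0 ?sqr_ge0 ?expR_ge0.
pose f x := x ^+ 2 * normal_fun 0 s x - s ^+ 2 * normal_fun 0 s x + C * expR (- x).
pose F x := (- (s ^+ 2 *: 'X) : {poly R}).[x] * expR (- q.[x])
   - (C%:P : {poly R}).[x] * expR (- ('X : {poly R}).[x]).
have dF (x : R) : is_derive x 1 F (f x).
  apply: (is_derive_eq (is_deriveB (is_derive_poly_expRN _ q x)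
    (is_derive_poly_expRN C%:P 'X x))).
  rewrite dqE -normalE derivN derivZ !derivX derivC !hornerN !hornerZ !hornerC !hornerX.
  by rewrite /f; field; rewrite ?sn0.
have f0 x : 0 <= f x.
  rewrite /f -addrA; apply: addr_ge0.
    by rewrite mulr_ge0 ?sqr_ge0 ?normal_fun_ge0.
  rewrite addrC subr_ge0 /C -mulrA ler_wpM2l ?sqr_ge0// -expRD normalE ler_expR qE.
  have -> : s ^+ 2 / 2 + - x = - (x ^+ 2 / (2 * s ^+ 2)) + (x - s ^+ 2) ^+ 2 / (2 * s ^+ 2).
    by field; rewrite ?sn0.
  by rewrite lerDl divr_ge0 ?sqr_ge0// mulr_ge0 ?sqr_ge0.
have cgauss : continuous (normal_fun 0 s).
  move=> x; rewrite (_ : normal_fun 0 s = fun x => (1%:P : {poly R}).[x] * expR (- q.[x])); last first.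
    by apply/funext => y; rewrite normalE hornerC mul1r.
  exact: continuous_poly_expRN.
have mE (h : R -> R) : continuous h -> measurable_fun (`[0%R, +oo[%classic : set R) (fun x => (h x)%:E).
  move=> ch; apply/measurable_EFinP; apply: measurable_funTS.
  exact: continuous_measurable_fun.
have cX2 : continuous (fun x : R => x ^+ 2 * normal_fun 0 s x).
  by under eq_fun do rewrite normalE -[_ ^+ 2]hornerXn; exact: continuous_poly_expRN.
have cexp : continuous (fun x : R => expR (- x)).
  by move=> x; apply: continuous_comp; [exact: opp_continuous|exact: continuous_expR].
have cf : continuous f.
  move=> x; apply: cvgD; last by apply: cvgMr; exact: cexp.
  by apply: cvgB; [exact: cX2|apply: cvgMr; exact: cgauss].
have IF : (\int[mu]_(x in `[0%R, +oo[) (f x)%:E = C%:E)%E.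
  rewrite (ge0_FTC_half_line (fun x _ => f0 x) cf dF).
    by rewrite /F hornerC hornerX hornerN hornerZ hornerX oppr0 expR0 !mulr0 oppr0 mul0r sub0r mulr1 opprK.
  rewrite (_ : F = fun x => - (s ^+ 2 * (x * expR (- q.[x])) + C * expR (- x))); last first.
    apply/funext => x; rewrite /F; set e := expR (- q.[x]).
    by rewrite hornerC hornerX hornerN hornerZ hornerX; ring.
  rewrite -oppr0; apply: cvgN; rewrite -[X in _ --> X](addr0 0); apply: cvgD.
    rewrite -[X in _ --> X](mulr0 (s ^+ 2)); apply: cvgMr.
    apply: (@squeeze_cvgr _ _ _ _ (cst 0)
      (fun x => 2 * s ^+ 2 * (q.[x] ^+ 1 * expR (- q.[x])))).
    - near=> x; have x1 : 1 <= x by near: x; exact: nbhs_pinfty_ge.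
      have x0 : 0 <= x by rewrite (le_trans _ x1).
      apply/andP; split; first by rewrite /= mulr_ge0 ?expR_ge0.
      rewrite mulrA ler_wpM2r ?expR_ge0// expr1 qE mulrC divfK ?mulf_neq0 ?expf_neq0//.
      by rewrite expr2 ler_peMr.
    - exact: cvg_cst.
    - rewrite -[X in _ --> X](mulr0 (2 * s ^+ 2)); apply: cvgMr; exact: cvg_qM.
  by rewrite -[X in _ --> X](mulr0 C); apply: cvgMr; exact: cvgr_expR.
have E : (\int[mu]_(x in `[0%R, +oo[) (f x)%:E + 
   (s ^+ 2)%:E * \int[mu]_(x in `[0%R, +oo[) (normal_fun 0 s x)%:E = 
   \int[mu]_(x in `[0%R, +oo[) (x ^+ 2 * normal_fun 0 s x)%:E + 
   C%:E * \int[mu]_(x in `[0%R, +oo[) (expR (- x))%:E)%E.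
  have Z (k : R) (h : R -> R) : 0 <= k -> continuous h -> (forall x, 0 <= h x) ->
      (k%:E * \int[mu]_(x in `[0%R, +oo[) (h x)%:E =
       \int[mu]_(x in `[0%R, +oo[) (k * h x)%:E)%E.
    move=> k0 ch h0; rewrite -ge0_integralZl//; first exact: mE.
    by move=> x _; rewrite lee_fin.
  have D (h1 h2 : R -> R) : continuous h1 -> continuous h2 ->
      (forall x, 0 <= h1 x) -> (forall x, 0 <= h2 x) ->
      (\int[mu]_(x in `[0%R, +oo[) (h1 x)%:E +
       \int[mu]_(x in `[0%R, +oo[) (h2 x)%:E =
       \int[mu]_(x in `[0%R, +oo[) (h1 x + h2 x)%:E)%E.
    move=> c1 c2 h10 h20; rewrite -ge0_integralD//.
    - by move=> x _; rewrite lee_fin.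
    - exact: mE.
    - by move=> x _; rewrite lee_fin.
    - exact: mE.
  have ge0n x : 0 <= normal_fun 0 s x by exact: normal_fun_ge0.
  rewrite !Z ?sqr_ge0//.
  rewrite !D//; first by apply: eq_integral => x _; congr (_%:E); rewrite /f; ring.
  - by move=> x; apply: cvgMr; exact: cexp.
  - by move=> x; rewrite mulr_ge0 ?sqr_ge0.
  - by move=> x; rewrite mulr_ge0 ?expR_ge0.
  - by move=> x; apply: cvgMr; exact: cgauss.
  - by move=> x; rewrite mulr_ge0 ?sqr_ge0.
move: E; rewrite IF integral_expRN mule1 [LHS]addeC => E.
rewrite -[RHS](@addeK _ C%:E)// E addeK//.
Unshelve. all: by end_near. Qed.
End gauss.
End Half_line_integrals.

(** * Second and third absolute moments of a centred normal law *)

Section Normal_moments.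
Context {R : realType}.
Local Notation mu := (@lebesgue_measure R).
Variable s : R.
Hypothesis s0 : 0 < s.

Let nonneg_set : [set x : R | 0 <= x] = `[0, +oo[%classic.
Proof. by apply/seteqP; split => x /=; rewrite in_itv/= andbT. Qed.

Let pdfE x : normal_pdf 0 s x = normal_peak s * normal_fun 0 s x.
Proof. by rewrite normal_pdfE// gt_eqF. Qed.

Let continuous_normal_fun0 : continuous (normal_fun 0 s).
Proof.
move=> x; rewrite (_ : normal_fun 0 s = (fun x => (normal_peak s)^-1 * normal_pdf 0 s x)).
  by apply: cvgMr; apply: continuous_normal_pdf; rewrite gt_eqF.
by apply/funext => y; rewrite pdfE mulKf// gt_eqF// normal_peak_gt0// gt_eqF.
Qed.

Let even_integral (h : R -> R) : (forall x, 0 <= h x) -> continuous h ->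
  (forall x, h (- x) = h x) ->
  (\int[normal_prob 0 s]_x (h x)%:E = (2 * normal_peak s)%:E *
    \int[mu]_(x in `[0%R, +oo[) (h x * normal_fun 0 s x)%:E)%E.
Proof.
move=> h0 ch hN.
have chn : continuous (fun x => h x * normal_fun 0 s x).
  by move=> x; apply: cvgM; [exact: ch|exact: continuous_normal_fun0].
have mh := continuous_measurable_fun ch.
have mhn := continuous_measurable_fun chn.
have hn0 x : 0 <= h x * normal_fun 0 s x by rewrite mulr_ge0// normal_fun_ge0.
rewrite ge0_integral_normal_prob//; last exact/measurable_EFinP.
under eq_integral do rewrite -EFinM pdfE mulrCA EFinM.
rewrite ge0_integralZl//; first last.
- by rewrite lee_fin normal_peak_ge0.
- by move=> x _; rewrite lee_fin.
- exact/measurable_EFinP.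
rewrite ge0_symfun_integralT//; last first.
  by move=> x /=; rewrite hN /normal_fun !subr0 sqrrN.
by rewrite nonneg_set muleA -EFinM mulrC.
Qed.

Lemma normal_prob_moment2 : (\int[normal_prob 0 s]_x (x ^+ 2)%:E = (s ^+ 2)%:E)%E.
Proof.
have c2 : continuous (fun x : R => x ^+ 2) by exact: exprn_continuous.
rewrite even_integral//; [|by move=> x; exact: sqr_ge0|by move=> x; rewrite sqrrN].
rewrite integral_gauss_moment2// muleCA.
have := @even_integral (cst 1) (fun=> ler01) (fun=> cvg_cst _) (fun=> erefl).
have -> : (\int[normal_prob 0 s]_x (cst 1 x)%:E = 1)%E.
  by rewrite -[LHS]/(\int[normal_prob 0 s]_x (cst 1%E x))%E integral_cst//= mul1e probability_setT.
by under eq_integral do rewrite /= mul1r; move=> <-; rewrite mule1.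
Qed.

(** The exact value is [4 * s ^+ 4 * normal_peak s], and the peak is at most [1 / s] because
    [2 pi >= 1]. *)
Lemma normal_prob_abs_moment3 :
  (\int[normal_prob 0 s]_x (`|x| ^+ 3)%:E <= (4 * s ^+ 3)%:E)%E.
Proof.
have c3 : continuous (fun x : R => `|x| ^+ 3).
  move=> x; apply: (@cvg_comp _ _ _ (fun x : R => `|x|) (fun y => y ^+ 3)).
    exact: (@norm_continuous _ R^o).
  exact: exprn_continuous.
rewrite even_integral//; last by move=> x; rewrite normrN.
have -> : (\int[mu]_(x in `[0%R, +oo[) (`|x| ^+ 3 * normal_fun 0 s x)%:E =
    \int[mu]_(x in `[0%R, +oo[) (x ^+ 3 * normal_fun 0 s x)%:E)%E.
  by apply: eq_integral => x; rewrite inE/= in_itv/= andbT => x0; rewrite ger0_norm.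
rewrite integral_gauss_moment3// -EFinM lee_fin.
have -> : 2 * normal_peak s * (2 * s ^+ 4) = 4 * s ^+ 4 * normal_peak s by ring.
have -> : 4 * s ^+ 3 = 4 * s ^+ 4 * s^-1 by field; rewrite gt_eqF.
apply: ler_wpM2l; first by rewrite mulr_ge0// exprn_ge0// ltW.
have s2pi : 0 < s ^+ 2 * pi *+ 2 by rewrite mulrn_wgt0// mulr_gt0 ?exprn_gt0 ?pi_gt0.
rewrite /normal_peak lef_pV2 ?posrE ?sqrtr_gt0//.
rewrite -[leLHS]gtr0_norm// -sqrtr_sqr; apply: ler_wsqrtr.
rewrite -mulrnAr ler_peMr ?sqr_ge0// mulr2n.
by have := pi_ge2 R; lra.
Qed.
End Normal_moments.

(** * Gaussian averaging: second-order expansion and semigroup property *)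

Section Gaussian_average.
Context {R : realType}.

Lemma normal_prob_integrable (s : R) : 0 < s ->
  [/\ (normal_prob 0 s).-integrable setT (EFin \o (fun x : R => x)),
      (normal_prob 0 s).-integrable setT (EFin \o (fun x : R => x ^+ 2)) &
      (normal_prob 0 s).-integrable setT (EFin \o (fun x : R => `|x| ^+ 3))].
Proof.
move=> s0.
have mX n : measurable_fun setT (EFin \o (fun x : R => x ^+ n)).
  by apply/measurable_EFinP; exact: measurable_funX.
have i2 : (normal_prob 0 s).-integrable setT (EFin \o (fun x : R => x ^+ 2)).
  apply/integrableP; split; first exact: mX.
  under eq_integral do rewrite /= ger0_norm ?sqr_ge0//.
  by rewrite /= normal_prob_moment2// ltry.
have i3 : (normal_prob 0 s).-integrable setT (EFin \o (fun x : R => `|x| ^+ 3)).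
  apply/integrableP; split.
    apply/measurable_EFinP; apply: measurable_funX. exact: (measurableT_comp (@normr_measurable R setT) (@measurable_id _ _ setT)).
  under eq_integral do rewrite /= ger0_norm ?exprn_ge0//.
  by rewrite (le_lt_trans (normal_prob_abs_moment3 s0))// ltry.
split => //.
have iD : (normal_prob 0 s).-integrable setT (EFin \o (fun x : R => 1 + x ^+ 2)).
  have ic : (normal_prob 0 s).-integrable setT (EFin \o (fun x : R => 1)).
    exact: (finite_measure_integrable_cst _ _ measurableT).
  exact: (integrableD measurableT ic i2).
apply: (le_integrable measurableT _ _ iD).
  exact/measurable_EFinP.
move=> x _; rewrite /= lee_fin [leRHS]ger0_norm ?addr_ge0 ?sqr_ge0//.
rewrite -(real_normK (num_real x)).
by have := sqr_ge0 (`|x| - 1); have := normr_ge0 x; nra.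
Qed.

(** The law is invariant under reflection, so the mean equals its opposite. *)
Lemma normal_prob_mean (s : R) : 0 < s -> \int[normal_prob 0 s]_x x = 0.
Proof.
move=> s0.
have sym (A : set R) : measurable A ->
    pushforward (normal_prob 0 s) (-%R : R -> measurableTypeR R) A = normal_prob 0 s A.
  move=> mA.
  have mNA : measurable ((-%R : R -> R) @^-1` A).
    by rewrite -[X in measurable X]setTI; exact: oppr_measurable.
  have mpdf (B : set R) : measurable_fun B (fun x : R => (normal_pdf 0 s x)%:E).
    by apply: measurable_funTS; apply/measurable_EFinP; exact: measurable_normal_pdf.
  rewrite /pushforward /normal_prob.
  transitivity (\int[pushforward lebesgue_measure (-%R : R -> measurableTypeR R)]_(x in A)
      (normal_pdf 0 s x)%:E)%E; last first.
    by apply: eq_measure_integral => B mB _; exact: lebesgue_measureN.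
  rewrite ge0_integral_pushforward; last 4 first.
  - exact: oppr_measurable.
  - exact: mA.
  - exact: mpdf.
  - by move=> x _; rewrite lee_fin normal_pdf_ge0.
  apply: eq_integral => x _ /=.
  by rewrite !normal_pdfE ?gt_eqF// /normal_fun !subr0 sqrrN.
have [i1 _ _] := normal_prob_integrable s0.
have i1N : (normal_prob 0 s).-integrable setT (EFin \o (fun x : R => - x)).
  under eq_fun do rewrite -mulN1r; exact: (integrableZl measurableT (-1) i1).
have E : (\int[normal_prob 0 s]_x x%:E = \int[normal_prob 0 s]_x (- x)%:E)%E.
  transitivity (\int[pushforward (normal_prob 0 s) (-%R : R -> measurableTypeR R)]_x x%:E)%E.
    by apply: eq_measure_integral => A mA _; apply/esym; exact: sym.
  by rewrite integral_pushforward//; exact/measurable_EFinP.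
have : \int[normal_prob 0 s]_x x = - \int[normal_prob 0 s]_x x.
  rewrite -[RHS]mulN1r -RintegralZl//.
  rewrite {1}/Rintegral E; congr fine; apply: eq_integral => x _.
  by rewrite mulN1r.
lra.
Qed.

Lemma taylor3_normal (M s : R) (g g1 g2 : R -> R) (y : R) : 0 < s -> 0 <= M ->
  measurable_fun setT g -> (forall z, `|g z| <= M) ->
  (forall y h, `|g (y + h) - g y - g1 y * h - g2 y * (h ^+ 2 / 2)| <=
          M * `|h| ^+ 3) ->
  `|translation_average (normal_prob 0 s) idfun g y - g y - g2 y / 2 * s ^+ 2|
    <= M * (4 * s ^+ 3).
Proof.
move=> s0 M0 mg gM gT; have [i1 i2 i3] := normal_prob_integrable s0.
have mid : measurable_fun [set: measurableTypeR R] (idfun : measurableTypeR R -> R).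
  exact: measurable_id.
have := @taylor3_expectation R _ _ (normal_prob 0 s) idfun mid M g g1 g2 y mg gM gT i1 i2 i3.
rewrite /= normal_prob_mean// mulr0 subr0.
rewrite [X in g2 y / 2 * X](_ : _ = s ^+ 2); last first.
  by rewrite /Rintegral normal_prob_moment2.
move=> /le_trans; apply; apply: ler_wpM2l => //.
rewrite -lee_fin EFin_Rintegral//; exact: normal_prob_abs_moment3.
Qed.

(** The convolution identity for nonnegative functions, transferred to bounded ones through
    [g + M]. *)
Lemma normal_average_comp (a b M : R) (g : R -> R) (y : R) : 0 < a -> 0 < b ->
  measurable_fun setT g -> (forall z, `|g z| <= M) ->
  translation_average (normal_prob 0 b) idfun
    (translation_average (normal_prob 0 a) idfun g) y =
  translation_average (normal_prob 0 (Num.sqrt (a ^+ 2 + b ^+ 2))) idfun g y.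
Proof.
move=> a0 b0 mg gM; set c := Num.sqrt _.
have mid : measurable_fun [set: measurableTypeR R] (idfun : measurableTypeR R -> R).
  exact: measurable_id.
have Mg z : 0 <= g z + M.
  by rewrite -lerBlDr sub0r; have := gM z; rewrite ler_norml => /andP[].
have mgM : measurable_fun setT (fun x => (g x + M)%:E).
  by apply/measurable_EFinP; exact: measurable_funD.
have iM (s : R) : (normal_prob 0 s).-integrable setT (EFin \o (fun x : R => M)).
  exact: finite_measure_integrable_cst.
have ig (s z : R) : (normal_prob 0 s).-integrable setT (EFin \o (fun x : R => g (z + x))).
  by apply: (@bounded_integrable _ _ _ _ _ M) => //; exact: (measurable_translate mid _ mg).
have igM (s z : R) : (normal_prob 0 s).-integrable setT (EFin \o (fun x : R => g (z + x) + M)).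
  exact: (integrableD measurableT (ig s z) (iM s)).
have ta s z : translation_average (normal_prob 0 s) idfun g z =
    fine (\int[normal_prob 0 s]_x (g (z + x) + M)%:E) - M.
  rewrite -[fine _]/(\int[normal_prob 0 s]_x (g (z + x) + M)).
  by rewrite (RintegralD measurableT (ig s z) (iM s)) Rintegral_cst_prob addrK.
have := @normal_prob_convolution R a b y _ a0 b0 mgM Mg.
rewrite -/c => /(congr1 fine) E.
rewrite [RHS]ta -E.
have it : (normal_prob 0 b).-integrable setT
    (EFin \o (fun w => translation_average (normal_prob 0 a) idfun g (y + w))).
  apply: (@bounded_integrable _ _ _ _ _ M).
    apply: (@measurable_translate _ _ _ idfun mid).
    exact: (measurable_translation_average _ mid mg gM).
  by move=> w; exact: (normr_translation_average _ mid _ mg gM).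
have E2 := RintegralD measurableT it (iM b).
rewrite (Rintegral_cst_prob (normal_prob 0 b)) in E2.
apply: (addIr M); rewrite subrK -[LHS]E2 /Rintegral.
congr fine; apply: eq_integral => w _.
rewrite ta subrK fineK; first by reflexivity.
exact: (integrable_fin_num measurableT (igM a (y + w))).
Qed.

End Gaussian_average.

(** * Integrating out an independent summand *)

Section Independent_average.
Context {d : measure_display} {T : measurableType d} {R : realType}.
Variable P : probability T R.
Variables S Y : T -> R.
Hypothesis mS : measurable_fun setT S.
Hypothesis mY : measurable_fun setT Y.
Hypothesis indSY : independent2 P S Y.

HB.instance Definition _ := isMeasurableFun.Build _ _ _ _ S mS.
HB.instance Definition _ := isMeasurableFun.Build _ _ _ _ Y mY.

Lemma Rintegral_independent_add (g : R -> R) (M : R) :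
  measurable_fun setT g -> (forall z, `|g z| <= M) ->
  \int[P]_w g (S w + Y w) = \int[P]_w translation_average P Y g (S w).
Proof.
move=> mg gM.
have Mg z : 0 <= g z + M.
  by rewrite -lerBlDr sub0r; have := gM z; rewrite ler_norml => /andP[].
have iM : P.-integrable setT (EFin \o (fun w : T => M)).
  exact: finite_measure_integrable_cst.
have ig z : P.-integrable setT (EFin \o (fun w => g (z + Y w))).
  by apply: (bounded_integrable _ (M := M)) => //; exact: measurable_translate.
have igS : P.-integrable setT (EFin \o (fun w => g (S w + Y w))).
  apply: (bounded_integrable _ (M := M)) => //.
  by apply: measurableT_comp => //; exact: measurable_funD.
have mt := measurable_translation_average P mY mg gM.
have it : P.-integrable setT (EFin \o (fun w => translation_average P Y g (S w))).
  apply: (bounded_integrable _ (M := M)) => [|w]; first exact: measurableT_comp.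
  exact: normr_translation_average.
have mgM : measurable_fun [set: R * R] (fun z => (g (z.1 + z.2) + M)%:E).
  apply/measurable_EFinP; apply: measurable_funD => //.
  by apply: measurableT_comp => //; exact: measurable_funD.
have /(congr1 fine) := ge0_integral_independent indSY mgM (fun z => Mg _).
rewrite -[LHS]/(\int[P]_w (g (S w + Y w) + M)).
rewrite (RintegralD measurableT igS iM) (Rintegral_cst_prob P) => E.
apply: (addIr M); rewrite E.
have := RintegralD measurableT it iM; rewrite (Rintegral_cst_prob P) => <-.
congr fine; apply: eq_integral => w _ /=.
have := RintegralD measurableT (ig (S w)) iM; rewrite (Rintegral_cst_prob P).
rewrite -[translation_average _ _ _ _]/(\int[P]_w' g (S w + Y w')) => <-.
rewrite fineK; first reflexivity.
exact: (integrable_fin_num measurableT (integrableD measurableT (ig (S w)) iM)).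
Qed.

Lemma ge0_integral_independent_add (g : R -> R) :
  measurable_fun setT g -> (forall z, 0 <= g z) ->
  (\int[P]_w (g (S w + Y w))%:E = \int[P]_w \int[P]_w' (g (S w + Y w'))%:E)%E.
Proof.
move=> mg g0.
have mg2 : measurable_fun [set: R * R] (fun z => (g (z.1 + z.2))%:E).
  by apply/measurable_EFinP; apply: measurableT_comp => //; exact: measurable_funD.
exact: (ge0_integral_independent indSY mg2 (fun z => g0 _)).
Qed.

End Independent_average.

(** * Lindeberg's replacement method *)

Section Lindeberg.
Context {d : measure_display} {T : measurableType d} {R : realType}.
Variable P : probability T R.
Variables (X : nat -> {RV P >-> R}) (f : R -> R).
Hypothesis indX : mutually_independent X.
Hypothesis mf : measurable_fun setT f.

Local Notation G s := (translation_average (normal_prob 0 s) (idfun : R -> R)).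

Let mfX i : measurable_fun setT (f \o X i).
Proof. exact: measurableT_comp. Qed.

Let mid : measurable_fun [set: measurableTypeR R] (idfun : measurableTypeR R -> R).
Proof. exact: measurable_id. Qed.

Lemma taylor3_iter_normal (s M : R) (g : R -> R) j :
  taylor3 M g -> taylor3 M (iter j (G s) g).
Proof.
move=> gM; elim: j => [//|j IH]; rewrite iterS.
exact: (taylor3_translation_average (normal_prob 0 s) mid IH).
Qed.

(** Induction on [j]: independence integrates out the last summand, [step] replaces its averaging
    operator by the Gaussian one at cost [delta], and [G s g] stays in the class with the same [M],
    so the induction hypothesis applies to it. *)
Lemma lindeberg_replacement (n : nat) (s M delta : R) :
  (forall i g y, (i < n)%N -> taylor3 M g ->
     `|translation_average P (f \o X i) g y - G s g y| <= delta) ->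
  forall j g, (j <= n)%N -> taylor3 M g ->
  `|\int[P]_w g (partial_sum X f j w) - iter j (G s) g 0| <= j%:R * delta.
Proof.
move=> step; elim=> [|j IH] g jn gM.
  rewrite mul0r normr_le0 /= subr_eq0 (_ : (fun w => _) = fun=> g 0).
    by rewrite Rintegral_cst_prob.
  by apply/funext => w; rewrite /partial_sum big_ord0.
have [g1 [g2 [[mg gB] _ _ _]]] := gM.
have GM : taylor3 M (G s g) by exact: (taylor3_translation_average (normal_prob 0 s) mid gM).
have [_ [_ [[mGg GgB] _ _ _]]] := GM.
have E : \int[P]_w g (partial_sum X f j.+1 w) =
    \int[P]_w translation_average P (f \o X j) g (partial_sum X f j w).
  under eq_Rintegral do rewrite partial_sumS.
  apply: (@Rintegral_independent_add _ _ _ P (partial_sum X f j) (f \o X j) _ _ _ g M) => //.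
    exact: measurable_partial_sum.
  exact: independent_partial_sum.
rewrite E iterSr.
rewrite -(subrKA (\int[P]_w G s g (partial_sum X f j w))) -natr1 mulrDl mul1r.
rewrite (le_trans (ler_normD _ _))// addrC lerD ?IH ?(ltnW jn)//.
have mS : measurable_fun setT (partial_sum X f j) by exact: measurable_partial_sum.
have mt := measurable_translation_average P (mfX j) mg gB.
have i1 : P.-integrable setT (EFin \o (fun w =>
    translation_average P (f \o X j) g (partial_sum X f j w))).
  apply: (bounded_integrable _ (M := M)) => [|w]; first exact: measurableT_comp.
  exact: normr_translation_average.
have i2 : P.-integrable setT (EFin \o (fun w => G s g (partial_sum X f j w))).
  by apply: (bounded_integrable _ (M := M)) => //; exact: measurableT_comp.
rewrite -(RintegralB measurableT i1 i2).
apply: normr_Rintegral_le => [|w]; last exact: step.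
by apply: measurable_funB; exact: measurableT_comp.
Qed.

Lemma iter_normal_average (s M : R) (g : R -> R) j y : 0 < s ->
  measurable_fun setT g -> (forall z, `|g z| <= M) ->
  iter j.+1 (G s) g y = G (s * Num.sqrt j.+1%:R) g y.
Proof.
move=> s0 mg gM; elim: j y => [|j IH] y; first by rewrite sqrtr1 mulr1.
rewrite iterS (_ : iter j.+1 (G s) g = G (s * Num.sqrt j.+1%:R) g); last exact/funext.
have sj0 : 0 < s * Num.sqrt j.+1%:R by rewrite mulr_gt0// sqrtr_gt0 ltr0n.
rewrite (normal_average_comp y sj0 s0 mg gM).
suff -> : Num.sqrt ((s * Num.sqrt j.+1%:R) ^+ 2 + s ^+ 2) =
    s * Num.sqrt j.+2%:R by reflexivity.
rewrite exprMn sqr_sqrtr ?ler0n// -[X in _ + X]mulr1 -mulrDr natr1.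
by rewrite sqrtrM ?sqr_ge0// sqrtr_sqr ger0_norm// ltW.
Qed.

(** With steps of variance [1 / n] the [n] Gaussian operators compose to the standard normal. One
    replacement costs the mismatch of the first two moments plus the two third absolute moments. *)
Lemma clt_bound (n : nat) (M a b c : R) (g : R -> R) : (0 < n)%N ->
  taylor3 M g ->
  (forall i, (i < n)%N ->
    [/\ P.-integrable setT (EFin \o (f \o X i)),
        P.-integrable setT (EFin \o (fun w => f (X i w) ^+ 2)) &
        P.-integrable setT (EFin \o (fun w => `|f (X i w)| ^+ 3))]) ->
  (forall i, (i < n)%N ->
    [/\ `|\int[P]_w f (X i w)| <= a,
        `|\int[P]_w (f (X i w) ^+ 2) - n%:R^-1| <= b &
        \int[P]_w (`|f (X i w)| ^+ 3) <= c]) ->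
  `|\int[P]_w g (partial_sum X f n w) - \int[normal_prob 0 1]_x g x| <=
    n%:R * (M * (a + b / 2 + c + 4 * (Num.sqrt n%:R)^-1 ^+ 3)).
Proof.
move=> n0 gM ifX mom.
pose s : R := (Num.sqrt n%:R)^-1.
have s0 : 0 < s by rewrite invr_gt0 sqrtr_gt0 ltr0n.
have s2 : s ^+ 2 = n%:R^-1 by rewrite exprVn sqr_sqrtr ?ler0n.
have [g1 [g2 [[mg gB] _ _ _]]] := gM.
have M0 : 0 <= M by exact: le_trans (normr_ge0 _) (gB 0).
have <- : iter n (G s) g 0 = \int[normal_prob 0 1]_x g x.
  have s1 : s * Num.sqrt n%:R = 1 by rewrite mulVf// gt_eqF// sqrtr_gt0 ltr0n.
  have E := iter_normal_average n.-1 0 s0 mg gB.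
  rewrite (prednK n0) s1 in E; rewrite E /translation_average.
  by apply: eq_Rintegral => x _ /=; rewrite add0r.
apply: (@lindeberg_replacement n s M) => //.
move=> i h y ilt hM.
have [h1 [h2 [[mh hB] [_ h1B] [_ h2B] hT]]] := hM.
have [I1 I2 I3] := ifX i ilt; have [m1 m2 m3] := mom i ilt.
have TP := taylor3_expectation (mfX i) y mh hB hT I1 I2 I3.
have TG := taylor3_normal y s0 M0 mh hB hT.
rewrite s2 in TG.
set A := translation_average P _ _ _ in TP *.
set B := G s h y in TG *.
set u := \int[P]_w _ in TP m1.
set v := \int[P]_w _ in TP m2.
set t := \int[P]_w _ in TP m3.
have -> : A - B = (A - h y - h1 y * u - h2 y / 2 * v) - (B - h y - h2 y / 2 * n%:R^-1)
    + h1 y * u + h2 y / 2 * (v - n%:R^-1) by ring.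
rewrite (le_trans (ler_normD _ _))// (le_trans (lerD (ler_normD _ _) (lexx _)))//.
rewrite (le_trans (lerD (lerD (ler_normB _ _) (lexx _)) (lexx _)))//.
have H1 : `|h1 y * u| <= M * a by rewrite normrM ler_pM.
have H2 : `|h2 y / 2 * (v - n%:R^-1)| <= M * (b / 2).
  by rewrite !normrM mulrAC -mulrA [`|2^-1|]ger0_norm ?invr_ge0//; apply: ler_pM => //;
    rewrite ?mulr_ge0// ler_wpM2r.
have H3 : M * t <= M * c by rewrite ler_wpM2l.
rewrite (le_trans (lerD (lerD (lerD TP TG) H1) H2))//.
by move: H3; rewrite /s; lra.
Qed.

End Lindeberg.

(** * Piecewise cubic approximations of the indicator of an interval *)

Section Test_functions.
Context {R : realType}.
Implicit Types (x y h : R) (g : R -> R).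

Lemma taylor3_affine (M a b : R) g : 1 <= a -> taylor3 M g ->
  taylor3 (a ^+ 3 * M) (fun y => g (a * y + b)).
Proof.
move=> a1 [g1 [g2 [[mg gM] [mg1 g1M] [mg2 g2M] gT]]].
have M0 : 0 <= M by exact: le_trans (normr_ge0 _) (gM 0).
have a0 : 0 <= a by rewrite (le_trans _ a1).
have mab : measurable_fun setT (fun y => a * y + b).
  by apply: measurable_funD => //; exact: mulrl_measurable.
have aX n : (n <= 3)%N -> `|a ^+ n| <= a ^+ 3.
  by move=> n3; rewrite ger0_norm ?exprn_ge0// ler_weXn2l.
exists (fun y => a * g1 (a * y + b)), (fun y => a ^+ 2 * g2 (a * y + b)); split.
- split=> [|y]; first exact: measurableT_comp.
  by rewrite (le_trans (gM _))// ler_peMl// exprn_ege1.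
- split=> [|y].
    by apply: measurable_funM => //; exact: measurableT_comp.
  by rewrite normrM ler_pM//; exact: (aX 1%N).
- split=> [|y].
    by apply: measurable_funM => //; exact: measurableT_comp.
  by rewrite normrM ler_pM//; exact: aX.
move=> y h.
have := gT (a * y + b) (a * h).
rewrite (_ : a * y + b + a * h = a * (y + h) + b); last by ring.
rewrite [`|a * h|]normrM [(`|a| * `|h|) ^+ 3]exprMn [`|a|]ger0_norm//.
rewrite (_ : M * (a ^+ 3 * `|h| ^+ 3) = a ^+ 3 * M * `|h| ^+ 3); last by ring.
by congr (`| _ | <= _); ring.
Qed.

Lemma taylor3B (M1 M2 : R) g g' : taylor3 M1 g -> taylor3 M2 g' ->
  taylor3 (M1 + M2) (fun y => g y - g' y).
Proof.
move=> [g1 [g2 [[mg gM] [mg1 g1M] [mg2 g2M] gT]]].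
move=> [k1 [k2 [[mk kM] [mk1 k1M] [mk2 k2M] kT]]].
have D (u v : R) : `|u| <= M1 -> `|v| <= M2 -> `|u - v| <= M1 + M2.
  by move=> uM vM; rewrite (le_trans (ler_normB _ _))// lerD.
exists (fun y => g1 y - k1 y), (fun y => g2 y - k2 y); split.
- by split=> [|y]; [exact: measurable_funB|exact: D].
- by split=> [|y]; [exact: measurable_funB|exact: D].
- by split=> [|y]; [exact: measurable_funB|exact: D].
move=> y h; rewrite [leRHS]mulrDl.
have -> : g (y + h) - g' (y + h) - (g y - g' y) - (g1 y - k1 y) * h
    - (g2 y - k2 y) * (h ^+ 2 / 2) = (g (y + h) - g y - g1 y * h - g2 y * (h ^+ 2 / 2))
  - (g' (y + h) - g' y - k1 y * h - k2 y * (h ^+ 2 / 2)) by ring.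
by rewrite (le_trans (ler_normB _ _))// lerD.
Qed.

Let pos x : R := Num.max 0 x.

Let posE x : (x <= 0 /\ pos x = 0) \/ (0 <= x /\ pos x = x).
Proof.
by rewrite /pos; have [x0|x0] := leP x 0; [left|right]; split => //; exact: ltW.
Qed.

(** The truncated cube has a Lipschitz second derivative. If [y] and [y + h] have the same sign the
    remainder is 0 or [h ^ 3]; the two remaining cases are bounded directly. *)
Let pos_taylor y h :
  `|pos (y + h) ^+ 3 - pos y ^+ 3 - 3 * pos y ^+ 2 * h - 3 * pos y * h ^+ 2| <= `|h| ^+ 3.
Proof.
have [[h0 ->]|[h0 ->]] := posE (y + h); have [[y0 ->]|[y0 ->]] := posE y.
- by rewrite !expr0n/= !(mulr0, mul0r) !subr0 normr0.
- have hN : h <= 0 by lra.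
  rewrite (ler0_norm hN).
  have -> : 0 ^+ 3 - y ^+ 3 - 3 * y ^+ 2 * h - 3 * y * h ^+ 2 = (- (y + h)) ^+ 3 - (- h) ^+ 3.
    by rewrite expr0n/=; ring.
  have A : (- (y + h)) ^+ 3 <= (- h) ^+ 3 by rewrite lerXn2r ?nnegrE; lra.
  have B : 0 <= (- (y + h)) ^+ 3 by rewrite exprn_ge0//; lra.
  by rewrite ler_norml; apply/andP; split; lra.
- rewrite !expr0n/= !(mulr0, mul0r) !subr0 ger0_norm ?exprn_ge0//.
  by rewrite lerXn2r ?nnegrE ?normr_ge0// (le_trans _ (ler_norm h))//; lra.
- have -> : (y + h) ^+ 3 - y ^+ 3 - 3 * y ^+ 2 * h - 3 * y * h ^+ 2 = h ^+ 3 by ring.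
  by rewrite normrX.
Qed.

(* Third differences of (x_+)^3 / 6, i.e., the integral of the quadratic
   B-spline with knots 0, 1, 2, 3. *)
Let spline n x : R := pos x ^+ n - 3 * pos (x - 1) ^+ n + 3 * pos (x - 2) ^+ n - pos (x - 3) ^+ n.

Definition smooth_step x : R := spline 3 x / 6.

Let measurable_spline n : measurable_fun setT (spline n).
Proof.
have mp c : measurable_fun setT (fun x => pos (x - c) ^+ n).
  apply: measurable_funX; apply: measurable_maxr => //.
  exact: measurable_funB.
have -> : spline n = (fun x => pos (x - 0) ^+ n - 3 * pos (x - 1) ^+ n
    + 3 * pos (x - 2) ^+ n - pos (x - 3) ^+ n).
  by apply/funext => x; rewrite subr0.
apply: measurable_funB; last exact: mp.
by apply: measurable_funD; [apply: measurable_funB|]; try (exact: mp);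
  apply: measurable_funM.
Qed.

Let spline_cases n x : (0 < n)%N ->
  [\/ x <= 0 /\ spline n x = 0,
      0 <= x <= 1 /\ spline n x = x ^+ n,
      1 <= x <= 2 /\ spline n x = x ^+ n - 3 * (x - 1) ^+ n |
      2 <= x <= 3 /\ spline n x = x ^+ n - 3 * (x - 1) ^+ n + 3 * (x - 2) ^+ n]
  \/ 3 <= x /\ spline n x = x ^+ n - 3 * (x - 1) ^+ n + 3 * (x - 2) ^+ n - (x - 3) ^+ n.
Proof.
move=> n0; have z : 0 ^+ n = 0 :> R by rewrite expr0n gtn_eqF.
rewrite /spline.
have [[c0 ->]|[c0 ->]] := posE x; have [[c1 ->]|[c1 ->]] := posE (x - 1);
have [[c2 ->]|[c2 ->]] := posE (x - 2); have [[c3 ->]|[c3 ->]] := posE (x - 3);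
  rewrite ?z; first
  [ exfalso; lra
  | by left; apply: Or41; split; lra
  | by left; apply: Or42; split; [apply/andP; split; lra|lra]
  | by left; apply: Or43; split; [apply/andP; split; lra|lra]
  | by left; apply: Or44; split; [apply/andP; split; lra|lra]
  | by right; split; lra ].
Qed.

Lemma smooth_step_le0 x : x <= 0 -> smooth_step x = 0.
Proof.
move=> x0; rewrite /smooth_step /spline.
have [[_ ->]|[? ->]] := posE x; have [[_ ->]|[? ->]] := posE (x - 1);
have [[_ ->]|[? ->]] := posE (x - 2); have [[_ ->]|[? ->]] := posE (x - 3);
  first [exfalso; lra | rewrite ?expr0n/=; lra | idtac].
all: have -> : x = 0 by lra.
all: rewrite ?expr0n/=; lra.
Qed.

Lemma smooth_step_ge3 x : 3 <= x -> smooth_step x = 1.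
Proof.
move=> x3; rewrite /smooth_step /spline.
have [[? ->]|[_ ->]] := posE x; first by exfalso; lra.
have [[? ->]|[_ ->]] := posE (x - 1); first by exfalso; lra.
have [[? ->]|[_ ->]] := posE (x - 2); first by exfalso; lra.
have [[? ->]|[_ ->]] := posE (x - 3); last by field.
have -> : x = 3 by lra.
by field.
Qed.

Let smooth_step_cases x :
  [\/ x <= 0 /\ smooth_step x = 0,
      [/\ 0 <= x <= 1, smooth_step x = x ^+ 3 / 6 & 0 <= smooth_step x <= 1/6],
      [/\ 1 <= x <= 2, smooth_step x = (x ^+ 3 - 3 * (x - 1) ^+ 3) / 6 &
        1/6 <= smooth_step x <= 5/6] |
      [/\ 2 <= x <= 3, smooth_step x = 1 - (3 - x) ^+ 3 / 6 &
        5/6 <= smooth_step x <= 1]]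
  \/ 3 <= x /\ smooth_step x = 1.
Proof.
have [x0|x0] := leP x 0; first by left; apply: Or41; rewrite smooth_step_le0.
have [x3|x3] := leP 3 x; first by right; rewrite smooth_step_ge3.
left; have [[]|] := @spline_cases 3 x isT => -[c E]; rewrite /smooth_step E.
- by exfalso; lra.
- apply: Or42; split => //; case/andP: c => c1 c2.
  have : 0 <= x ^+ 3 by rewrite exprn_ge0.
  have : x ^+ 3 <= 1 by rewrite exprn_ile1.
  lra.
- apply: Or43; split => //; case/andP: c => c1 c2.
  have [u uE] : exists u, x = u + 1 by exists (x - 1); ring.
  rewrite uE addrK in c1 c2 *; have u0 : 0 <= u by lra.
  have u1 : u <= 1 by lra.
  have -> : (u + 1) ^+ 3 - 3 * u ^+ 3 = 1 + 3 * u + 3 * u ^+ 2 - 2 * u ^+ 3 by ring.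
  have u2 : u ^+ 2 <= u by nra.
  have u3 : u ^+ 3 <= u ^+ 2 by rewrite exprS; nra.
  have u30 : 0 <= u ^+ 3 by rewrite exprn_ge0.
  have : 3 * u ^+ 2 - 2 * u ^+ 3 <= 1.
    have -> : 3 * u ^+ 2 - 2 * u ^+ 3 = 1 - (1 - u) ^+ 2 * (1 + 2 * u) by ring.
    have : 0 <= (1 - u) ^+ 2 * (1 + 2 * u) by rewrite mulr_ge0 ?sqr_ge0//; lra.
    lra.
  by move=> ?; apply/andP; split; lra.
- apply: Or44; case/andP: c => c1 c2.
  have -> : (x ^+ 3 - 3 * (x - 1) ^+ 3 + 3 * (x - 2) ^+ 3) / 6 = 1 - (3 - x) ^+ 3 / 6 by field.
  split => //; first by apply/andP; split.
  have : 0 <= (3 - x) ^+ 3 by rewrite exprn_ge0//; lra.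
  have : (3 - x) ^+ 3 <= 1 by rewrite exprn_ile1//; lra.
  by move=> ? ?; apply/andP; split; lra.
- by exfalso; lra.
Qed.

Lemma le_smooth_step : {homo smooth_step : x y / x <= y}.
Proof.
move=> x y; rewrite le_eqVlt => /predU1P[->//|xy].
case: (smooth_step_cases x) => [[[? ?]|[/andP[? ?] a2 /andP[? ?]]|
    [/andP[? ?] a2 /andP[? ?]]|[/andP[? ?] a2 /andP[? ?]]]|[? ?]];
case: (smooth_step_cases y) => [[[? ?]|[/andP[? ?] b2 /andP[? ?]]|
    [/andP[? ?] b2 /andP[? ?]]|[/andP[? ?] b2 /andP[? ?]]]|[? ?]];
  first [lra | idtac].
- rewrite a2 b2 ler_pM2r ?invr_gt0// lerXn2r ?nnegrE; lra.
- rewrite a2 b2 ler_pM2r ?invr_gt0//.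
  have [u uE] : exists u, x = u + 1 by exists (x - 1); ring.
  have [v vE] : exists v, y = v + 1 by exists (y - 1); ring.
  rewrite uE vE !addrK in xy *.
  have [u0 u1 v0 v1] : [/\ 0 <= u, u <= 1, 0 <= v & v <= 1] by split; lra.
  rewrite -subr_ge0.
  have -> : (v + 1) ^+ 3 - 3 * v ^+ 3 - ((u + 1) ^+ 3 - 3 * u ^+ 3) =
    (v - u) * (3 + (3 * u - 2 * u ^+ 2 - u * v) + (3 * v - 2 * v ^+ 2 - u * v)) by ring.
  apply: mulr_ge0; first lra.
  by have := mulr_ge0 u0 v0; nra.
- rewrite a2 b2 lerD2l lerN2 ler_pM2r ?invr_gt0// lerXn2r ?nnegrE; lra.
Qed.

Lemma smooth_step_01 x : 0 <= smooth_step x <= 1.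
Proof.
by case: (smooth_step_cases x) => [[[? ->]|[_ _ /andP[? ?]]|[_ _ /andP[? ?]]|
  [_ _ /andP[? ?]]]|[? ->]]; apply/andP; split; lra.
Qed.

(** The remainder is a combination of four truncated-cube remainders with weights 1, 3, 3, 1 over 6,
    hence at most [4 / 3] times the cube; the constant 4 also covers the function and its first two
    derivatives. *)
Lemma taylor3_smooth_step : taylor3 4 smooth_step.
Proof.
exists (fun x => spline 2 x / 2), (spline 1); split.
- split=> [|y]; last by have /andP[? ?] := smooth_step_01 y; rewrite ler_norml; lra.
  by apply: measurable_funM => //; exact: measurable_spline.
- split=> [|y]; first by apply: measurable_funM => //; exact: measurable_spline.
  by rewrite ler_norml; have [[]|] := @spline_cases 2 y isT => -[c ->]; nra.
- split=> [|y]; first exact: measurable_spline.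
  by rewrite ler_norml; have [[]|] := @spline_cases 1 y isT => -[c ->]; lra.
move=> y h.
pose r c := pos (y - c + h) ^+ 3 - pos (y - c) ^+ 3 - 3 * pos (y - c) ^+ 2 * h
   - 3 * pos (y - c) * h ^+ 2.
have -> : smooth_step (y + h) - smooth_step y - spline 2 y / 2 * h - spline 1 y * (h ^+ 2 / 2)
   = (r 0 - 3 * r 1 + 3 * r 2 - r 3) / 6.
  by rewrite /smooth_step /spline /r !subr0 !(addrAC y h); field.
have rh c : `|r c| <= `|h| ^+ 3 by exact: pos_taylor.
have := rh 0; have := rh 1; have := rh 2; have := rh 3.
rewrite !ler_norml => /andP[? ?] /andP[? ?] /andP[? ?] /andP[? ?].
by have := normr_ge0 h => /(exprn_ge0 3) ?; apply/andP; split; lra.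
Qed.

(** The difference of two steps contracted by [3 / h], one rising on [[-(c + h), -c]] and the other
    on [[c, c + h]]. The bound [h <= 3] makes the factor at least 1, as [taylor3_affine]
    requires. *)
Lemma smooth_indicator (c h : R) : 0 <= c -> 0 < h <= 3 ->
  exists M g, [/\ taylor3 M g, (forall z, 0 <= g z <= 1),
    (forall z, `|z| <= c -> g z = 1) & (forall z, c + h <= `|z| -> g z = 0)].
Proof.
move=> c0 /andP[h0 h3]; pose a := 3 / h.
have a1 : 1 <= a by rewrite ler_pdivlMr// mul1r.
have a0 : 0 < a by rewrite (lt_le_trans _ a1).
have ah : a * h = 3 by rewrite divfK// gt_eqF.
exists (a ^+ 3 * 4 + a ^+ 3 * 4).
exists (fun z => smooth_step (a * z + a * (c + h)) - smooth_step (a * z + a * - c)); split.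
- by apply: taylor3B; apply: taylor3_affine => //; exact: taylor3_smooth_step.
- move=> z; have /andP[A B] := smooth_step_01 (a * z + a * (c + h)).
  have /andP[A' B'] := smooth_step_01 (a * z + a * - c).
  rewrite subr_ge0 le_smooth_step; last by rewrite -!mulrDr ler_pM2l//; lra.
  lra.
- move=> z; rewrite ler_norml => /andP[z1 z2].
  rewrite smooth_step_ge3; last by rewrite -mulrDr -ah ler_pM2l//; lra.
  by rewrite smooth_step_le0 ?subr0// -mulrDr pmulr_rle0//; lra.
- move=> z; rewrite ler_normr => /orP[z1|z1].
    rewrite !smooth_step_ge3 ?subrr//; last by rewrite -mulrDr -ah ler_pM2l//; lra.
    by rewrite -mulrDr -ah ler_pM2l//; lra.
  rewrite !smooth_step_le0 ?subrr//; last by rewrite -mulrDr pmulr_rle0//; lra.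
  by rewrite -mulrDr pmulr_rle0//; lra.
Qed.
End Test_functions.

(** * The normal probability of a symmetric interval *)

Section Normal_interval.
Context {R : realType}.

Definition normal_within (c : R) : R := fine (normal_prob 0 1 `[- c, c]).

Lemma normal_within0 : normal_within 0 = 0.
Proof.
rewrite /normal_within oppr0 set_itv1.
have /null_content_dominatesP dom := normal_prob_dominates (0 : R) 1.
by rewrite (dom [set 0])//= lebesgue_measure_set1.
Qed.

(** The standard normal density is at most 1, and two intervals of length [h] are added. *)
Lemma normal_withinD (c h : R) : 0 <= c -> 0 <= h ->
  normal_within (c + h) <= normal_within c + 2 * h.
Proof.
move=> c0 h0.
have fin (A : set R) : measurable A -> normal_prob 0 1 A \is a fin_num.
  by move=> mA; exact: fin_num_measure.
have short (a b : R) : a <= b -> (normal_prob 0 1 `[a, b] <= (b - a)%:E)%E.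
  move=> ab; rewrite /normal_prob.
  apply: (@le_trans _ _ (\int[lebesgue_measure]_(x in `[a, b]) 1)%E).
    apply: ge0_le_integral => //=.
    - by move=> x _; rewrite lee_fin normal_pdf_ge0.
    - by apply: measurable_funTS; apply/measurable_EFinP; exact: measurable_normal_pdf.
    - move=> x _; rewrite lee_fin (le_trans (normal_pdf_ub _ _ _))// ?oner_neq0//.
      rewrite /normal_peak invf_le1 ?sqrtr_gt0; last first.
        by rewrite mulrn_wgt0// mulr_gt0 ?pi_gt0// exprn_gt0.
      rewrite -[leLHS]sqrtr1; apply: ler_wsqrtr.
      by rewrite expr1n mul1r mulr2n; have := pi_ge2 R; lra.
  by rewrite integral_cst//= mul1e lebesgue_measure_itv/= lte_fin; case: ltP => [_|ba];
    rewrite -?EFinB// lee_fin subr_ge0.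
rewrite /normal_within -lee_fin EFinD fineK ?fin//.
rewrite (_ : 2 * h = (c + h - c) + (- c - - (c + h))); last by ring.
rewrite !EFinD fineK ?fin//.
apply: (@le_trans _ _ (normal_prob 0 1 (`[- c, c] `|` (`[c, c + h] `|` `[- (c + h), - c])))).
  apply: le_measure; rewrite ?inE//; first by apply: measurableU => //; exact: measurableU.
  move=> x /=; rewrite !in_itv/= => /andP[x1 x2].
  have [xc|xc] := leP x c; last by right; left; rewrite ltW.
  have [cx|cx] := leP (- c) x; first by left.
  by right; right; rewrite x1 ltW.
rewrite (le_trans (measureU2 _ _ _))//; first exact: measurableU.
apply: leeD => //; rewrite (le_trans (measureU2 _ _ _))//.
by apply: leeD; apply: short; lra.
Qed.

Lemma normal_within_cvg1 (e : R) : 0 < e -> exists2 c, 0 < c & 1 - e <= normal_within c.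
Proof.
move=> e0.
pose A (n : nat) := `[- n%:R, n%:R]%classic : set R.
have : normal_prob (0 : R) 1 (A n) @[n --> \oo] --> normal_prob (0 : R) 1 (\bigcup_n A n).
  apply: nondecreasing_cvg_mu.
  - by move=> n; exact: measurable_itv.
  - by apply: bigcupT_measurable => n; exact: measurable_itv.
  move=> m n mn; apply/subsetPset => x; rewrite /A /= !in_itv/= => /andP[x1 x2].
  have mnR : m%:R <= n%:R :> R by rewrite ler_nat.
  by apply/andP; split; lra.
have -> : \bigcup_n A n = setT.
  apply/seteqP; split => // x _; exists (Num.bound `|x|) => //.
  by rewrite /A/= in_itv/= -ler_norml ltW// archi_boundP.
rewrite probability_setT => /fine_cvg /cvgrPdist_le /(_ e e0) [n _ /(_ n.+1 (leqnSn _))].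
rewrite /= ler_norml => /andP[_ h]; exists n.+1%:R => //.
by rewrite /normal_within -/(A n.+1); lra.
Qed.

End Normal_interval.

(** * Central limit theorem for a row-wise transformed i.i.d. array *)

Section Array_clt.
Context {d : measure_display} {T : measurableType d} {R : realType}.
Variable P : probability T R.
Variables (X : nat -> {RV P >-> R}) (f : nat -> R -> R).
Hypothesis indX : mutually_independent X.
Hypothesis mf : forall n, measurable_fun setT (f n).

Lemma Rintegral_indicator d' (S : measurableType d') (Q : probability S R) (A : set S) :
  measurable A -> \int[Q]_w (\1_A w : R) = fine (Q A).
Proof. by move=> mA; rewrite /Rintegral integral_indic// setIT. Qed.

Lemma measurable_norm_le d' (S : measurableType d') (V : S -> R) (c : R) :
  measurable_fun setT V -> measurable [set w | `|V w| <= c].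
Proof.
move=> mV; rewrite (_ : [set w | _] = setT `&` V @^-1` `[- c, c]%classic).
  exact: mV.
by rewrite setTI; apply/seteqP; split => w /=; rewrite in_itv/= ler_norml.
Qed.

Lemma probability_le_smooth d' (S : measurableType d') (Q : probability S R)
    (V : S -> R) (g : R -> R) (c : R) :
  measurable_fun setT V -> measurable_fun setT g -> (forall z, 0 <= g z <= 1) ->
  (forall z, `|z| <= c -> g z = 1) ->
  fine (Q [set w | `|V w| <= c]) <= \int[Q]_w g (V w).
Proof.
move=> mV mg g01 gc; have mA := measurable_norm_le c mV.
rewrite -Rintegral_indicator//; apply: le_Rintegral => //.
- exact: integrable_indic.
- apply: (bounded_integrable _ (M := 1)) => [|w]; first exact: measurableT_comp.
  by have /andP[? ?] := g01 (V w); rewrite ger0_norm.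
- move=> w _; rewrite indicE; have [|_] := boolP (w \in _).
    by rewrite inE /= => /gc ->.
  by have /andP[? _] := g01 (V w).
Qed.

Lemma smooth_le_probability d' (S : measurableType d') (Q : probability S R)
    (V : S -> R) (g : R -> R) (c : R) :
  measurable_fun setT V -> measurable_fun setT g -> (forall z, 0 <= g z <= 1) ->
  (forall z, c <= `|z| -> g z = 0) ->
  \int[Q]_w g (V w) <= fine (Q [set w | `|V w| <= c]).
Proof.
move=> mV mg g01 gc; have mA := measurable_norm_le c mV.
rewrite -Rintegral_indicator//; apply: le_Rintegral => //.
- apply: (bounded_integrable _ (M := 1)) => [|w]; first exact: measurableT_comp.
  by have /andP[? ?] := g01 (V w); rewrite ger0_norm.
- exact: integrable_indic.
- move=> w _; rewrite indicE; have [_|] := boolP (w \in _).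
    by have /andP[_ ?] := g01 (V w).
  by rewrite notin_setE /= => /negP; rewrite -ltNge => /ltW /gc ->.
Qed.

(** The indicator of [[-c, c]] is sandwiched between smooth functions for which [clt_bound] applies,
    and [normal_withinD] bounds the error of the sandwich. The hypotheses make [n] times the cost of
    one replacement vanish. *)
Lemma array_clt (m1 m2 m3 : nat -> R) :
  (\forall n \near \oo, forall i, (i < n)%N ->
    [/\ P.-integrable setT (EFin \o (f n \o X i)),
        P.-integrable setT (EFin \o (fun w => f n (X i w) ^+ 2)) &
        P.-integrable setT (EFin \o (fun w => `|f n (X i w)| ^+ 3))]) ->
  (\forall n \near \oo, forall i, (i < n)%N ->
    [/\ `|\int[P]_w f n (X i w)| <= m1 n,
        `|\int[P]_w (f n (X i w) ^+ 2) - n%:R^-1| <= m2 n &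
        \int[P]_w (`|f n (X i w)| ^+ 3) <= m3 n]) ->
  n%:R * m1 n @[n --> \oo] --> (0 : R) -> n%:R * m2 n @[n --> \oo] --> (0 : R) ->
  n%:R * m3 n @[n --> \oo] --> (0 : R) ->
  forall c e : R, 0 <= c -> 0 < e -> \forall n \near \oo,
    `|fine (P [set w | `|partial_sum X (f n) n w| <= c]) - normal_within c| <= e.
Proof.
move=> ifX mom h1 h2 h3 c e c0 e0.
have mS n : measurable_fun setT (partial_sum X (f n) n) by exact: measurable_partial_sum.
have main M g : taylor3 M g -> \forall n \near \oo,
    `|\int[P]_w g (partial_sum X (f n) n w) - \int[normal_prob 0 1]_x g x| <= e / 4.
  move=> gM.
  have sn0 : (Num.sqrt n%:R)^-1 @[n --> \oo] --> (0 : R).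
    under eq_fun do rewrite -sqrtrV ?ler0n//.
    rewrite -(sqrtr0 R); apply: (@cvg_comp _ _ _ (fun n : nat => n%:R^-1) Num.sqrt _ (nbhs (0 : R))); last exact: sqrt_continuous.
    apply/gtr0_cvgV0; last exact: cvgr_idn.
    by near=> n; rewrite ltr0n; near: n; exact: nbhs_infty_gt.
  have : n%:R * (M * (m1 n + m2 n / 2 + m3 n + 4 * (Num.sqrt n%:R)^-1 ^+ 3))
      @[n --> \oo] --> (0 : R).
    have -> : (fun n => n%:R * (M * (m1 n + m2 n / 2 + m3 n + 4 * (Num.sqrt n%:R)^-1 ^+ 3))) =
      (fun n => M * (n%:R * m1 n) + M / 2 * (n%:R * m2 n) + M * (n%:R * m3 n) +
         (4 * M) * (Num.sqrt n%:R)^-1).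
      apply/funext => n; have -> : n%:R * (M * (m1 n + m2 n / 2 + m3 n + 4 * (Num.sqrt n%:R)^-1 ^+ 3)) =
         M * (n%:R * m1 n) + M / 2 * (n%:R * m2 n) + M * (n%:R * m3 n) +
         (4 * M) * (n%:R * (Num.sqrt n%:R)^-1 ^+ 3).
        by move: ((Num.sqrt n%:R)^-1) => r; field.
      congr (_ + _ * _); case: n => [|n]; first by rewrite mul0r sqrtr0 invr0.
      rewrite -{1}(sqr_sqrtr (ler0n R n.+1)).
      by field; rewrite gt_eqF// sqrtr_gt0 ltr0n.
    rewrite -[X in _ --> X]addr0; apply: cvgD; last first.
      by rewrite -[X in _ --> X](mulr0 (4 * M)); exact: cvgMr.
    rewrite -[X in _ --> X]addr0; apply: cvgD; last first.
      by rewrite -[X in _ --> X](mulr0 M); exact: cvgMr.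
    rewrite -[X in _ --> X]addr0; apply: cvgD.
      by rewrite -[X in _ --> X](mulr0 M); exact: cvgMr.
    by rewrite -[X in _ --> X](mulr0 (M / 2)); exact: cvgMr.
  have e4 : 0 < e / 4 by rewrite divr_gt0.
  move=> /cvgrPdist_le /(_ _ e4) near0.
  near=> n; apply: (@le_trans _ _
     (n%:R * (M * (m1 n + m2 n / 2 + m3 n + 4 * (Num.sqrt n%:R)^-1 ^+ 3)))).
    apply: clt_bound => //; first by near: n; exact: nbhs_infty_gt.
      by near: n.
    by near: n.
  have : `|0 - n%:R * (M * (m1 n + m2 n / 2 + m3 n + 4 * (Num.sqrt n%:R)^-1 ^+ 3))| <= e / 4.
    by near: n.
  by rewrite sub0r normrN; exact: le_trans (ler_norm _).
have mQ : measurable_fun [set: measurableTypeR R] (idfun : measurableTypeR R -> R).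
  exact: measurable_id.
have QE (b : R) : normal_within b = fine (normal_prob 0 1 [set w : R | `|w| <= b]).
  by congr (fine (normal_prob _ _ _)); apply/seteqP; split => x /=;
    rewrite in_itv/= ler_norml.
have up : \forall n \near \oo,
   fine (P [set w | `|partial_sum X (f n) n w| <= c]) <= normal_within c + e.
  pose h := Num.min (e / 8) 3.
  have h0 : 0 < h by rewrite lt_min divr_gt0//= ltr0n.
  have h3' : h <= 3 by rewrite ge_min lexx orbT.
  have he : h <= e / 8 by rewrite ge_min lexx.
  have [|M [g [gM g01 g1 g0]]] := @smooth_indicator R c h c0; first by rewrite h0 h3'.
  have [_ [_ [[mg _] _ _ _]]] := gM.
  have [N _ HN] := main M g gM; exists N => // n Nn; have := HN n Nn; rewrite ler_norml => /andP[_].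
  have A := probability_le_smooth P (mS n) mg g01 g1.
  have B := smooth_le_probability (normal_prob 0 1) mQ mg g01 g0.
  have C := normal_withinD c0 (ltW h0).
  rewrite /= -QE in B; lra.
have low : \forall n \near \oo,
   normal_within c - e <= fine (P [set w | `|partial_sum X (f n) n w| <= c]).
  (* At [c = 0] there is no smaller interval to approximate from inside, but the normal probability
     is 0 and the lower bound is trivial. *)
  move: c0; rewrite le_eqVlt => /predU1P[<-|c0].
    near=> n; have P0 : 0 <= fine (P [set w | `|partial_sum X (f n) n w| <= 0]).
      exact: fine_ge0.
    by rewrite normal_within0; lra.
  pose h := Num.min (Num.min (e / 8) 3) c.
  have h0 : 0 < h by rewrite !lt_min c0 divr_gt0//= ltr0n.
  have h3' : h <= 3 by rewrite !ge_min lexx orbT.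
  have hc : h <= c by rewrite !ge_min lexx orbT.
  have he : h <= e / 8 by rewrite !ge_min lexx.
  have ch0 : 0 <= c - h by rewrite subr_ge0.
  have [|M [g [gM g01 g1 g0]]] := @smooth_indicator R (c - h) h ch0; first by rewrite h0 h3'.
  rewrite subrK in g0.
  have [_ [_ [[mg _] _ _ _]]] := gM.
  have [N _ HN] := main M g gM; exists N => // n Nn; have := HN n Nn; rewrite ler_norml => /andP[+ _].
  have A := smooth_le_probability P (mS n) mg g01 g0.
  have B := probability_le_smooth (normal_prob 0 1) mQ mg g01 g1.
  have C := normal_withinD ch0 (ltW h0).
  rewrite /= -QE in B; rewrite subrK in C; lra.
near=> n; rewrite ler_norml; apply/andP; split.
  by rewrite lerBrDr addrC; near: n.
by rewrite lerBlDr addrC; near: n.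
Unshelve. all: by end_near. Qed.
End Array_clt.

(** * From pointwise to locally uniform control of increments *)

Section Uniform_boundedness.
Context {R : realType}.
Local Notation mu := (@lebesgue_measure R).
Variables (g chi r : R -> R).
Hypothesis mg : measurable_fun setT g.
Let b y := g (y + 1) - g y.
Hypothesis b_neq0 : \forall y \near +oo, b y != 0.
Hypothesis cvg_g : forall v, (g (y + v) - g y) / b y @[y --> +oo] --> chi v.
Hypothesis cvg_b : forall v, b (y + v) / b y @[y --> +oo] --> r v.
Hypothesis r_gt0 : forall v, 0 < r v.

(** Along the base points [y m], from index [N] on, increments by [v] are controlled and [b] at the
    shifted and unshifted points are comparable, all with constant [N]. *)
Let good (y : nat -> R) (N : nat) (v : R) := forall m, (N <= m)%N ->
  [/\ `|g (y m + v) - g (y m)| <= N%:R * `|b (y m)|,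
      `|b (y m + v)| <= N%:R * `|b (y m)| &
      `|b (y m)| <= N%:R * `|b (y m + v)|].

Let bad y N := [set v | ~ good y N v] `&` `[-1, 2].

Let measurable_le (f h : R -> R) : measurable_fun setT f -> measurable_fun setT h ->
  measurable [set v | f v <= h v].
Proof.
move=> mf mh.
rewrite (_ : [set v | _] = setT `&` (fun v => h v - f v) @^-1` `[0, +oo[%classic).
  by apply: (measurable_funB mh mf) => //; exact: measurable_itv.
by rewrite setTI; apply/seteqP; split => v /=; rewrite in_itv/= andbT subr_ge0.
Qed.

Let measurable_gD z : measurable_fun setT (fun v : R => g (z + v)).
Proof. by apply: measurableT_comp => //; exact: measurable_funD. Qed.

Let measurable_bD z : measurable_fun setT (fun v : R => b (z + v)).
Proof.
apply: measurable_funB => //; apply: measurableT_comp => //.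
by apply: measurable_funD => //; exact: measurable_funD.
Qed.

Let measurable_bad y N : measurable (bad y N).
Proof.
apply: measurableI => //; rewrite -[X in measurable X]setCK; apply: measurableC.
rewrite (_ : ~` _ = \bigcap_m [set v | (N <= m)%N ->
  [/\ `|g (y m + v) - g (y m)| <= N%:R * `|b (y m)|,
      `|b (y m + v)| <= N%:R * `|b (y m)| &
      `|b (y m)| <= N%:R * `|b (y m + v)|]]); last first.
  apply/seteqP; split => v /=; first by move=> /contrapT gv m _ Nm; exact: (gv m Nm).
  by move=> gv; apply => m Nm; exact: (gv m I Nm).
apply: bigcap_measurable => // m _.
have [Nm|Nm] := boolP (N <= m)%N; last first.
  by rewrite (_ : [set v | _] = setT)//; apply/seteqP.
rewrite (_ : [set v | _] =
  [set v | `|g (y m + v) - g (y m)| <= N%:R * `|b (y m)|] `&`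
  ([set v | `|b (y m + v)| <= N%:R * `|b (y m)|] `&`
   [set v | `|b (y m)| <= N%:R * `|b (y m + v)|])); last first.
  by apply/seteqP; split => v /=; [move=> /(_ isT)[]|move=> [? [? ?]] _; split].
have mn (f : R -> R) : measurable_fun setT f -> measurable_fun setT (fun v => `|f v|).
  by move=> mf; exact: (measurableT_comp (@normr_measurable R setT) mf).
apply: measurableI; last apply: measurableI; apply: measurable_le => //.
- by apply: mn; apply: measurable_funB.
- exact: mn.
- by apply: measurable_funM => //; exact: mn.
Qed.

Let eventually_good (y : nat -> R) v : y m @[m --> \oo] --> +oo ->
  exists N, good y N v.
Proof.
move=> yoo.
have e1 : \forall m \near \oo, b (y m) != 0 by exact: (yoo _ b_neq0).
have bnd (q : R -> R) (l : R) : q y0 @[y0 --> +oo] --> l ->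
    \forall m \near \oo, `|q (y m)| <= `|l| + 1.
  move=> /cvgrPdist_le /(_ 1 ltr01) h.
  have h' : \forall m \near \oo, `|l - q (y m)| <= 1 := yoo _ h.
  near=> m; have hm : `|l - q (y m)| <= 1 by near: m.
  by rewrite -lerBlDl (le_trans _ hm)// distrC (le_trans (lerB_dist _ _)).
have bndr : \forall m \near \oo, r v / 2 <= `|b (y m + v) / b (y m)|.
  have r2 : 0 < r v / 2 by rewrite divr_gt0.
  have := @cvg_b v => /cvgrPdist_le /(_ _ r2) h.
  have h' : \forall m \near \oo, `|r v - b (y m + v) / b (y m)| <= r v / 2 := yoo _ h.
  near=> m; have : `|r v - b (y m + v) / b (y m)| <= r v / 2 by near: m.
  rewrite ler_norml => /andP[_ h2]; rewrite (le_trans _ (ler_norm _))//.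
  lra.
have [N _ HN] : \forall m \near \oo, [/\ b (y m) != 0,
   `|(g (y m + v) - g (y m)) / b (y m)| <= `|chi v| + 1,
   `|b (y m + v) / b (y m)| <= `|r v| + 1 &
   r v / 2 <= `|b (y m + v) / b (y m)|].
  have B1 := bnd _ _ (@cvg_g v); have B2 := bnd _ _ (@cvg_b v).
  by near=> m; split; near: m.
pose K : nat := maxn N (maxn (Num.bound (`|chi v| + 1))
  (maxn (Num.bound (`|r v| + 1)) (Num.bound (r v / 2)^-1))).
exists K => m Km.
have [h0 h1 h2 h3] := HN m (leq_trans (leq_maxl _ _) Km).
have bm : 0 < `|b (y m)| by rewrite normr_gt0.
have K1 : `|chi v| + 1 <= K%:R.
  apply: ltW; apply: (lt_le_trans (archi_boundP _)); first by rewrite addr_ge0.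
  by rewrite ler_nat /K maxnA leq_max leq_maxr.
have K2 : `|r v| + 1 <= K%:R.
  apply: ltW; apply: (lt_le_trans (archi_boundP _)); first by rewrite addr_ge0.
  by rewrite ler_nat /K !leq_max leqnn !orbT.
have K3 : (r v / 2)^-1 <= K%:R.
  apply: ltW; apply: (lt_le_trans (archi_boundP _)).
    by rewrite invr_ge0 ltW// divr_gt0.
  by rewrite ler_nat /K !leq_max leqnn !orbT.
move: h1 h2 h3; rewrite !normrM normfV.
rewrite ler_pdivrMr// ler_pdivrMr// ler_pdivlMr// => h1 h2 h3; split.
- by rewrite (le_trans h1)// ler_wpM2r.
- by rewrite (le_trans h2)// ler_wpM2r.
- have r2 : 0 < r v / 2 by rewrite divr_gt0.
  rewrite -(ler_pM2l r2) (le_trans h3)// mulrA ler_peMl//.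
  by rewrite -ler_pdivrMl// mulr1.
Unshelve. all: by end_near. Qed.

(** The bad sets decrease with [N] inside an interval of finite length, and pointwise convergence
    makes their intersection empty; continuity from above concludes. *)
Let mostly_good (y : nat -> R) : y m @[m --> \oo] --> +oo ->
  \forall N \near \oo, (mu (bad y N) < 2^-1%:E)%E.
Proof.
move=> yoo.
have : mu (bad y N) @[N --> \oo] --> mu (\bigcap_N bad y N).
  apply: nonincreasing_cvg_mu.
  - apply: (@le_lt_trans _ _ (mu `[-1, 2])).
      by apply: le_measure; [rewrite inE; exact: measurable_bad|
        rewrite inE; exact: measurable_itv|exact: subIsetr].
    by rewrite lebesgue_measure_itv/=; case: ifP => _; rewrite -?EFinD ltry.
  - by move=> N; exact: measurable_bad.
  - by apply: bigcapT_measurable => N; exact: measurable_bad.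
  - move=> N M NM; apply/subsetPset => v [gv v12]; split => // gN; apply: gv => m Mm.
    have [h1 h2 h3] := gN m (leq_trans NM Mm).
    have NMR : N%:R <= M%:R :> R by rewrite ler_nat.
    by split; [apply: (le_trans h1)|apply: (le_trans h2)|apply: (le_trans h3)];
      rewrite ler_wpM2r.
have -> : \bigcap_N bad y N = set0.
  apply/seteqP; split => // v bv; have [N gN] := eventually_good v yoo.
  by have [] := bv N I.
rewrite measure0 => /fine_cvgP[finN /cvgrPdist_lt].
move=> /(_ 2^-1); rewrite invr_gt0 => /(_ (ltr0Sn _ _)) h.
near=> N.
have f : mu (bad y N) \is a fin_num by near: N.
rewrite -(fineK f) lte_fin.
have : `|0 - (fine \o (fun N => mu (bad y N))) N| < 2^-1 by near: N.
by rewrite sub0r normrN; exact: le_lt_trans (ler_norm _).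
Unshelve. all: by end_near. Qed.

(** This is the classical argument for uniform convergence in regular variation. A failure yields
    base points [y m] and [y' m = y m + v m] with too large an increment between them. For a fixed
    large [N] both have small bad sets, so some point is reached by a good shift from each; passing
    through it bounds the increment. *)
Lemma locally_uniform_bound : exists C Y : R, 0 <= C /\ forall y v, Y <= y ->
  0 <= v <= 1 -> `|g (y + v) - g y| <= C * `|b y|.
Proof.
apply: contrapT => H.
have ex (n : nat) : exists z : R * R, [/\ n%:R <= z.1, 0 <= z.2 <= 1 &
    n%:R * `|b z.1| < `|g (z.1 + z.2) - g z.1|].
  apply: contrapT => Hn; apply: H; exists n%:R, n%:R; split => // y v ny v01.
  by rewrite leNgt; apply/negP => lt; apply: Hn; exists (y, v).
have [z zP] := choice ex.
pose y n := (z n).1; pose y' n := (z n).1 + (z n).2.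
have yoo : y n @[n --> \oo] --> +oo.
  apply/cvgryPge => A; near=> n; have [h _ _] := zP n; apply: le_trans h.
  by near: n; exact: nbhs_infty_ger.
have y'oo : y' n @[n --> \oo] --> +oo.
  apply/cvgryPge => A; near=> n; have [h /andP[v0 _] _] := zP n.
  apply: (@le_trans _ _ n%:R); last by rewrite /y'; lra.
  by near: n; exact: nbhs_infty_ger.
have [N _ HN] : \forall N \near \oo, (mu (bad y N) < 2^-1%:E)%E /\ (mu (bad y' N) < 2^-1%:E)%E.
  have M1 := mostly_good yoo; have M2 := mostly_good y'oo.
  by near=> N; split; near: N.
have [muN muN'] := HN N (leqnn _).
(* Going through the common point costs [N] from [y m] and [N ^ 3] from [y' m], so this index
   contradicts the choice of the sequence. *)
pose m := maxn N (N + N * N * N)%N.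
have [_ v01 gt] := zP m.
have v01' := v01; case/andP: v01' => v0 v1.
pose shifted := (fun v => v - (z m).2) @^-1` bad y' N.
have mshift : measurable shifted.
  rewrite -[X in measurable X]setTI; apply: measurable_funB => //.
have shiftE : mu shifted = mu (bad y' N).
  have -> : shifted = (fun x : measurableTypeR R => (x + - (z m).2)%R : measurableTypeR R)
      @^-1` bad y' N by [].
  exact: (lebesgue_measure_translation (- (z m).2) (measurable_bad y' N)).
(* Length 2 cannot be covered by two sets of measure less than one half. A shift in [[0, 2]] stays
   in [[-1, 2]] when the base point moves by at most 1. *)
have : ~ (`[0, 2]%classic `<=` bad y N `|` shifted).
  move=> /(le_measure mu); rewrite !inE => le.
  have {le} : (mu `[0%R, 2%R] <= mu (bad y N `|` shifted))%E.
    by apply: le; [exact: measurable_itv|apply: measurableU => //; exact: measurable_bad].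
  rewrite leNgt => /negP; apply; rewrite /= lebesgue_measure_itv/= lte_fin ltr0n/=.
  have mU : (mu (bad y N `|` shifted) <= mu (bad y N) + mu (bad y' N))%E.
    by rewrite -shiftE; exact: (measureU2 mu (measurable_bad y N) mshift).
  apply: (le_lt_trans mU); apply: (lt_le_trans (lteD muN muN')).
  by rewrite -!EFinD lee_fin; lra.
apply => v; rewrite /= in_itv/= => /andP[v_0 v_2].
have [gv|] := pselect (good y N v); last by left; split => //; rewrite /= in_itv/=; lra.
have [gv'|] := pselect (good y' N (v - (z m).2)); last first.
  by right; split => //; rewrite /= in_itv/=; lra.
exfalso.
have Nm : (N <= m)%N by exact: leq_maxl.
have [h1 h2 _] := gv m Nm; have [k1 _ k3] := gv' m Nm.
have E : y' m + (v - (z m).2) = y m + v by rewrite /y' /y; ring.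
rewrite E in k1 k3.
move: gt; rewrite ltNge => /negP; apply; rewrite -/(y m) -/(y' m).
have -> : g (y' m) - g (y m) = (g (y m + v) - g (y m)) - (g (y m + v) - g (y' m)) by ring.
rewrite (le_trans (ler_normB _ _))//.
have b0 : 0 <= `|b (y m)| by [].
have N0 : 0 <= N%:R :> R by [].
have k4 : `|b (y' m)| <= N%:R * (N%:R * `|b (y m)|).
  by rewrite (le_trans k3)// ler_wpM2l.
have k5 : N%:R * `|b (y' m)| <= N%:R * (N%:R * (N%:R * `|b (y m)|)).
  by rewrite ler_wpM2l.
rewrite (le_trans (lerD h1 (le_trans k1 k5)))//.
rewrite !mulrA -mulrDl -!natrM -natrD ler_wpM2r// ler_nat.
exact: leq_maxr.
Unshelve. all: by end_near. Qed.

End Uniform_boundedness.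

(** * Generalized inverses as adjoints of the tail *)

Section Quantile.
Context {R : realType}.
Variable F : R -> R.
Hypothesis F_nd : {homo F : x y / x <= y}.
Hypothesis F_rc : forall y c, (forall z, y < z -> c <= F z) -> c <= F y.
Hypothesis F_Ny : forall e : R, 0 < e -> exists y, F y < e.
Hypothesis F_y : forall e : R, 0 < e -> exists y, 1 - F y < e.

(** The Galois connection between the inverse and the tail. Right continuity, used in the form
    [F_rc], makes the infimum attained. *)
Lemma survival_inv_le (p y : R) : 0 < p < 1 ->
  (survival_inv F p <= y) = (1 - F y <= p).
Proof.
move=> /andP[p0 p1]; rewrite /survival_inv; set A := [set y | _].
have A0 : A !=set0 by have [z zp] := F_y p0; exists z; exact: ltW.
have Alb : has_lbound A.
  have [|z zp] := F_Ny (e := 1 - p); first by rewrite subr_gt0.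
  exists z => a; rewrite /A /= => ap; rewrite leNgt; apply/negP => /ltW /F_nd; lra.
apply/idP/idP => [le|yp]; last exact: ge_inf.
rewrite lerBlDr -lerBlDl; apply: F_rc => z yz.
have [a Aa az] : exists2 a, A a & a < z.
  by apply: inf_lt => //; exact: le_lt_trans yz.
by move: Aa; rewrite /A /= => Aa; have := F_nd (ltW az); lra.
Qed.

Hypothesis F_lt1 : forall y, F y < 1.

Lemma tail_quantileE (s : R) : 0 < s -> tail_quantile F s = survival_inv F s^-1.
Proof.
move=> s0; rewrite /tail_quantile /survival_inv; congr (inf _).
apply/seteqP; split => y /=; have : 0 < 1 - F y by rewrite subr_gt0.
  by move=> F0 sF; rewrite -[leLHS]invrK lef_pV2 ?posrE ?invr_gt0.
by move=> F0 sF; rewrite -[leLHS]invrK lef_pV2 ?posrE ?invr_gt0.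
Qed.

Lemma tail_quantile_le (s y : R) : 1 < s -> (tail_quantile F s <= y) = (1 - F y <= s^-1).
Proof.
move=> s1; have s0 : 0 < s by exact: lt_trans s1.
by rewrite tail_quantileE// survival_inv_le// invr_gt0 s0 invf_lt1.
Qed.

Lemma tail_quantile_nd (s t : R) : 1 < s -> s <= t -> tail_quantile F s <= tail_quantile F t.
Proof.
move=> s1 st; have t1 : 1 < t by exact: lt_le_trans st.
rewrite tail_quantile_le//; apply: (@le_trans _ _ t^-1).
  by rewrite -tail_quantile_le.
by rewrite lef_pV2 ?posrE// (lt_trans _ s1, lt_trans _ t1).
Qed.

Lemma tail_quantile_gt0 : exists2 t0, 1 < t0 & forall t, t0 <= t -> 0 < tail_quantile F t.
Proof.
have F0 : 0 < 1 - F 0 by rewrite subr_gt0.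
have F0' : 0 < (1 - F 0)^-1 by rewrite invr_gt0.
exists (2 + (1 - F 0)^-1) => [|t tt]; first by lra.
have t1 : 1 < t by lra.
rewrite ltNge tail_quantile_le// -ltNge -[ltRHS]invrK ltf_pV2 ?posrE ?invr_gt0//; lra.
Qed.
End Quantile.

(** * Elementary bounds for the logarithm and the exponential *)

Section Logarithm.
Context {R : realType}.

(** The upper bound is [ln (1 + x) <= x]; the lower bound is the same inequality applied to
    [1 / (1 + z)]. *)
Lemma ln1D_linear (z : R) : `|z| <= 1 / 2 -> `|ln (1 + z) - z| <= 2 * z ^+ 2.
Proof.
rewrite ler_norml => /andP[z1 z2].
have z0 : 0 < 1 + z by lra.
have up : ln (1 + z) <= z by apply: le_ln1Dx; lra.
have low : z - 2 * z ^+ 2 <= ln (1 + z).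
  have : ln (1 + (- z / (1 + z))) <= - z / (1 + z).
    by apply: le_ln1Dx; rewrite ltr_pdivlMr//; lra.
  have -> : 1 + - z / (1 + z) = (1 + z)^-1 by field; rewrite gt_eqF.
  rewrite lnV ?posrE// mulNr lerN2 => h; apply: le_trans h.
  rewrite ler_pdivlMr//; nra.
by rewrite ler_norml; have := sqr_ge0 z; lra.
Qed.

Lemma expR_cvgy : expR y @[y --> +oo] --> (+oo : set_system R).
Proof.
apply/cvgryPge => A; near=> y; apply: (@le_trans _ _ y).
  by near: y; apply: nbhs_pinfty_ge; rewrite num_real.
by have := expR_ge1Dx y; lra.
Unshelve. all: by end_near. Qed.
End Logarithm.

(** * The second-order condition made uniform *)

Section Second_order.
Context {R : realType}.
Variables (F A : R -> R) (gamma rho : R).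
Hypothesis F_nd : {homo F : x y / x <= y}.
Hypothesis F_rc : forall y c, (forall z, y < z -> c <= F z) -> c <= F y.
Hypothesis F_Ny : forall e : R, 0 < e -> exists y, F y < e.
Hypothesis F_y : forall e : R, 0 < e -> exists y, 1 - F y < e.
Hypothesis F_lt1 : forall y, F y < 1.
Hypothesis gamma0 : 0 < gamma.
Hypothesis rho0 : rho < 0.
Hypothesis A_to0 : A t @[t --> +oo] --> (0 : R).
Hypothesis second_order : forall x : R, 0 < x ->
  (tail_quantile F (t * x) / tail_quantile F t - x `^ (gamma^-1)) / A t
    @[t --> +oo] --> x `^ (gamma^-1) * ((x `^ rho - 1) / rho).

Local Notation U := (tail_quantile F).
Let psi v := (expR (rho * v) - 1) / rho.
Let a y := A (expR y).
(** In the variable [y = ln t], this is the logarithm of the slowly varying part of [U]; the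
    condition turns into a statement about its additive increments. *)
Let ell y := ln (U (expR y)) - y / gamma.

Let psi_neq0 (v : R) : 0 < v -> psi v != 0.
Proof.
move=> v0; have rv : rho * v < 0 by rewrite nmulr_rlt0.
by rewrite mulf_neq0 ?invr_eq0 ?lt_eqF// subr_lt0 expR_lt1.
Qed.

Let q v y := (U (expR y * expR v) / U (expR y) - expR (v / gamma)) / a y.

Let cvg_q v : q v y @[y --> +oo] --> expR (v / gamma) * psi v.
Proof.
have := second_order (expR_gt0 v).
rewrite -!expRM [v * rho]mulrC => h.
exact: (cvg_comp _ _ expR_cvgy h).
Qed.

(** Where [a] vanishes the quotient [q 1] is 0 by the convention on inverses, but its limit is
    not. *)
Let a_neq0 : \forall y \near +oo, a y != 0.
Proof.
have l0 : expR (1 / gamma) * psi 1 != 0 by rewrite mulf_neq0 ?psi_neq0// gt_eqF// expR_gt0.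
have := @cvg_q 1 => /cvgrPdist_lt /(_ `|expR (1 / gamma) * psi 1|).
rewrite normr_gt0 => /(_ l0) h; near=> y; apply/eqP => ay0.
have : `|expR (1 / gamma) * psi 1 - q 1 y| < `|expR (1 / gamma) * psi 1| by near: y.
by rewrite /q ay0 invr0 mulr0 subr0 ltxx.
Unshelve. all: by end_near. Qed.

Let a_to0 : a y @[y --> +oo] --> (0 : R).
Proof. exact: (cvg_comp _ _ expR_cvgy A_to0). Qed.

Let U_gt0 : \forall y \near +oo, 0 < U (expR y).
Proof.
have [t0 t01 Ut] := tail_quantile_gt0 F_nd F_rc F_Ny F_y F_lt1.
near=> y; apply: Ut; near: y.
exact: (expR_cvgy (nbhs_pinfty_ge (num_real t0))).
Unshelve. all: by end_near. Qed.

(** The ratio of the [U] values is [c (1 + z)] with [z] of order [a y]; replacing [ln (1 + z)] by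
    [z] leaves an error of order [a y ^ 2], negligible after division by [a y]. *)
Let cvg_ell v : (ell (y + v) - ell y) / a y @[y --> +oo] --> psi v.
Proof.
set c := expR (v / gamma).
have c0 : 0 < c by exact: expR_gt0.
have qc : q v y / c @[y --> +oo] --> psi v.
  have -> : psi v = expR (v / gamma) * psi v / c by rewrite mulrAC divff ?mul1r// gt_eqF.
  by apply: cvgMl; exact: cvg_q.
have z0 : a y * (q v y / c) @[y --> +oo] --> (0 : R).
  by rewrite -(mul0r (psi v)); apply: cvgM.
have err : 2 * (`|a y| * (q v y / c) ^+ 2) @[y --> +oo] --> (0 : R).
  rewrite -(mulr0 2); apply: cvgMr; rewrite -(mul0r (psi v ^+ 2)).
  apply: cvgM; first by rewrite -(normr0 R); apply: cvg_norm.
  exact: (cvg_comp _ _ qc (@exprn_continuous R 2 _)).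
have half0 : 0 < 1 / 2 :> R by lra.
have z0h : \forall y \near +oo, `|a y * (q v y / c)| <= 1 / 2.
  by move/cvgr0Pnorm_le: z0 => /(_ _ half0).
have diff : (ell (y + v) - ell y) / a y - q v y / c @[y --> +oo] --> (0 : R).
  apply/cvgr0Pnorm_le => e e0; near=> y.
  apply: (@le_trans _ _ (2 * (`|a y| * (q v y / c) ^+ 2))); last first.
    apply: le_trans (ler_norm _) _; near: y.
    by move/cvgr0Pnorm_le: err => /(_ e e0).
  have ay : a y != 0 by near: y.
  have Uy : 0 < U (expR y) by near: y.
  have Uyv : 0 < U (expR (y + v)).
    near: y; have := U_gt0 => -[Y [Yr HY]]; exists (Y - v); split; first exact: num_real.
    by move=> y /= yY; apply: HY; lra.
  set z := a y * (q v y / c).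
  have zE : U (expR (y + v)) / U (expR y) = c * (1 + z).
    rewrite /z /q expRD -/c; have cn0 : c != 0 by rewrite gt_eqF.
    by move: (U (expR y * expR v) / U (expR y)) (a y) ay => u ay' ay0; field; rewrite ay0 cn0.
  have -> : ell (y + v) - ell y = ln (1 + z).
    have : ln (U (expR (y + v)) / U (expR y)) = ln (c * (1 + z)) by rewrite zE.
    have z1 : 0 < 1 + z by rewrite -(pmulr_rgt0 _ c0) -zE divr_gt0.
    rewrite ln_div ?posrE// lnM ?posrE// expRK /ell => h.
    by rewrite mulrDl addrC; move: h => /eqP; rewrite subr_eq => /eqP ->; ring.
  have zs : `|z| <= 1 / 2.
    by rewrite /z; near: y; exact: z0h.
  have -> : ln (1 + z) / a y - q v y / c = (ln (1 + z) - z) / a y.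
    by rewrite /z; field; rewrite ay gt_eqF.
  rewrite normrM normfV ler_pdivrMr ?normr_gt0// (le_trans (ln1D_linear zs))//.
  rewrite /z exprMn -[a y ^+ 2]real_normK ?num_real//.
  by rewrite le_eqVlt; apply/orP; left; apply/eqP; ring.
rewrite -(add0r (psi v)) (_ : (fun y => _) =
  (fun y => ((ell (y + v) - ell y) / a y - q v y / c) + q v y / c)); last first.
  by apply/funext => y; rewrite subrK.
exact: cvgD.
Unshelve. all: by end_near. Qed.

(** Unit increments of [ell] shrink by a factor tending to [exp rho < 1], so those over any number
    of unit steps sum geometrically. The final fractional step is covered by
    [locally_uniform_bound], and unit increments are comparable to [a]. *)
Lemma second_order_uniform : exists C Y : R, 0 <= C /\ forall y v, Y <= y -> 0 <= v ->
  `|ell (y + v) - ell y| <= C * `|a y|.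
Proof.
have [t0 t01 Ut] := tail_quantile_gt0 F_nd F_rc F_Ny F_y F_lt1.
pose Y0 := ln t0.
have Y0E y : Y0 <= y -> t0 <= expR y.
  by move=> h; rewrite -[t0]lnK ?posrE ?ler_expR// (lt_trans _ t01).
(* Freezing [U] below [Y0], where it might not be positive, makes the first term nondecreasing on
   the whole line, hence [g] measurable. *)
pose g y := ln (U (expR (Num.max y Y0))) - y / gamma.
have gE y : Y0 <= y -> g y = ell y by move=> h; rewrite /g max_l.
have mg : measurable_fun setT g.
  apply: measurable_funB; last exact: mulrr_measurable.
  apply: nondecreasing_measurable => // x y xy.
  have m0 : Num.max x Y0 <= Num.max y Y0 by rewrite ge_max !le_max xy lexx !orbT.
  have h1 : t0 <= expR (Num.max x Y0) by apply: Y0E; rewrite le_max lexx orbT.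
  have h2 : t0 <= expR (Num.max y Y0) by apply: Y0E; rewrite le_max lexx orbT.
  rewrite ler_ln ?posrE ?Ut//; apply: tail_quantile_nd => //.
    exact: lt_le_trans h1.
  by rewrite ler_expR.
pose b (y : R) : R := g (y + 1) - g y.
have nearY (Z : R) : \forall y \near +oo, Z <= y.
  by apply: nbhs_pinfty_ge; rewrite num_real.
have cvg_ga v : (g (y + v) - g y) / a y @[y --> +oo] --> psi v.
  have := @cvg_ell v; apply: cvg_trans; apply: near_eq_cvg; near=> y.
  have y0 : Y0 <= y by near: y; exact: nearY.
  have yv : Y0 <= y + v by rewrite -lerBlDr; near: y; exact: nearY.
  by rewrite (gE _ y0) (gE _ yv).
have psi1 : psi 1 != 0 by exact: psi_neq0.
have cvg_ba : b y / a y @[y --> +oo] --> psi 1 by exact: cvg_ga.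
have ba_neq0 : \forall y \near +oo, b y / a y != 0.
  have := cvg_ba => /cvgrPdist_lt /(_ `|psi 1|); rewrite normr_gt0 => /(_ psi1) h.
  near=> y; apply/eqP => ba0.
  have : `|psi 1 - b y / a y| < `|psi 1| by near: y.
  by rewrite ba0 subr0 ltxx.
have b_neq0 : \forall y \near +oo, b y != 0.
  near=> y; have : b y / a y != 0 by near: y.
  by apply: contra => /eqP ->; rewrite mul0r.
have cvg_quot (h : R -> R) (l : R) : h y / a y @[y --> +oo] --> l ->
    h y / b y @[y --> +oo] --> l / psi 1.
  move=> hl; have : h y / a y * (b y / a y)^-1 @[y --> +oo] --> l / psi 1.
    by apply: cvgM => //; exact: cvgV.
  apply: cvg_trans; apply: near_eq_cvg; near=> y.
  have ay : a y != 0 by near: y; exact: a_neq0.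
  have by0 : b y != 0 by near: y.
  by field; rewrite ay by0.
have cvg_g v : (g (y + v) - g y) / b y @[y --> +oo] --> psi v / psi 1.
  exact: (cvg_quot _ _ (cvg_ga v)).
have cvg_b v : b (y + v) / b y @[y --> +oo] --> expR (rho * v).
  have -> : expR (rho * v) = (psi (v + 1) - psi v) / psi 1.
    move: psi1; rewrite /psi mulrDr mulr1 expRD => psi1; field.
    rewrite lt_eqF//= ; move: psi1; rewrite mulf_eq0 negb_or => /andP[+ _].
    by [].
  apply: (cvg_quot (fun y => b (y + v))).
  rewrite (_ : (fun y => _) =
      (fun y => (g (y + (v + 1)) - g y) / a y - (g (y + v) - g y) / a y)).
    exact: cvgB.
  by apply/funext => y; rewrite /b addrA; ring.
have [C0 [Y1 [C00 unif]]] := locally_uniform_bound mg b_neq0 cvg_g cvg_b (fun v => expR_gt0 _).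
(* Any ratio strictly between [exp rho] and 1 would serve; this is the midpoint. *)
pose th := (expR rho + 1) / 2.
have erho : expR rho < 1 by rewrite expR_lt1.
have erho0 : 0 < expR rho by exact: expR_gt0.
have th1 : th < 1 by rewrite /th; lra.
have th0 : 0 <= th by rewrite /th; lra.
have [Y2 [_ decay]] : \forall y \near +oo, `|b (y + 1)| <= th * `|b y|.
  have e0 : 0 < th - expR rho by rewrite /th; lra.
  have := cvg_b 1; rewrite mulr1 => /cvgrPdist_le /(_ _ e0) h; near=> y.
  have by0 : b y != 0 by near: y.
  have h1 : `|expR rho - b (y + 1) / b y| <= th - expR rho by near: y.
  rewrite -ler_pdivrMr ?normr_gt0// -normfV -normrM.
  have := ler_distD (expR rho) 0 (b (y + 1) / b y).
  rewrite !sub0r !normrN [`|expR rho|]gtr0_norm// ; lra.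
have [Y3 [_ ba_bound]] : \forall y \near +oo, `|b y| <= (`|psi 1| + 1) * `|a y|.
  have := cvg_ba => /cvgrPdist_le /(_ 1 ltr01) h; near=> y.
  have ay : a y != 0 by near: y; exact: a_neq0.
  have h1 : `|psi 1 - b y / a y| <= 1 by near: y.
  rewrite -ler_pdivrMr ?normr_gt0// -normfV -normrM.
  have := ler_distD (psi 1) 0 (b y / a y).
  rewrite !sub0r !normrN; lra.
pose Y := Num.max Y0 (Num.max Y1 (Num.max (Y2 + 1) (Y3 + 1))).
have YY y : Y <= y -> [/\ Y0 <= y, Y1 <= y, Y2 < y & Y3 < y].
  rewrite /Y !ge_max => /andP[? /andP[? /andP[? ?]]]; split => //; lra.
have geom y n : Y <= y -> `|b (y + n%:R)| <= th ^+ n * `|b y|.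
  move=> Yy; elim: n => [|n IH]; first by rewrite addr0 expr0 mul1r.
  have n0 : 0 <= n%:R :> R by [].
  rewrite -natr1 addrA (le_trans (decay _ _))//.
    by have [_ _ + _] := YY _ Yy; lra.
  by rewrite exprS -mulrA ler_wpM2l.
have sum y n : Y <= y -> `|g (y + n%:R) - g y| <= (1 - th ^+ n) / (1 - th) * `|b y|.
  move=> Yy; elim: n => [|n IH]; first by rewrite addr0 subrr normr0 expr0 subrr !mul0r.
  have -> : g (y + n.+1%:R) - g y = b (y + n%:R) + (g (y + n%:R) - g y).
    by rewrite /b -natr1 addrA; ring.
  rewrite (le_trans (ler_normD _ _))// (le_trans (lerD (geom _ n Yy) IH))//.
  rewrite -mulrDl ler_wpM2r// exprS le_eqVlt; apply/orP; left; apply/eqP; field.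
  by rewrite gt_eqF// subr_gt0.
pose D := C0 + (1 - th)^-1.
have D0 : 0 <= D by rewrite addr_ge0// invr_ge0; lra.
exists (D * (`|psi 1| + 1)), Y; split; first by rewrite mulr_ge0// addr_ge0.
move=> y v Yy v0; have [y0 y1 y2 y3] := YY _ Yy.
rewrite -!gE//; last by lra.
apply: (@le_trans _ _ (D * `|b y|)); last by rewrite -mulrA ler_wpM2l// ba_bound.
pose n := Num.truncn v; have /andP[n1 n2] := truncn_itv v0.
have -> : g (y + v) - g y = (g (y + n%:R + (v - n%:R)) - g (y + n%:R)) + (g (y + n%:R) - g y).
  have -> : y + n%:R + (v - n%:R) = y + v by ring.
  by ring.
have n0 : 0 <= n%:R :> R by [].
have h1 : `|g (y + n%:R + (v - n%:R)) - g (y + n%:R)| <= C0 * `|b (y + n%:R)|.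
  apply: unif; first by lra.
  by move: n1 n2; rewrite -/n -natr1 => ? ?; apply/andP; split; lra.
have thn0 : 0 <= th ^+ n by rewrite exprn_ge0.
have h2 : `|b (y + n%:R)| <= `|b y|.
  by rewrite (le_trans (geom _ n Yy))// ler_piMl// exprn_ile1// ltW.
have h3 : `|g (y + n%:R) - g y| <= (1 - th)^-1 * `|b y|.
  rewrite (le_trans (sum _ n Yy))// ler_wpM2r// -[leRHS]mul1r ler_wpM2r ?invr_ge0; lra.
rewrite (le_trans (ler_normD _ _))// /D mulrDl lerD// (le_trans h1)//.
exact: ler_wpM2l.
Unshelve. all: by end_near. Qed.

(** The same increment of [ell] over [[y + v, y + v + 1]] is asymptotic to [psi 1 * a (y + v)] and
    to [exp (rho v) * psi 1 * a y]. Relative errors of one third give the factor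
    [(4 / 3) / (2 / 3) = 2]. *)
Lemma second_order_shift (v : R) :
  \forall y \near +oo, `|a y| <= 2 * expR (- (rho * v)) * `|a (y + v)|.
Proof.
have nearS (Q : R -> Prop) : (\forall y \near +oo, Q y) -> \forall y \near +oo, Q (y + v).
  by move=> [Y [Yr HY]]; exists (Y - v); split; [exact: num_real|move=> y /= yY; apply: HY; lra].
pose c y := ell (y + v + 1) - ell (y + v).
have psi1 : psi 1 != 0 by exact: psi_neq0.
have n1 : 0 < `|psi 1| by rewrite normr_gt0.
have ev : 0 < expR (rho * v) by exact: expR_gt0.
have h1 : \forall y \near +oo, `|psi 1 - c y / a (y + v)| <= `|psi 1| / 3.
  apply: (nearS (fun z => `|psi 1 - (ell (z + 1) - ell z) / a z| <= `|psi 1| / 3)).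
  by have := @cvg_ell 1 => /cvgrPdist_le; apply; rewrite divr_gt0.
have cE : psi (v + 1) - psi v = expR (rho * v) * psi 1.
  by rewrite /psi mulrDr mulr1 expRD; field; rewrite lt_eqF.
have h2 : \forall y \near +oo,
    `|expR (rho * v) * psi 1 - c y / a y| <= expR (rho * v) * `|psi 1| / 3.
  have : c y / a y @[y --> +oo] --> expR (rho * v) * psi 1.
    rewrite -cE (_ : (fun y => _) =
      (fun y => (ell (y + (v + 1)) - ell y) / a y - (ell (y + v) - ell y) / a y)).
      exact: cvgB (@cvg_ell (v + 1)) (@cvg_ell v).
    by apply/funext => y; rewrite /c addrA; ring.
  by move=> /cvgrPdist_le; apply; rewrite divr_gt0// mulr_gt0.
near=> y.
have ay : a y != 0 by near: y; exact: a_neq0.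
have ayv : a (y + v) != 0 by near: y; exact: (nearS (fun z => a z != 0)).
have H1 : `|psi 1 - c y / a (y + v)| <= `|psi 1| / 3 by near: y.
have H2 : `|expR (rho * v) * psi 1 - c y / a y| <= expR (rho * v) * `|psi 1| / 3 by near: y.
have {H1} : `|c y| <= (4 / 3) * `|psi 1| * `|a (y + v)|.
  rewrite -ler_pdivrMr ?normr_gt0// -normfV -normrM.
  have := ler_distD (psi 1) 0 (c y / a (y + v)).
  by rewrite !sub0r !normrN; lra.
have {H2} : (2 / 3) * (expR (rho * v) * `|psi 1|) * `|a y| <= `|c y|.
  rewrite -ler_pdivlMr ?normr_gt0// -normfV -normrM.
  have := ler_distD (c y / a y) 0 (expR (rho * v) * psi 1).
  rewrite !sub0r !normrN [`|expR _ * _|]normrM (gtr0_norm ev) [X in _ <= _ + X]distrC; lra.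
move=> g1 g2; have := le_trans g1 g2.
have -> : 2 / 3 * (expR (rho * v) * `|psi 1|) * `|a y| =
  (2 / 3 * `|psi 1|) * (expR (rho * v) * `|a y|) by ring.
have -> : 4 / 3 * `|psi 1| * `|a (y + v)| = (2 / 3 * `|psi 1|) * (2 * `|a (y + v)|) by field.
rewrite ler_pM2l; last by rewrite mulr_gt0.
by rewrite expRN mulrAC ler_pdivlMr// mulrC.
Unshelve. all: by end_near. Qed.

End Second_order.

(** * Exponential bounds on the tail beyond a deterministic level *)

Section Tail_bounds.
Context {R : realType}.
Variables (F A : R -> R) (gamma rho : R).
Hypothesis F_nd : {homo F : x y / x <= y}.
Hypothesis F_rc : forall y c, (forall z, y < z -> c <= F z) -> c <= F y.
Hypothesis F_Ny : forall e : R, 0 < e -> exists y, F y < e.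
Hypothesis F_y : forall e : R, 0 < e -> exists y, 1 - F y < e.
Hypothesis F_lt1 : forall y, F y < 1.
Hypothesis gamma0 : 0 < gamma.

Local Notation U := (tail_quantile F).

(* [s] is the reciprocal k/n of the argument of U and [u] plays the role of U(1/s). *)
Definition tail_bounds (s u e : R) : Prop :=
  [/\ 0 < u, 0 <= e & forall t, - ln 2 <= t ->
    s * expR (- t - e) <= 1 - F (u * expR (t / gamma)) <= s * expR (- t + e)].

(** Inversion of the two-sided bound on [U]. That bound only looks upward from [y], so the level is
    placed [ln 2] higher on the log scale: arguments down to [t = - ln 2] then remain available. *)
Lemma tail_boundsP (y C : R) : 0 < y -> 0 < U (expR y) -> 0 <= C ->
  (forall v, 0 <= v ->
    `|(ln (U (expR (y + v))) - (y + v) / gamma) - (ln (U (expR y)) - y / gamma)| <= C) ->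
  tail_bounds (expR (- (y + ln 2))) (U (expR y) * expR (ln 2 / gamma)) (gamma * C).
Proof.
move=> y0 Uy C0 unif; have t1 : 1 < expR y by rewrite expR_gt1.
have tv v : 0 <= v -> 1 < expR (y + v) by move=> v0; rewrite expR_gt1; lra.
have Uv v : 0 <= v -> 0 < U (expR (y + v)).
  move=> v0; apply: (lt_le_trans Uy); apply: tail_quantile_nd => //.
  by rewrite ler_expR lerDl.
have ub v : 0 <= v -> U (expR (y + v)) <= U (expR y) * expR (v / gamma + C).
  move=> v0; move: (unif v v0) (Uv v v0) Uy.
  move: (U (expR (y + v))) (U (expR y)) => a b /= + a0 b0.
  rewrite ler_norml mulrDl => /andP[_ h].
  have c0 := expR_gt0 (v / gamma + C).
  by rewrite -ler_ln ?posrE ?mulr_gt0// lnM ?posrE// expRK; lra.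
have lb v : 0 <= v -> U (expR y) * expR (v / gamma - C) <= U (expR (y + v)).
  move=> v0; move: (unif v v0) (Uv v v0) Uy.
  move: (U (expR (y + v))) (U (expR y)) => a b /= + a0 b0.
  rewrite ler_norml mulrDl => /andP[h _].
  have c0 := expR_gt0 (v / gamma - C).
  by rewrite -ler_ln ?posrE ?mulr_gt0// lnM ?posrE// expRK; lra.
have gn0 : gamma != 0 by rewrite gt_eqF.
split; [by rewrite mulr_gt0// expR_gt0|by rewrite mulr_ge0// ltW|move=> t t2].
have -> : U (expR y) * expR (ln 2 / gamma) * expR (t / gamma) =
    U (expR y) * expR ((t + ln 2) / gamma).
  by rewrite -mulrA -expRD; congr (_ * expR _); field.
rewrite -!expRD; set z := U (expR y) * expR ((t + ln 2) / gamma).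
have g2 : 0 <= t + ln 2 by lra.
apply/andP; split; last first.
  (* When the shift is negative the claimed bound exceeds [exp (- y)], which monotonicity of the
     tail already gives. *)
  have [v0|v0] := leP 0 (t + ln 2 - gamma * C).
    have -> : - (y + ln 2) + (- t + gamma * C) = - (y + (t + ln 2 - gamma * C)) by ring.
    rewrite expRN -tail_quantile_le//; last exact: tv.
    rewrite (le_trans (ub _ v0))// le_eqVlt; apply/orP; left; apply/eqP.
    by congr (_ * expR _); field.
  apply: (@le_trans _ _ (expR y)^-1).
    have h1 : 1 <= expR ((t + ln 2) / gamma).
      have h2 : 0 <= (t + ln 2) / gamma by apply: divr_ge0 => //; exact: ltW.
      by have := expR_ge1Dx ((t + ln 2) / gamma); lra.
    have : U (expR y) <= z by rewrite /z -[leLHS]mulr1; apply: ler_wpM2l => //; exact: ltW.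
    by rewrite tail_quantile_le.
  by rewrite -expRN ler_expR; lra.
rewrite leNgt; apply/negP => lt.
have F0 : 0 < 1 - F z by rewrite subr_gt0.
(* Chosen so that [exp (y + v)] is the reciprocal of the tail at [z]; then [U (exp (y + v)) <= z]
   contradicts the lower bound on [U]. *)
pose v := - y - ln (1 - F z).
have vE : expR (y + v) = (1 - F z)^-1 by rewrite /v addrA subrr sub0r expRN lnK ?posrE.
have vt : t + ln 2 + gamma * C < v.
  by move: lt; rewrite -ltr_ln ?posrE ?expR_gt0// expRK /v; lra.
have gC : 0 <= gamma * C by rewrite mulr_ge0// ltW.
have v0 : 0 <= v by lra.
have : U (expR (y + v)) <= z.
  by rewrite tail_quantile_le ?tv// vE invrK.
apply/negP; rewrite -ltNge; apply: lt_le_trans (lb v v0).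
rewrite ltr_pM2l// ltr_expR ltrBrDr.
have -> : (t + ln 2) / gamma + C = (t + ln 2 + gamma * C) / gamma by field.
by rewrite ltr_pM2r// invr_gt0.
Qed.

(** Evaluate the tail bounds at [L + e] and [L - e - kap] and invert. The slack [kap] provides the
    strict inequality needed to bound the infimum from below. *)
Lemma survival_inv_bounds (s u e p kap : R) : tail_bounds s u e -> 0 < s -> 0 < p < 1 ->
  0 < kap -> e + kap <= ln (s / p) ->
  0 < survival_inv F p /\
  `|gamma * (ln (survival_inv F p) - ln u) - ln (s / p)| <= e + kap.
Proof.
move=> [u0 e0 tb] s0 p01 kap0 eL; have /andP[p0 p1] := p01.
set L := ln (s / p) in eL *.
have pE : p = s * expR (- L) by rewrite /L expRN lnK ?posrE ?divr_gt0//; field; rewrite !gt_eqF.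
have ln2 : 0 < ln 2 :> R by rewrite ln_gt0// ltr1n.
have up : survival_inv F p <= u * expR ((L + e) / gamma).
  rewrite survival_inv_le//.
  have [|_ +] := andP (tb (L + e) _); first by lra.
  by rewrite (_ : - (L + e) + e = - L) -?pE//; ring.
have low : u * expR ((L - e - kap) / gamma) < survival_inv F p.
  rewrite ltNge survival_inv_le// -ltNge.
  have [|+ _] := andP (tb (L - e - kap) _); first by lra.
  apply: lt_le_trans; rewrite pE ltr_pM2l// ltr_expR; lra.
have x0 : 0 < survival_inv F p by rewrite (lt_trans _ low)// mulr_gt0// expR_gt0.
split => //.
have l1 : ln (survival_inv F p) <= ln u + (L + e) / gamma.
  by rewrite -[X in _ + X]expRK -lnM ?posrE ?expR_gt0// ler_ln ?posrE// mulr_gt0// expR_gt0.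
have l2 : ln u + (L - e - kap) / gamma <= ln (survival_inv F p).
  by rewrite -[X in _ + X]expRK -lnM ?posrE ?expR_gt0// ler_ln ?posrE ?mulr_gt0 ?expR_gt0// ltW.
have gn0 : gamma != 0 by rewrite gt_eqF.
have {}l1 : gamma * (ln (survival_inv F p) - ln u) <= L + e.
  by rewrite -ler_pdivlMl// mulrC; lra.
have {}l2 : L - e - kap <= gamma * (ln (survival_inv F p) - ln u).
  by rewrite -ler_pdivrMl// mulrC; lra.
by rewrite ler_norml; apply/andP; split; lra.
Qed.

Hypothesis rho0 : rho < 0.
Hypothesis A_to0 : A t @[t --> +oo] --> (0 : R).
Hypothesis second_order : forall x : R, 0 < x ->
  (tail_quantile F (t * x) / tail_quantile F t - x `^ (gamma^-1)) / A t
    @[t --> +oo] --> x `^ (gamma^-1) * ((x `^ rho - 1) / rho).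

(** The level is [U (n / (2 k))] times [2 ^ (1 / gamma)]. The uniform bound is in terms of [A] at
    [n / (2 k)], and [second_order_shift] with [v = ln 2] replaces it by [A (n / k)]. *)
Lemma second_order_tail_bounds (k : nat -> nat) :
  k n @[n --> \oo] --> \oo -> (k n)%:R / n%:R @[n --> \oo] --> (0 : R) ->
  exists (u : nat -> R) (D : R), 0 <= D /\ \forall n \near \oo,
    tail_bounds ((k n)%:R / n%:R) (u n) (D * `|A (n%:R / (k n)%:R)|).
Proof.
move=> koo k0.
have [C [Y [C0 unif]]] := second_order_uniform F_nd F_rc F_Ny F_y F_lt1 rho0 A_to0 second_order.
have shift := second_order_shift F_nd F_rc F_Ny F_y F_lt1 rho0 A_to0 second_order (ln 2).
have [t0 t01 Ut] := tail_quantile_gt0 F_nd F_rc F_Ny F_y F_lt1.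
pose D := gamma * (C * (2 * expR (- (rho * ln 2)))).
exists (fun n => U (expR (ln (n%:R / (k n)%:R) - ln 2)) * expR (ln 2 / gamma)), D.
split; first by rewrite !mulr_ge0// ?ltW// expR_ge0.
have kn0 : \forall n \near \oo, 0 < (k n)%:R / n%:R :> R.
  near=> n; rewrite divr_gt0// ltr0n; near: n; last exact: nbhs_infty_gt.
  by have := koo _ (nbhs_infty_gt 0%N).
have yoo : ln (n%:R / (k n)%:R) - ln 2 @[n --> \oo] --> (+oo : set_system R).
  apply/cvgryPge => B.
  have e0 : 0 < (expR (B + ln 2))^-1 by rewrite invr_gt0 expR_gt0.
  have kB : \forall n \near \oo, `|(k n)%:R / n%:R : R| <= (expR (B + ln 2))^-1.
    by move/cvgr0Pnorm_le: k0 => /(_ _ e0).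
  near=> n.
  have kn : 0 < (k n)%:R / n%:R :> R by near: n.
  have nk : 0 < n%:R / (k n)%:R :> R by rewrite -invf_div invr_gt0.
  rewrite lerBrDr -[leLHS]expRK ler_ln ?posrE ?expR_gt0//.
  rewrite -invf_div -[leLHS]invrK lef_pV2 ?posrE ?invr_gt0 ?expR_gt0//.
  by apply: le_trans (ler_norm _) _; near: n.
have big (Q : R -> Prop) : (\forall y \near +oo, Q y) ->
    \forall n \near \oo, Q (ln (n%:R / (k n)%:R) - ln 2) by exact: yoo.
have B1 := big _ (nbhs_pinfty_ge (num_real Y)).
have B2 : \forall n \near \oo, 0 < ln (n%:R / (k n)%:R) - ln 2 :> R.
  by apply: (big (fun y => 0 < y)); exact: nbhs_pinfty_gt.
have B3 := big _ (nbhs_pinfty_ge (num_real (ln t0))).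
have B4 := big _ shift.
near=> n.
have kn : 0 < (k n)%:R / n%:R :> R by near: n.
have nk : 0 < n%:R / (k n)%:R :> R by rewrite -invf_div invr_gt0.
have yY : Y <= ln (n%:R / (k n)%:R) - ln 2 by near: n; exact: B1.
have y0 : 0 < ln (n%:R / (k n)%:R) - ln 2 :> R by near: n; exact: B2.
have yt : ln t0 <= ln (n%:R / (k n)%:R) - ln 2 by near: n; exact: B3.
have ysh : `|A (expR (ln (n%:R / (k n)%:R) - ln 2))| <= 2 * expR (- (rho * ln 2)) *
  `|A (expR (ln (n%:R / (k n)%:R) - ln 2 + ln 2))| by near: n; exact: B4.
set y := ln (n%:R / (k n)%:R) - ln 2 in yY y0 yt ysh *.
have Uy : 0 < U (expR y).
  by apply: Ut; rewrite -[t0]lnK ?posrE ?ler_expR// (lt_trans _ t01).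
have yE : y + ln 2 = ln (n%:R / (k n)%:R) by rewrite /y subrK.
have sE : (k n)%:R / n%:R = expR (- (y + ln 2)) by rewrite yE expRN lnK ?posrE// invf_div.
have := @tail_boundsP y (C * (2 * expR (- (rho * ln 2)) * `|A (n%:R / (k n)%:R)|)) y0 Uy.
rewrite -sE /D !mulrA; apply.
  by rewrite !mulr_ge0// expR_ge0.
move=> v v0; apply: le_trans (unif y v yY v0) _.
by rewrite -!mulrA ler_wpM2l// !mulrA (le_trans ysh)// yE lnK ?posrE.
Unshelve. all: by end_near. Qed.

End Tail_bounds.

(** * Moments as integrals of the tail *)

Section Layer_cake.
Context {d : measure_display} {T : measurableType d} {R : realType}.
Variables (P : probability T R) (W : T -> R).
Hypothesis mW : measurable_fun setT W.
Hypothesis W0 : forall w, 0 <= W w.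
Local Notation mu := (@lebesgue_measure R).

Let graph : set (T * R) := [set z | 0 <= z.2 /\ z.2 < W z.1].

Let measurable_graph : measurable graph.
Proof.
have -> : graph = ((snd : T * R -> R) @^-1` `[0, +oo[%classic) `&`
    ((fun z : T * R => W z.1 - z.2) @^-1` `]0, +oo[%classic).
  by apply/seteqP; split => z /=; rewrite !in_itv/= !andbT subr_gt0.
apply: measurableI; rewrite -[X in measurable X]setTI.
  exact: measurable_snd.
apply: (measurable_funB _ measurable_snd) => //.
exact: measurableT_comp.
Qed.

Let FTC (n : nat) (w : R) : 0 <= w ->
  (\int[mu]_(t in `[0%R, w]) (n.+1%:R * t ^+ n)%:E = (w ^+ n.+1)%:E)%E.
Proof.
rewrite le_eqVlt => /predU1P[<-|w0].
  by rewrite set_itv1 integral_set1 expr0n.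
have dX (t : R) : is_derive t 1 (fun x : R => x ^+ n.+1) (n.+1%:R * t ^+ n).
  apply: DeriveDef; first exact: exprn_derivable.
  by rewrite exp_derive /GRing.scale/= mulr1.
have cX : continuous (fun x : R => x ^+ n.+1) by exact: exprn_continuous.
rewrite (@continuous_FTC2 _ _ (fun x : R => x ^+ n.+1)) => //.
- by rewrite expr0n/= sube0.
- apply: continuous_subspaceT => x; apply: cvgMr; exact: exprn_continuous.
- split => //.
  + by apply: cvg_at_right_filter; exact: cX.
  + by apply: cvg_at_left_filter; exact: cX.
- by move=> x _; rewrite derive1E; case: (dX x).
Qed.

(** Tonelli on the region under the graph of [W]. *)
Lemma layer_cake (n : nat) :
  (\int[P]_w (W w ^+ n.+1)%:E =
   \int[mu]_(t in `[0%R, +oo[) ((n.+1%:R * t ^+ n)%:E * P [set w | (t < W w)%R]))%E.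
Proof.
pose h (z : T * R) : \bar R := (n.+1%:R * z.2 ^+ n * \1_graph z)%:E.
have mh : measurable_fun setT h.
  apply/measurable_EFinP; apply: measurable_funM; last exact: measurable_indic.
  by apply: measurable_funM => //; apply: measurable_funX; exact: measurable_snd.
have h0 z : (0 <= h z)%E.
  rewrite lee_fin /h indicE; have [|_] := boolP (z \in graph); last by rewrite mulr0.
  by rewrite inE => -[z0 _]; rewrite mulr1 mulr_ge0// exprn_ge0.
have hE w t : h (w, t) = ((fun t => (n.+1%:R * t ^+ n)%:E) \_ (`[0, W w[%classic)) t.
  rewrite /h patchE indicE; have -> : ((w, t) \in graph) = (t \in `[0, W w[%classic).
    by apply/idP/idP; rewrite !inE /graph /= in_itv/= => /andP.
  by case: ifP => _; rewrite ?mulr1 ?mulr0.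
transitivity (\int[P]_w \int[mu]_t h (w, t))%E.
  apply: eq_integral => w _.
  under eq_integral do rewrite hE.
  rewrite -integral_mkcond integral_itv_bndo_bndc ?FTC//.
  apply: measurable_funTS; apply/measurable_EFinP; apply: measurable_funM => //.
rewrite fubini_tonelli// [RHS]integral_mkcond; apply: eq_integral => t _.
rewrite patchE; have [t0|t0] := leP 0 t.
  rewrite mem_set; last by rewrite /= in_itv/= andbT.
  rewrite (_ : (fun w => h (w, t)) =
     (fun w => (n.+1%:R * t ^+ n)%:E * (\1_[set w | (t < W w)%R] w)%:E)%E).
    have mA : measurable [set w | (t < W w)%R].
      rewrite (_ : [set w | _] = setT `&` W @^-1` `]t, +oo[%classic); first exact: mW.
      by rewrite setTI; apply/seteqP; split => w /=; rewrite in_itv/= andbT.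
    rewrite ge0_integralZl.
    - by rewrite integral_indic ?setIT.
    - exact: measurableT.
    - by apply/measurable_EFinP; exact: measurable_indic.
    - by move=> w _; rewrite lee_fin.
    - by rewrite lee_fin mulr_ge0// exprn_ge0.
  apply/funext => w; rewrite /h EFinM; congr (_ * (_)%:E)%E.
  rewrite !indicE; congr (_%:R); apply: congr1; apply/idP/idP; rewrite !inE /graph/=.
    by case.
  by split.
rewrite memNset; last by rewrite /= in_itv/= andbT leNgt t0.
apply: integral0_eq => w _; rewrite /h indicE memNset ?mulr0//.
by rewrite /graph /= leNgt t0 => -[].
Qed.

End Layer_cake.

(** * The integrals of [t ^ n exp (- t)] for small [n] *)

Section Gamma_integrals.
Context {R : realType}.
Local Notation mu := (@lebesgue_measure R).

Let step (h p : {poly R}) : (forall x, 0 <= x -> 0 <= h.[x]) -> p^`() - p = h ->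
  p.[x] * expR (- x) @[x --> +oo] --> (0 : R) ->
  (\int[mu]_(x in `[0%R, +oo[) (h.[x] * expR (- x))%:E = (- p.[0])%:E)%E.
Proof.
move=> h0 ph p0.
have dF (x : R) : is_derive x 1 (fun x => p.[x] * expR (- ('X : {poly R}).[x]))
    (h.[x] * expR (- ('X : {poly R}).[x])).
  apply: (is_derive_eq (is_derive_poly_expRN p 'X x)).
  by rewrite derivX hornerC mulr1 -ph hornerD hornerN.
under eq_integral do rewrite -[X in expR (- X)]hornerX.
rewrite (ge0_FTC_half_line _ _ dF).
- by rewrite hornerX oppr0 expR0 mulr1.
- by move=> x x0; rewrite mulr_ge0 ?h0 ?expR_ge0.
- exact: continuous_poly_expRN.
- by under eq_fun do rewrite hornerX.
Qed.

Lemma gamma_integral (n : nat) : (n <= 2)%N ->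
  (\int[mu]_(t in `[0%R, +oo[) (t ^+ n * expR (- t))%:E = (n`!%:R)%:E)%E.
Proof.
case: n => [|[|[|//]]] _.
- under eq_integral => t _ do rewrite expr0 -(hornerC 1 t).
  rewrite (@step 1%:P (- 1%:P)).
  + by rewrite hornerN hornerC opprK.
  + by move=> x _; rewrite hornerC.
  + by rewrite derivN derivC oppr0 sub0r opprK.
  + under eq_fun do rewrite hornerN hornerC mulN1r.
    by rewrite -oppr0; apply: cvgN; exact: cvgr_expR.
- under eq_integral => t _ do rewrite expr1 -{1}(hornerX t).
  rewrite (@step 'X (- ('X + 1%:P))).
  + by rewrite hornerN hornerD hornerX hornerC add0r opprK.
  + by move=> x x0; rewrite hornerX.
  + by rewrite derivN derivD derivX derivC addr0 opprK addrCA addNr addr0.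
  + rewrite (_ : (fun x => _) = (fun x : R => - (x ^+ 1 * expR (- x) + x ^+ 0 * expR (- x)))).
      rewrite -oppr0; apply: cvgN; rewrite -[X in _ --> X](addr0 0).
      by apply: cvgD; exact: cvg_expRM.
    by apply/funext => x; rewrite hornerN hornerD hornerX hornerC; ring.
- under eq_integral do rewrite -[X in X * _]hornerXn.
  rewrite (@step 'X^2 (- ('X^2 + 2 *: 'X + 2%:P))).
  + by rewrite hornerN !hornerD hornerZ hornerXn hornerX hornerC expr0n/= mulr0 !add0r opprK.
  + by move=> x x0; rewrite hornerXn sqr_ge0.
  + rewrite derivN !derivD derivXn derivZ derivX derivC addr0 opprK expr1.
    by rewrite -mulr_natl -!mul_polyC; ring.
  + rewrite (_ : (fun x => _) = (fun x : R => - (x ^+ 2 * expR (- x) +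
       2 * (x ^+ 1 * expR (- x)) + 2 * (x ^+ 0 * expR (- x))))).
      rewrite -oppr0; apply: cvgN; rewrite -[X in _ --> X](addr0 0).
      apply: cvgD; last by rewrite -(mulr0 2); apply: cvgMr; exact: cvg_expRM.
      rewrite -[X in _ --> X](addr0 0); apply: cvgD; first exact: cvg_expRM.
      by rewrite -(mulr0 2); apply: cvgMr; exact: cvg_expRM.
    by apply/funext => x; rewrite hornerN !hornerD hornerZ hornerXn hornerX hornerC; ring.
Qed.
End Gamma_integrals.

(** * Normalized log excess and score *)

Section Excess.
Context {R : realType}.
Implicit Types gamma u x : R.

Definition excess gamma u x : R := (u < x)%R%:R * (gamma * (ln x - ln u)).

(** The excess over [u] is approximately standard exponential given exceedance; subtracting its mean
    1 on that event centres it. *)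
Definition score gamma u x : R := excess gamma u x - (u < x)%R%:R.

Lemma measurable_gt u : measurable_fun setT (fun x : R => (u < x)%R%:R : R).
Proof.
rewrite (_ : (fun x => _) = \1_(`]u, +oo[%classic)); first exact: measurable_indic.
apply/funext => x; rewrite indicE; congr (_%:R); congr nat_of_bool.
by apply/idP/idP; rewrite inE /= in_itv/= andbT.
Qed.

Lemma measurable_excess gamma u : measurable_fun setT (excess gamma u).
Proof.
apply: measurable_funM; first exact: measurable_gt.
by apply: measurable_funM => //; apply: measurable_funB => //; exact: measurable_ln.
Qed.

Lemma measurable_score gamma u : measurable_fun setT (score gamma u).
Proof. by apply: measurable_funB; [exact: measurable_excess|exact: measurable_gt]. Qed.

Lemma excess_ge0 gamma u x : 0 < gamma -> 0 < u -> 0 <= excess gamma u x.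
Proof.
move=> g0 u0; rewrite /excess; have [ux|_] := ltP u x; last by rewrite mul0r.
rewrite mul1r mulr_ge0 ?(ltW g0)// subr_ge0 ler_ln ?posrE// ?ltW//.
exact: lt_trans ux.
Qed.

Lemma lt_excess gamma u x t : 0 < gamma -> 0 < u -> 0 <= t ->
  (t < excess gamma u x) = (u * expR (t / gamma) < x).
Proof.
move=> g0 u0 t0; rewrite /excess.
have e1 : 1 <= expR (t / gamma).
  by have := expR_ge1Dx (t / gamma); have := divr_ge0 t0 (ltW g0); lra.
have ue : 0 < u * expR (t / gamma) by rewrite mulr_gt0// expR_gt0.
have [ux|xu] := ltP u x; last first.
  rewrite mul0r ltNge t0/=; apply/esym/negbTE; rewrite -leNgt (le_trans xu)//.
  by rewrite ler_peMr// ltW.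
have x0 : 0 < x by exact: lt_trans ux.
rewrite mul1r -ltr_pdivrMl// mulrC -[RHS]ltr_ln ?posrE// lnM ?posrE ?expR_gt0// expRK.
by rewrite ltrBrDl.
Qed.

End Excess.

(** * Moments of the score *)

Section Score_moments.
Context {d : measure_display} {T : measurableType d} {R : realType}.
Variables (P : probability T R) (X : {RV P >-> R}) (F : R -> R).
Variables gamma s u e : R.
Hypothesis cdfX : forall x, cdf X x = (F x)%:E.
Hypothesis gamma0 : 0 < gamma.
Hypothesis s0 : 0 <= s.
Hypothesis tb : tail_bounds F gamma s u e.
Local Notation mu := (@lebesgue_measure R).

Let u0 : 0 < u. Proof. by case: tb. Qed.
Let e0 : 0 <= e. Proof. by case: tb. Qed.

Lemma probability_gt (v : R) : P [set w | v < X w] = (1 - F v)%:E.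
Proof.
rewrite (_ : [set w | v < X w] = ~` (X @^-1` `]-oo, v]%classic)).
  by rewrite probability_setC ?[X in (1 - X)%E]cdfX//; exact: measurable_funPTI.
by apply/seteqP; split => w /=; rewrite in_itv/= leNgt; [move=> ->|move=> /negP/negPn].
Qed.

Let W w := excess gamma u (X w).
Let I w : R := (u < X w)%R%:R.
Let mW : measurable_fun setT W.
Proof. exact: (measurableT_comp (measurable_excess gamma u) (measurable_funPT X)). Qed.
Let mI : measurable_fun setT I.
Proof. exact: (measurableT_comp (measurable_gt u) (measurable_funPT X)). Qed.
Let W0 w : 0 <= W w. Proof. exact: excess_ge0. Qed.

Let PW t : 0 <= t -> P [set w | (t < W w)%R] = (1 - F (u * expR (t / gamma)))%:E.
Proof.
move=> t0; rewrite -probability_gt; congr (P _).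
by apply/seteqP; split => w /=; rewrite lt_excess.
Qed.

(** The tail of the excess lies between [s exp (- t - e)] and [s exp (- t + e)]; integrate with the
    layer-cake formula. *)
Let moment_bounds n : (n <= 2)%N ->
  ((s * expR (- e) * (n.+1)`!%:R)%:E <= \int[P]_w (W w ^+ n.+1)%:E <=
   (s * expR e * (n.+1)`!%:R)%:E)%E.
Proof.
move=> n2.
have gammaE (c : R) : 0 <= c ->
   (\int[mu]_(t in `[0%R, +oo[) (c * n.+1%:R * (t ^+ n * expR (- t)))%:E =
    (c * (n.+1)`!%:R)%:E)%E.
  move=> c0; under eq_integral do rewrite EFinM.
  rewrite ge0_integralZl//.
  - by rewrite gamma_integral// -EFinM -mulrA -natrM -factS.
  - apply: measurable_funTS; apply/measurable_EFinP; apply: measurable_funM => //.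
    by apply: measurableT_comp => //; exact: oppr_measurable.
  - by move=> t; rewrite /= in_itv/= andbT => t0; rewrite lee_fin mulr_ge0 ?exprn_ge0 ?expR_ge0.
  - by rewrite lee_fin mulr_ge0.
have mP : measurable_fun (`[0%R, +oo[%classic : set R)
    (fun t => ((n.+1%:R * t ^+ n)%:E * P [set w | (t < W w)%R])%E).
  suff : measurable_fun (`[0%R, +oo[%classic : set R)
      (fun t => (n.+1%:R * t ^+ n * (1 - F (u * expR (t / gamma))))%:E).
    apply: eq_measurable_fun => t.
    by rewrite inE/= in_itv/= andbT => t0; rewrite PW// -EFinM.
  apply: measurable_funTS; apply/measurable_EFinP.
  have mF : measurable_fun (setT : set R) F.
    apply: nondecreasing_measurable => // x y xy.
    by rewrite -lee_fin -!cdfX cdf_nondecreasing.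
  have mu' : measurable_fun (setT : set R) (fun t => u * expR (t / gamma)).
    apply: measurable_funM => //; apply: measurableT_comp => //.
    exact: measurable_funM.
  have mFu : measurable_fun (setT : set R) (fun t => F (u * expR (t / gamma))).
    exact: (measurableT_comp mF mu').
  have mX : measurable_fun (setT : set R) (fun t : R => n.+1%:R * t ^+ n).
    exact: measurable_funM.
  apply: (measurable_funM mX).
  by apply: measurable_funB.
have mexpN : measurable_fun (setT : set R) (fun t => expR (- t)).
  by apply: measurableT_comp => //; exact: oppr_measurable.
have mc (c : R) : measurable_fun (`[0%R, +oo[%classic : set R)
   (fun t => (c * n.+1%:R * (t ^+ n * expR (- t)))%:E).
  apply: measurable_funTS; apply/measurable_EFinP.
  exact: (measurable_funM (measurable_cst _) (measurable_funM (exprn_measurable n) mexpN)).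
have bnd t : 0 <= t -> s * expR (- t - e) <= 1 - F (u * expR (t / gamma)) <= s * expR (- t + e).
  case: tb => _ _ h t0; apply: h; rewrite (le_trans _ t0)// oppr_le0 ln_ge0// ler1n.
  by [].
rewrite layer_cake//; apply/andP; split.
  rewrite -gammaE; last by rewrite mulr_ge0// expR_ge0.
  apply: ge0_le_integral; [exact: measurable_itv| |exact: mc|exact: mP|].
  - move=> t; rewrite /= in_itv/= andbT => t0.
    by rewrite lee_fin !mulr_ge0 ?exprn_ge0 ?expR_ge0.
  - move=> t; rewrite /= in_itv/= andbT => t0; rewrite PW// -EFinM lee_fin.
    have /andP[h _] := bnd t t0; have := ler_wpM2l (mulr_ge0 (ler0n R n.+1) (exprn_ge0 n t0)) h.
    by apply: le_trans; rewrite expRD le_eqVlt; apply/orP; left; apply/eqP; ring.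
rewrite -gammaE; last by rewrite mulr_ge0// expR_ge0.
apply: ge0_le_integral; [exact: measurable_itv| |exact: mP|exact: mc|].
- move=> t; rewrite /= in_itv/= andbT => t0.
  by rewrite mule_ge0// lee_fin mulr_ge0// exprn_ge0.
- move=> t; rewrite /= in_itv/= andbT => t0; rewrite PW// -EFinM lee_fin.
  have /andP[_ h] := bnd t t0; have := ler_wpM2l (mulr_ge0 (ler0n R n.+1) (exprn_ge0 n t0)) h.
  by move=> /le_trans; apply; rewrite expRD le_eqVlt; apply/orP; left; apply/eqP; ring.
Qed.

Let intW n : (0 < n <= 3)%N -> P.-integrable setT (EFin \o (fun w => W w ^+ n)).
Proof.
case: n => [//|n] /andP[_ n2]; apply/integrableP; split.
  by apply/measurable_EFinP; exact: measurable_funX.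
under eq_integral do rewrite /= ger0_norm ?exprn_ge0//.
by have /andP[_ h] := moment_bounds n2; rewrite (le_lt_trans h)// ltry.
Qed.

Let intI : P.-integrable setT (EFin \o I).
Proof.
apply: (bounded_integrable _ (M := 1)) => // w.
by rewrite /I; case: (u < X w); rewrite ?normr1 ?normr0.
Qed.

Let momentR n : (n <= 2)%N ->
  s * expR (- e) * (n.+1)`!%:R <= \int[P]_w (W w ^+ n.+1) <= s * expR e * (n.+1)`!%:R.
Proof.
move=> n2; have := moment_bounds n2; rewrite -!lee_fin EFin_Rintegral//.
exact: intW.
Qed.

Let EI : s * expR (- e) <= \int[P]_w I w <= s * expR e.
Proof.
have -> : \int[P]_w I w = 1 - F u.
  rewrite (_ : I = \1_[set w | u < X w]).
    have mA : measurable [set w | u < X w].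
      rewrite (_ : [set w | _] = X @^-1` `]u, +oo[%classic); first exact: measurable_funPTI.
      by apply/seteqP; split => w /=; rewrite in_itv/= andbT.
    rewrite /Rintegral integral_indic// setIT -[RHS]/(fine (1 - F u)%:E).
    congr fine; exact: probability_gt.
  apply/funext => w; rewrite indicE /I; congr (_%:R); congr nat_of_bool.
  by apply/idP/idP; rewrite inE.
case: tb => _ _ /(_ 0); rewrite oppr_le0 mul0r expR0 mulr1 oppr0 sub0r add0r; apply.
by rewrite ln_ge0// ler1n.
Qed.

Let score2 w : score gamma u (X w) ^+ 2 = W w ^+ 2 - 2 * W w ^+ 1 + I w.
Proof. by rewrite /score /W /I /excess; case: (u < X w) => /=; ring. Qed.

Let score3 w : `|score gamma u (X w)| ^+ 3 <= W w ^+ 3 + I w.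
Proof.
have := W0 w; rewrite /score /W /I.
have : (u < X w)%R%:R = 1 :> R \/ excess gamma u (X w) = 0 /\ (u < X w)%R%:R = 0 :> R.
  by rewrite /excess; case: (u < X w) => /=; [left|right; rewrite mul0r].
move: (excess _ _ _) ((u < X w)%R%:R : R) => a i [->|[-> ->]] a0; last first.
  by rewrite subrr normr0 !expr0n/= addr0.
have [a1|a1] := leP a 1.
  rewrite ler0_norm ?subr_le0// opprB (@le_trans _ _ 1)//.
    by rewrite exprn_ile1// ?subr_ge0//; lra.
  by rewrite lerDr exprn_ge0.
rewrite gtr0_norm ?subr_gt0// (@le_trans _ _ (a ^+ 3))//.
  by rewrite lerXn2r ?nnegrE//; lra.
by rewrite lerDl.
Qed.

Let mscore : measurable_fun setT (score gamma u \o X).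
Proof. exact: (measurableT_comp (measurable_score gamma u) (measurable_funPT X)). Qed.

Let int_dom : P.-integrable setT (EFin \o (fun w => W w ^+ 3 + I w)).
Proof.
exact: (integrableD measurableT (@intW 3 isT) intI).
Qed.

Let int2W : P.-integrable setT (EFin \o (fun w => 2 * W w ^+ 1)).
Proof. exact: (integrableZl measurableT 2 (@intW 1 isT)). Qed.

Let int2WB : P.-integrable setT (EFin \o (fun w => W w ^+ 2 - 2 * W w ^+ 1)).
Proof. exact: (integrableB measurableT (@intW 2 isT) int2W). Qed.

Lemma score_integrable :
  [/\ P.-integrable setT (EFin \o (score gamma u \o X)),
      P.-integrable setT (EFin \o (fun w => score gamma u (X w) ^+ 2)) &
      P.-integrable setT (EFin \o (fun w => `|score gamma u (X w)| ^+ 3))].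
Proof.
split.
- exact: (integrableB measurableT (@intW 1 isT) intI).
- rewrite (_ : (fun w => _) = (fun w => W w ^+ 2 - 2 * W w ^+ 1 + I w)).
    exact: (integrableD measurableT int2WB intI).
  by apply/funext => w; rewrite score2.
- apply: (le_integrable measurableT _ _ int_dom).
    apply/measurable_EFinP; apply: measurable_funX.
    exact: (measurableT_comp (@normr_measurable R setT) mscore).
  move=> w _; rewrite /= lee_fin ger0_norm ?exprn_ge0//.
  by rewrite (le_trans (score3 w))// ler_norm.
Qed.

(** Up to factors [exp (+- e)], the first three moments of the excess are [s], [2 s], [6 s] and the
    exceedance probability is [s]. Hence mean [s - s = 0] and second moment [2 s - 2 s + s = s]; the
    third absolute moment is bounded through [score3] by [6 s + s]. *)
Lemma score_moments :
  [/\ `|\int[P]_w score gamma u (X w)| <= s * (expR e - expR (- e)),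
      `|\int[P]_w (score gamma u (X w) ^+ 2) - s| <= 3 * (s * (expR e - expR (- e))) &
      \int[P]_w (`|score gamma u (X w)| ^+ 3) <= 7 * (s * expR e)].
Proof.
have s1 : s <= s * expR e.
  by rewrite ler_peMr// -expR0 ler_expR.
have s2 : s * expR (- e) <= s.
  by rewrite ler_piMr// -expR0 ler_expR oppr_le0.
have /andP[m1l m1u] := @momentR 0 isT.
have /andP[m2l m2u] := @momentR 1 isT.
have /andP[m3l m3u] := @momentR 2 isT.
have /andP[il iu] := EI.
rewrite (_ : 1`!%:R = 1 :> R)// in m1l m1u.
rewrite (_ : 2`!%:R = 2 :> R)// in m2l m2u.
rewrite (_ : 3`!%:R = 6 :> R)// in m3l m3u.
have [_ _ int3] := score_integrable.
split.
- have -> : \int[P]_w score gamma u (X w) = \int[P]_w (W w ^+ 1) - \int[P]_w I w.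
    exact: (RintegralB measurableT (@intW 1 isT) intI).
  by rewrite ler_norml; apply/andP; split; lra.
- under eq_Rintegral do rewrite score2.
  rewrite (RintegralD measurableT int2WB intI).
  rewrite (RintegralB measurableT (@intW 2 isT) int2W).
  rewrite (RintegralZl 2 measurableT (@intW 1 isT)).
  by rewrite ler_norml; apply/andP; split; lra.
- apply: (@le_trans _ _ (\int[P]_w (W w ^+ 3 + I w))).
    by apply: (le_Rintegral measurableT int3 int_dom) => w _; exact: score3.
  rewrite (RintegralD measurableT (@intW 3 isT) intI); lra.
Qed.

Lemma exceedance_probability : s * expR (- e) <= 1 - F u <= s * expR e.
Proof.
case: tb => _ _ /(_ 0); rewrite oppr_le0 mul0r expR0 mulr1 oppr0 sub0r add0r; apply.
by rewrite ln_ge0// ler1n.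
Qed.

End Score_moments.

(** * Existence and uniqueness of the multiplier *)

Section Multiplier_equation.
Context {R : realType}.
Variables k n S D p : R.
Hypothesis k0 : 0 < k.
Hypothesis kn : k < n.
Hypothesis S0 : 0 < S.
Hypothesis p01 : 0 < p < 1.
Implicit Types l : R.

Definition multiplier_fun l : R :=
  k * D / (S - l * D) + ln p - ln ((k - l) / (n - l)).

Local Notation h := multiplier_fun.

Let p0 : 0 < p. Proof. by case/andP: p01. Qed.
Let lnp : ln p < 0. Proof. by apply: ln_lt0. Qed.
Let n0 : 0 < n. Proof. exact: lt_trans kn. Qed.

Let ratio_gt0 l : l < k -> 0 < (k - l) / (n - l).
Proof. by move=> lk; rewrite divr_gt0// subr_gt0//; exact: lt_trans kn. Qed.

(** The derivative of the first term is [k D ^ 2 / (S - l D) ^ 2 >= 0], and [(k - l) / (n - l)]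
    decreases strictly because [k < n]. *)
Lemma multiplier_fun_lt l l' : l < l' -> l' < k -> 0 < S - l * D -> 0 < S - l' * D ->
  h l < h l'.
Proof.
move=> ll' lk' l0 l0'; have lk : l < k by exact: lt_trans lk'.
have : k * D / (S - l * D) <= k * D / (S - l' * D).
  rewrite ler_pdivrMr// mulrAC ler_pdivlMr// -subr_ge0.
  rewrite (_ : _ - _ = k * (D ^+ 2 * (l' - l))); last by ring.
  by rewrite mulr_ge0 ?(ltW k0)// mulr_ge0 ?sqr_ge0// subr_ge0 ltW.
have : ln ((k - l') / (n - l')) < ln ((k - l) / (n - l)).
  rewrite ltr_ln ?posrE ?ratio_gt0// ltr_pdivrMr ?subr_gt0; last exact: lt_trans kn.
  rewrite mulrAC ltr_pdivlMr ?subr_gt0; last exact: lt_trans kn.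
  rewrite -subr_gt0 (_ : _ - _ = (l' - l) * (n - k)); last by ring.
  by rewrite mulr_gt0// subr_gt0.
rewrite /h; lra.
Qed.

(** If the right end of the domain is [k], the term [- ln ((k - l) / (n - l))] becomes large near
    it; otherwise the end is the pole [S / D], where the first term does. *)
Let h_upper : exists l, [/\ l < k, 0 < S - l * D & 0 <= h l].
Proof.
have [k0' kn' S0' lnp'] : [/\ 0 < k, k < n, 0 < S & ln p < 0] by split.
have small (c e : R) : 0 < e -> e <= (n - k) * expR (- c) ->
    c <= - ln ((k - (k - e)) / (n - (k - e))).
  move=> e0 ec; rewrite -[leLHS]opprK lerN2 -[leRHS]expRK ler_ln ?posrE ?expR_gt0//.
    have nke : 0 < n - (k - e) by lra.
    by rewrite ler_pdivrMr// subKr (le_trans ec)// mulrC ler_wpM2l ?expR_ge0//; lra.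
  by rewrite ratio_gt0//; lra.
have [D0|D0] := leP D 0.
  pose c := - ln p - k * D / S.
  pose e := Num.min k ((n - k) * expR (- c)).
  have e0 : 0 < e by rewrite lt_min k0 mulr_gt0 ?expR_gt0// subr_gt0.
  have ek : e <= k by rewrite ge_min lexx.
  have ec : e <= (n - k) * expR (- c) by rewrite ge_min lexx orbT.
  have le0 : (k - e) * D <= 0 by apply: mulr_ge0_le0 => //; lra.
  exists (k - e); split; [lra|lra|].
  have := small c e e0 ec; rewrite /h /c.
  suff : k * D / S <= k * D / (S - (k - e) * D) by lra.
  rewrite ler_pdivlMr; last by lra.
  rewrite mulrAC ler_pdivrMr// -subr_ge0.
  rewrite (_ : _ - _ = k * (D * ((k - e) * D))); last by ring.
  by rewrite mulr_ge0 ?(ltW k0)// mulr_le0.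
have [kS|Sk] := leP (k * D) S.
  pose e := (n - k) * expR (- - ln p).
  have e0 : 0 < e by rewrite mulr_gt0 ?expR_gt0// subr_gt0.
  have eD : 0 < S - (k - e) * D by have := mulr_gt0 e0 D0; lra.
  exists (k - e); split => //; first lra.
  have := small (- ln p) e e0 (lexx _); rewrite /h.
  suff : 0 <= k * D / (S - (k - e) * D) by lra.
  by rewrite divr_ge0 ?(ltW eD)// mulr_ge0 ?(ltW D0) ?(ltW k0).
(* At [l = S / D - k / c] the first term equals exactly [c], which outweighs [ln p]. *)
pose c := 1 - ln p.
have c1 : 1 < c by rewrite /c; lra.
have SD : S / D < k by rewrite ltr_pdivrMr.
have kc : 0 < k / c by rewrite divr_gt0//; lra.
have lk : S / D - k / c < k by lra.
exists (S / D - k / c).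
have E : S - (S / D - k / c) * D = k * D / c by field; rewrite !gt_eqF//; lra.
have E0 : 0 < k * D / c by rewrite !(divr_gt0, mulr_gt0)//; lra.
split=> //; rewrite /h E // (_ : k * D / (k * D / c) = c); last first.
  by field; rewrite !gt_eqF//; lra.
suff : ln ((k - (S / D - k / c)) / (n - (S / D - k / c))) <= 0 by rewrite /c; lra.
rewrite -[leRHS]ln1 ler_ln ?posrE ?ratio_gt0//.
by rewrite ler_pdivrMr ?mul1r; lra.
Qed.

(** If [D >= 0] the domain is unbounded to the left and everything except [ln p] vanishes there; if
    [D < 0] the left end is the pole [S / D < 0], where the first term tends to minus infinity. *)
Let h_lower : exists l, [/\ l < k, 0 < S - l * D & h l <= 0].
Proof.
have [k0' kn' S0' lnp'] : [/\ 0 < k, k < n, 0 < S & ln p < 0] by split.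
have [D0|D0] := leP 0 D.
  (* At [- M] the two other terms are at most [k / M] and [(n - k) / M], which add up to
     [- ln p]. *)
  pose M := n / (- ln p).
  have M0 : 0 < M by rewrite divr_gt0// oppr_gt0.
  have MD : 0 <= M * D by rewrite mulr_ge0// ltW.
  exists (- M); split; [lra|lra|].
  have E0 : 0 < S - - M * D by lra.
  have : k * D / (S - - M * D) <= k / M.
    rewrite ler_pdivrMr// mulrAC ler_pdivlMr//.
    by rewrite -mulrA ler_wpM2l ?(ltW k0)//; lra.
  have : - ln ((k - - M) / (n - - M)) <= (n - k) / M.
    rewrite -lnV ?posrE ?ratio_gt0//; last lra.
    have -> : ((k - - M) / (n - - M))^-1 = 1 + (n - k) / (k + M).
      by field; rewrite !gt_eqF//; lra.
    apply: (@le_trans _ _ ((n - k) / (k + M))).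
      by apply: le_ln1Dx; rewrite (lt_trans (ltrN10 _))// divr_gt0//; lra.
    by rewrite ler_wpM2l ?lef_pV2 ?posrE; lra.
  have : n / M = - ln p by rewrite /M invf_div mulrC divfK// gt_eqF.
  rewrite /h (_ : n / M = k / M + (n - k) / M); last by field; rewrite gt_eqF.
  lra.
have SD : S / D < 0 by rewrite pmulr_rlt0// invr_lt0.
pose e := Num.min (- (S / D)) (k ^+ 2 / n).
have kn0 : 0 < k ^+ 2 / n by rewrite divr_gt0// exprn_gt0.
have e0 : 0 < e by rewrite lt_min oppr_gt0 SD.
have eS : e <= - (S / D) by rewrite ge_min lexx.
have ek : e <= k ^+ 2 / n by rewrite ge_min lexx orbT.
have E : S - (S / D + e) * D = e * - D by field; rewrite lt_eqF.
have E0 : 0 < e * - D by rewrite mulr_gt0//; lra.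
have l0 : S / D + e <= 0 by lra.
exists (S / D + e); split; [lra|by rewrite E|].
rewrite /h E (_ : k * D / (e * - D) = - (k / e)); last first.
  by rewrite mulrN invrN mulrN -mulf_div divff ?mulr1// lt_eqF.
suff : - ln ((k - (S / D + e)) / (n - (S / D + e))) <= n / k.
  suff : n / k <= k / e by lra.
  rewrite ler_pdivrMr// mulrAC ler_pdivlMr// -expr2.
  by move: ek; rewrite ler_pdivlMr// mulrC.
move: (S / D + e) l0 => l l0.
rewrite -lnV ?posrE ?ratio_gt0//; last lra.
have -> : ((k - l) / (n - l))^-1 = 1 + (n - k) / (k - l).
  by field; rewrite !gt_eqF//; lra.
apply: (@le_trans _ _ ((n - k) / (k - l))).
  by apply: le_ln1Dx; rewrite (lt_trans (ltrN10 _))// divr_gt0//; lra.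
have : (n - k) / (k - l) <= (n - k) / k.
  by rewrite ler_wpM2l ?lef_pV2 ?posrE; lra.
have : n / k = (n - k) / k + 1 by field; rewrite gt_eqF.
lra.
Qed.

Let continuous_h l : l < k -> 0 < S - l * D -> {for l, continuous h}.
Proof.
have [k0' kn' S0' lnp'] : [/\ 0 < k, k < n, 0 < S & ln p < 0] by split.
move=> lk l0; apply: cvgB.
  apply: cvgD; last exact: cvg_cst.
  apply: cvgM; first exact: cvg_cst.
  apply: cvgV; first by rewrite gt_eqF.
  by apply: cvgB; [exact: cvg_cst|apply: cvgM; [exact: cvg_id|exact: cvg_cst]].
have c1 : (k - x) / (n - x) @[x --> l] --> (k - l) / (n - l).
  apply: cvgM; first by apply: cvgB; [exact: cvg_cst|exact: cvg_id].
  apply: cvgV; first by rewrite gt_eqF// subr_gt0; exact: lt_trans kn.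
  by apply: cvgB; [exact: cvg_cst|exact: cvg_id].
exact: (continuous_cvg _ (continuous_ln (ratio_gt0 lk)) c1).
Qed.

Lemma multiplier_fun_root : exists! l, [/\ l < k, 0 < S - l * D & h l = 0].
Proof.
have [k0' kn' S0' lnp'] : [/\ 0 < k, k < n, 0 < S & ln p < 0] by split.
have [u [uk u0 hu]] := h_upper; have [v [vk v0 hv]] := h_lower.
have vu : v <= u.
  rewrite leNgt; apply/negP => uv.
  by have := multiplier_fun_lt uv vk u0 v0; lra.
have dom l : l \in `[v, u] -> l < k /\ 0 < S - l * D.
  rewrite in_itv/= => /andP[vl lu]; split; first exact: le_lt_trans uk.
  have [D0|D0] := leP 0 D.
    by have := ler_wpM2r D0 lu; lra.
  by have := ler_wnM2r (ltW D0) vl; lra.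
have [l lvu hl0] : exists2 l, l \in `[v, u] & h l = 0.
  apply: IVT => //.
    apply: continuous_in_subspaceT => l; rewrite inE/= => /dom[lk l0].
    exact: continuous_h.
  by rewrite ge_min le_max hv hu orbT.
exists l; have [lk l0] := dom _ lvu; split => // l' [lk' l0' hl'].
apply/eqP; rewrite eq_le !leNgt; apply/andP; split; apply/negP => ll.
  by have := multiplier_fun_lt ll lk l0' l0; lra.
by have := multiplier_fun_lt ll lk' l0 l0'; lra.
Qed.

End Multiplier_equation.

(** * Second-order expansion of [ln (1 + z)] *)

Section Log_ratio_expansion.
Context {R : realType}.

Lemma ln1D_cubic (z : R) : `|z| <= 1 / 2 ->
  `|ln (1 + z) - z + z ^+ 2 / 2| <= 2 * `|z| ^+ 3.
Proof.
pose f (x : R) := ln (1 + x) - x + x ^+ 2 / 2.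
have df (x : R) : -1 < x -> is_derive x 1 f (x ^+ 2 / (1 + x)).
  move=> x1; have x0 : 0 < 1 + x by lra.
  have hl : is_derive x 1 (fun x => ln (1 + x)) (1 + x)^-1.
    have h1 : is_derive x 1 (fun x : R => 1 + x) (0 + 1).
      by apply: is_deriveD.
    have := is_derive1_comp (is_derive1_ln x0) h1.
    by rewrite add0r mulr1.
  have hq : is_derive x 1 (fun x : R => x ^+ 2 / 2) x.
    have hd : is_derive x 1 (fun x : R => x ^+ 2) (2 * x).
      apply: DeriveDef; first exact: exprn_derivable.
      by rewrite exp_derive /GRing.scale/= mulr1 expr1.
    have hc : is_derive x 1 (cst (2^-1 : R)) 0 by exact: is_derive_cst.
    by apply: (is_derive_eq (is_deriveM hd hc)); rewrite /GRing.scale/= mulr0 add0r; field.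
  have hi : is_derive x 1 (fun x : R => x) 1 by exact: is_derive_id.
  have -> : x ^+ 2 / (1 + x) = (1 + x)^-1 - 1 + x by field; rewrite gt_eqF.
  exact: (is_deriveD (is_deriveB hl hi) hq).
have cf (x : R) : -1 < x -> {for x, continuous f}.
  by move=> /df [dx _]; apply: differentiable_continuous; apply/derivable1_diffP.
have f0 : f 0 = 0 by rewrite /f addr0 ln1 expr0n/= mul0r subr0 addr0.
have bnd (c x : R) : `|c| <= `|x| -> `|x| <= 1 / 2 ->
    `|c ^+ 2 / (1 + c) * x| <= 2 * `|x| ^+ 3.
  move=> cx x1; have c0 : 0 < 1 + c.
    by move: (le_trans cx x1); rewrite ler_norml => /andP[]; lra.
  have c2 : (1 + c)^-1 <= 2.
    rewrite -[leRHS]invrK lef_pV2 ?posrE//.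
    by move: (le_trans cx x1); rewrite ler_norml => /andP[]; lra.
  rewrite normrM ger0_norm; last by rewrite divr_ge0 ?sqr_ge0// ltW.
  rewrite [`|x| ^+ 3]exprSr mulrA ler_wpM2r// mulrC ler_pM ?sqr_ge0//.
    by rewrite invr_ge0 ltW.
  by rewrite -(real_normK (num_real c)) lerXn2r ?nnegrE.
have cfab (a b : R) : -1 < a -> {within `[a, b], continuous f}.
  move=> a1; apply: continuous_in_subspaceT => x; rewrite inE/= in_itv/= => /andP[x0 _].
  by apply: cf; lra.
have dfab (a b x : R) : -1 < a -> x \in `]a, b[ -> is_derive x 1 f (x ^+ 2 / (1 + x)).
  by move=> a1; rewrite in_itv/= => /andP[x0 _]; apply: df; lra.
rewrite -/(f z) => z1; have z2 : -1 < z by move: z1; rewrite ler_norml => /andP[]; lra.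
have [z0|z0] := leP 0 z.
  have [c] := MVT_segment z0 (fun x => dfab 0 z x (ltrN10 R)) (cfab 0 z (ltrN10 R)).
  rewrite in_itv/= f0 !subr0 => /andP[c0 cz] ->; apply: bnd => //.
  by rewrite !ger0_norm.
have [c] := MVT_segment (ltW z0) (fun x => dfab z 0 x z2) (cfab z 0 z2).
rewrite in_itv/= f0 !sub0r => /andP[cz c0] E; rewrite -normrN E mulrN normrN.
apply: bnd => //; rewrite !ler0_norm ?lerN2//; exact: ltW.
Qed.

Lemma normr_ln1D (z : R) : `|z| <= 1 / 2 -> `|ln (1 + z)| <= 2 * `|z|.
Proof.
move=> z1; have := ln1D_linear z1.
have := ler_normD (ln (1 + z) - z) z; rewrite subrK => h1 h2; apply: (le_trans h1).
have : z ^+ 2 <= 1 / 2 * `|z| by rewrite -real_normK ?num_real// expr2 ler_wpM2r.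
by move: h2; lra.
Qed.

End Log_ratio_expansion.

(** * Deterministic expansion of the likelihood ratio *)

Section Log_ratio_limit.
Context {R : realType}.
Variables K n S D p gamma M t Z e1 : R.
Hypothesis gamma0 : 0 < gamma.
Hypothesis K2n : K ^+ 2 < n.
Hypothesis p01 : 0 < p < 1.
Local Notation k := (K ^+ 2).
Local Notation L := (ln (k / (n * p))).
Hypothesis M1 : 1 <= M.
Hypothesis t0 : 0 < t.
Hypothesis tM : 40 * M ^+ 2 * t <= 1.
Hypothesis tL : 1 <= t * L.
Hypothesis tK : 1 <= t * K.
Hypothesis ZM : `|Z| <= M.
Hypothesis SE : gamma * S = K ^+ 2 + K * Z.
Hypothesis DE : gamma * D = L + e1.
Hypothesis e1M : `|K * e1| <= M + 1.

Let large (x : R) : 1 <= t * x -> 40 * M ^+ 2 <= x.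
Proof.
move=> tx; have : 0 <= t * (x - 40 * M ^+ 2) by move: tM; lra.
by rewrite pmulr_rge0// subr_ge0.
Qed.

Let M2 : M <= M ^+ 2. Proof. by rewrite expr2 ler_peMr//; move: M1; lra. Qed.
Let L40 : 40 * M <= L. Proof. by have := large tL; move: M2; lra. Qed.
Let K40 : 40 * M <= K. Proof. by have := large tK; move: M2; lra. Qed.
Let K0 : 0 < K. Proof. by move: K40 M1; lra. Qed.
Let k0 : 0 < k. Proof. by rewrite exprn_gt0. Qed.
Let n0 : 0 < n. Proof. exact: lt_trans K2n. Qed.
Let p0 : 0 < p. Proof. by case/andP: p01. Qed.
Let L0 : 0 < L. Proof. by move: L40 M1; lra. Qed.

Let Mt : M * t <= 1 / 40.
Proof. by have := ler_wpM2r (ltW t0) M2; move: tM; lra. Qed.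

(** What remains of the logarithm in the multiplier equation once [L] is split off; negligible for
    [l] of order [K / L]. *)
Let w l := ln (1 - l / k) - ln (1 - l / n).

Let multiplier_funE l : l < k -> multiplier_fun k n S D p l = k * D / (S - l * D) - (L + w l).
Proof.
move=> lk; rewrite /multiplier_fun -addrA; congr (_ + _).
have kl : 0 < k - l by rewrite subr_gt0.
have nl : 0 < n - l by rewrite subr_gt0; exact: lt_trans K2n.
have kE : 1 - l / k = (k - l) / k by rewrite mulrBl divff// gt_eqF.
have nE : 1 - l / n = (n - l) / n by rewrite mulrBl divff// gt_eqF.
rewrite /w kE nE !ln_div ?posrE ?mulr_gt0// lnM ?posrE//.
lra.
Qed.

Let small_ratio l m : k <= m -> `|l| * L <= (M + 1) * K -> K * `|l / m| <= 2 * (M * t).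
Proof.
move=> km lB; have m0 : 0 < m by exact: lt_le_trans km.
rewrite normrM normfV (gtr0_norm m0) [K * _]mulrA ler_pdivrMr//.
apply: (@le_trans _ _ (2 * (M * t) * k)); last first.
  by rewrite ler_wpM2l// !mulr_ge0// ltW//; move: M1; lra.
rewrite -(ler_pM2r L0); apply: (@le_trans _ _ (K * ((M + 1) * K))).
  by rewrite -mulrA; apply: ler_wpM2l => //; exact: ltW.
rewrite (_ : K * _ = (M + 1) * k); last by ring.
rewrite (_ : 2 * (M * t) * k * L = (2 * M * (t * L)) * k); last by ring.
rewrite ler_wpM2r ?(ltW k0)//.
have : 2 * M * 1 <= 2 * M * (t * L) by rewrite ler_wpM2l//; move: M1; lra.
by move: M1; lra.
Qed.

Let small_ratio2 l m : k <= m -> `|l| * L <= (M + 1) * K -> `|l / m| <= 1 / 20.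
Proof.
move=> km lB; have h := small_ratio km lB; rewrite -(ler_pM2l K0) (le_trans h)//.
by move: Mt K40 M1; lra.
Qed.

Let ln_small l m : k <= m -> `|l| * L <= (M + 1) * K ->
  K * `|ln (1 - l / m)| <= 4 * (M * t).
Proof.
move=> km lB; have h := small_ratio km lB; have h2 := small_ratio2 km lB.
have : `|ln (1 - l / m)| <= 2 * `|l / m|.
  by rewrite -[X in _ <= 2 * X]normrN; apply: normr_ln1D; rewrite normrN; lra.
by move=> /(ler_wpM2l (ltW K0)); lra.
Qed.

Let w_small l : `|l| * L <= (M + 1) * K -> K * `|w l| <= 8 * (M * t).
Proof.
move=> lB; have h1 := ln_small (lexx k) lB; have h2 := ln_small (ltW K2n) lB.
have := ler_wpM2l (ltW K0) (ler_normB (ln (1 - l / k)) (ln (1 - l / n))).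
by rewrite -/(w l); lra.
Qed.

Let w_small1 l : `|l| * L <= (M + 1) * K -> `|w l| <= 1.
Proof.
move=> lB; have h := w_small lB; rewrite -(ler_pM2l K0) (le_trans h)//.
by move: Mt K40 M1; lra.
Qed.

Let Bk : (M + 1) * K / L < k.
Proof.
rewrite ltr_pdivrMr// (_ : k * L = K * L * K); last by ring.
rewrite ltr_pM2r//.
have : 40 * M * 40 <= K * L.
  apply: (@le_trans _ _ (K * 40)); first by move: K40; lra.
  by rewrite ler_wpM2l ?(ltW K0)//; move: L40 M1; lra.
by move: M1; lra.
Qed.

Let BL : (M + 1) * K / L * L = (M + 1) * K.
Proof. by rewrite divfK// gt_eqF. Qed.

Let normB s : `|s| = 1 -> `|s * ((M + 1) * K / L)| * L <= (M + 1) * K.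
Proof.
move=> s1; rewrite normrM s1 mul1r ger0_norm ?BL//.
by rewrite divr_ge0 ?(ltW L0)// mulr_ge0 ?(ltW K0)//; move: M1; lra.
Qed.

(* The two values are [gamma] times [k D / (S - l D)] and its gap to
   [L + w l], cleared of denominators, at [l = s (M + 1) K / L]. *)
Let gap s (l := s * ((M + 1) * K / L)) :
  gamma * (k * D - (L + w l) * (S - l * D)) =
  K * (K * e1 - K * w l - (L + w l) * (Z - s * (M + 1) - s * (M + 1) * e1 / L)).
Proof.
rewrite (_ : gamma * _ =
    k * (gamma * D) - (L + w l) * (gamma * S - l * (gamma * D))); last by ring.
rewrite SE DE (_ : l * (L + e1) = s * (M + 1) * K * (1 + e1 / L)).
  by ring.
by rewrite /l; field; rewrite gt_eqF.
Qed.

Let eL : `|(M + 1) * e1 / L| <= 1 / 2.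
Proof.
rewrite normrM normfV (gtr0_norm L0) ler_pdivrMr// -(ler_pM2l K0).
rewrite normrM ger0_norm; last by move: M1; lra.
rewrite mulrCA; move: e1M; rewrite normrM gtr0_norm// => h.
apply: (@le_trans _ _ ((M + 1) * (M + 1))).
  by rewrite ler_wpM2l//; move: M1; lra.
have : K * (40 * M) <= K * L by rewrite ler_wpM2l ?(ltW K0).
have : 40 * M * M <= K * M by rewrite ler_wpM2r//; move: M1; lra.
by move: M1 M2; lra.
Qed.

Let KwB s : `|s| = 1 -> `|K * w (s * ((M + 1) * K / L))| <= 1 /\
   `|w (s * ((M + 1) * K / L))| <= 1.
Proof.
move=> s1; split; last exact/w_small1/normB.
rewrite normrM gtr0_norm//; apply: (le_trans (w_small (normB s1))).
by move: Mt M1; lra.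
Qed.

(** By monotonicity it suffices to find the sign of [multiplier_fun] at [-(M + 1) K / L] and at
    [(M + 1) K / L]. There [gap] is dominated by [L] times a quantity of absolute value at least one
    half and of known sign, since [|Z| <= M]. *)
Lemma multiplier_small lam : lam < k -> 0 < S - lam * D ->
  multiplier_fun k n S D p lam = 0 -> `|lam| * L <= (M + 1) * K.
Proof.
move=> lk lS l0; have S0 : 0 < S.
  rewrite -(pmulr_rgt0 _ gamma0) SE (_ : _ + _ = K * (K + Z)); last by ring.
  by rewrite mulr_gt0//; move: ZM K40 M1; rewrite ler_norml => /andP[]; lra.
have B0 : 0 < (M + 1) * K / L by rewrite divr_gt0// mulr_gt0//; move: M1; lra.
rewrite -ler_pdivlMr// ler_norml; apply/andP; split; rewrite leNgt; apply/negP => lB.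
- have s1 : `|-1| = 1 :> R by rewrite normrN1.
  have Bk' : - ((M + 1) * K / L) < k by apply: lt_trans k0; rewrite oppr_lt0.
  have BS : 0 < S - - ((M + 1) * K / L) * D.
    have [D0|D0] := leP 0 D; first by have := mulr_ge0 (ltW B0) D0; move: S0; lra.
    by have := ler_wnM2r (ltW D0) (ltW lB); move: lS; lra.
  have := multiplier_fun_lt p k0 K2n lB Bk' lS BS.
  rewrite l0 multiplier_funE// ltNge => /negP; apply.
  rewrite subr_le0 ler_pdivrMr// -subr_le0 -(pmulr_rle0 _ gamma0).
  have -> : - ((M + 1) * K / L) = -1 * ((M + 1) * K / L) by rewrite mulN1r.
  rewrite gap (pmulr_rle0 _ K0) mulN1r.
  have [h1 h2] := KwB s1; rewrite mulN1r in h1 h2.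
  move: (w _) h1 h2 => v h1 h2.
  have : (L + v) * (1 / 2) <= (L + v) * (Z - - (M + 1) - - (M + 1) * e1 / L).
    apply: ler_wpM2l; first by move: h2 L40 M1; rewrite ler_norml => /andP[]; lra.
    move: ZM eL; rewrite !ler_norml => /andP[z1 z2] /andP[g1 g2].
    by rewrite !mulNr; lra.
  move: h1 h2 e1M L40 M1; rewrite !ler_norml => /andP[a1 a2] /andP[b1 b2] /andP[c1 c2].
  lra.
- have s1 : `|1| = 1 :> R by rewrite normr1.
  have Bk' : (M + 1) * K / L < k by [].
  have BS : 0 < S - (M + 1) * K / L * D.
    have [D0|D0] := leP 0 D; last by have := mulr_ge0_le0 (ltW B0) (ltW D0); move: S0; lra.
    by have := ler_wpM2r D0 (ltW lB); move: lS; lra.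
  have := multiplier_fun_lt p k0 K2n lB lk BS lS.
  rewrite l0 multiplier_funE// ltNge => /negP; apply.
  rewrite subr_ge0 ler_pdivlMr// -subr_ge0 -(pmulr_rge0 _ gamma0).
  have -> : (M + 1) * K / L = 1 * ((M + 1) * K / L) by rewrite mul1r.
  rewrite gap (pmulr_rge0 _ K0) !mul1r.
  have [h1 h2] := KwB s1; rewrite mul1r in h1 h2.
  move: (w _) h1 h2 => v h1 h2.
  have : (L + v) * (Z - (M + 1) - (M + 1) * e1 / L) <= (L + v) * (- (1 / 2)).
    apply: ler_wpM2l; first by move: h2 L40 M1; rewrite ler_norml => /andP[]; lra.
    by move: ZM eL; rewrite !ler_norml => /andP[z1 z2] /andP[g1 g2]; lra.
  move: h1 h2 e1M L40 M1; rewrite !ler_norml => /andP[a1 a2] /andP[b1 b2] /andP[c1 c2].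
  lra.
Qed.

Let log_quadratic l m : k <= m -> `|l| * L <= (M + 1) * K ->
  `|m * ln (1 - l / m) + l| <= 8 * (M * t) ^+ 2.
Proof.
move=> km lB; have m0 : 0 < m by exact: lt_le_trans km.
have h := small_ratio (lexx k) lB; have h2 := small_ratio2 km lB.
have z1 : `|- (l / m)| <= 1 / 2 by rewrite normrN; lra.
have := ln1D_linear z1; rewrite sqrrN opprK.
have -> : m * ln (1 - l / m) + l = m * (ln (1 - l / m) + l / m).
  by rewrite mulrDr [m * (l / m)]mulrC divfK// gt_eqF.
move=> /(ler_wpM2l (ltW m0)); rewrite normrM (gtr0_norm m0) => /le_trans; apply.
have : m * (l / m) ^+ 2 <= (K * `|l / k|) ^+ 2.
  rewrite [leRHS]exprMn real_normK ?num_real//.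
  rewrite (_ : m * _ = l ^+ 2 / m); last by field; rewrite gt_eqF.
  rewrite (_ : K ^+ 2 * _ = l ^+ 2 / k); last by field; rewrite gt_eqF.
  by rewrite ler_wpM2l ?sqr_ge0// lef_pV2.
have : (K * `|l / k|) ^+ 2 <= (2 * (M * t)) ^+ 2.
  rewrite lerXn2r ?nnegrE// ?mulr_ge0 ?(ltW K0) ?(ltW t0)//; move: M1; lra.
by rewrite exprMn; lra.
Qed.

(** The multiplier equation turns [r] into [1 + q] with [K q] close to [Z]. The terms in [lam] are
    [- lam] and [+ lam] up to small errors, and [k (ln r - (r - 1))] is about [- (K q) ^ 2 / 2].
    Replacing [N] by [k] costs [N - k] times factors of order [1 / K]. *)
Lemma log_ratio_expansion N lam : `|N - k| <= 3 * (t * K) ->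
  lam < k -> 0 < S - lam * D -> multiplier_fun k n S D p lam = 0 ->
  `|- 2 * (N * ln (1 - lam / k) - n * ln (1 - lam / n) + N * ln (S / (S - lam * D))
    - k * (S / (S - lam * D) - 1)) - Z ^+ 2| <= 400 * (M ^+ 3 * t).
Proof.
move=> Nk lk lS l0; have lB := multiplier_small lk lS l0.
have [Ml Mu] : 40 * M <= K /\ M * t <= 1 / 40 by split; [exact: K40|exact: Mt].
have [t0' M1' K0' L0'] : [/\ 0 < t, 1 <= M, 0 < K & 0 < L] by split.
have Mt0 : 0 < M * t by rewrite mulr_gt0//; lra.
have w8 := w_small lB; have w1 := w_small1 lB.
pose v := w lam; rewrite -/v in w8 w1.
have Lv : 1 / 2 * L <= L + v.
  by move: w1 L40; rewrite ler_norml => /andP[]; lra.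
have Lv0 : 0 < L + v by lra.
(* The deviation of [r] from [1 + Z / K]: dividing [K e1] and [K v], both bounded, by [L] makes it
   small. *)
pose d := K * (e1 - v) / (L + v).
have dM : `|d| <= 6 * (M * t).
  rewrite normrM normfV (gtr0_norm Lv0) ler_pdivrMr// mulrBr.
  apply: (le_trans (ler_normB _ _)); rewrite [`|K * v|]normrM (gtr0_norm K0').
  have : 6 * (M * t) * (1 / 2 * L) <= 6 * (M * t) * (L + v) by rewrite ler_wpM2l//; lra.
  have : 3 * M * 1 <= 3 * M * (t * L) by rewrite ler_wpM2l//; lra.
  by move: e1M; lra.
have Kd : 1 / 2 * K <= K + d by move: dM; rewrite ler_norml => /andP[]; lra.
have Kd0 : 0 < K + d by lra.
pose r := S / (S - lam * D); rewrite -/r.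
have rE : r = 1 + (Z - d) / (K + d).
  have E : k * D = (L + v) * (S - lam * D).
    have /esym/eqP := multiplier_funE lk.
    by rewrite l0 subr_eq0 => /eqP <-; rewrite divfK// gt_eqF.
  have E1 : K ^+ 2 * (L + e1) = (L + v) * (gamma * (S - lam * D)).
    by rewrite mulrCA -E -DE; ring.
  have Le1 : 0 < L + e1.
    by rewrite -(pmulr_rgt0 _ k0) E1 !mulr_gt0.
  have -> : r = (K ^+ 2 + K * Z) * (L + v) / (K ^+ 2 * (L + e1)).
    rewrite E1 -SE /r; field; rewrite ?gt_eqF//.
  have E2 : K + d = K * (L + e1) / (L + v).
    by rewrite /d; field; rewrite gt_eqF.
  rewrite (_ : 1 + _ = (K + Z) / (K + d)); last by field; rewrite gt_eqF.
  by rewrite E2; field; rewrite !gt_eqF.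
pose q := (Z - d) / (K + d).
have qM : K * `|q| <= 4 * M.
  rewrite normrM normfV (gtr0_norm Kd0) mulrA ler_pdivrMr//.
  have : `|Z - d| <= 2 * M.
    by have := ler_normB Z d; move: ZM dM; lra.
  move=> /(ler_wpM2l (ltW K0')); have : 4 * M * (1 / 2 * K) <= 4 * M * (K + d).
    by rewrite ler_wpM2l//; lra.
  lra.
have q1 : `|q| <= 1 / 10.
  by rewrite -(ler_pM2l K0') (le_trans qM)//; lra.
have lnr : `|ln r| <= 2 * `|q| by rewrite rE; apply: normr_ln1D; lra.
have q3 : `|k * (ln r - q) + (K * q) ^+ 2 / 2| <= 128 * (M ^+ 3 * t).
  have -> : k * (ln r - q) + (K * q) ^+ 2 / 2 = k * (ln (1 + q) - q + q ^+ 2 / 2).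
    by rewrite rE -/q; field.
  rewrite normrM (gtr0_norm k0).
  have q2 : `|q| <= 1 / 2 by lra.
  apply: (le_trans (ler_wpM2l (ltW k0) (ln1D_cubic q2))).
  have -> : k * (2 * `|q| ^+ 3) = 2 * ((K * `|q|) ^+ 2 * `|q|) by ring.
  have a1 : (K * `|q|) ^+ 2 <= (4 * M) ^+ 2.
    by rewrite lerXn2r ?nnegrE// ?mulr_ge0 ?(ltW K0')//; lra.
  have a2 : `|q| <= 4 * (M * t).
    apply: (@le_trans _ _ (t * K * `|q|)); first by rewrite ler_peMl.
    by rewrite -mulrA; have := ler_wpM2l (ltW t0') qM; lra.
  have := ler_pM (sqr_ge0 _) (normr_ge0 q) a1 a2.
  rewrite (_ : (4 * M) ^+ 2 * _ = 64 * (M ^+ 3 * t)); last by ring.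
  lra.
have qZ : `|(K * q) ^+ 2 - Z ^+ 2| <= 60 * (M ^+ 2 * t).
  have E : K * q - Z = - (d * (1 + q)) by rewrite /q; field; rewrite gt_eqF.
  have a1 : `|K * q - Z| <= 12 * (M * t).
    rewrite E normrN normrM.
    have : `|1 + q| <= 2 by have := ler_normD 1 q; rewrite normr1; lra.
    by move=> /(ler_pM (normr_ge0 _) (normr_ge0 _) dM); lra.
  have a2 : `|K * q + Z| <= 5 * M.
    have := ler_normD (K * q) Z; rewrite normrM (gtr0_norm K0').
    by move: ZM; lra.
  have := ler_pM (normr_ge0 _) (normr_ge0 _) a1 a2.
  rewrite -normrM (_ : (K * q - Z) * _ = (K * q) ^+ 2 - Z ^+ 2); last by ring.
  by rewrite (_ : 12 * _ * _ = 60 * (M ^+ 2 * t)); last by ring.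
have b1 := log_quadratic (lexx k) lB; have b2 := log_quadratic (ltW K2n) lB.
have cross x c : K * `|x| <= c -> `|(N - k) * x| <= 3 * (t * c).
  move=> xc; rewrite normrM (le_trans (ler_wpM2r (normr_ge0 x) Nk))//.
  by have := ler_wpM2l (ltW t0') xc; lra.
have b3 := cross _ _ (ln_small (lexx k) lB).
have b4 : `|(N - k) * ln r| <= 3 * (t * (8 * M)).
  by apply: cross; have := ler_wpM2l (ltW K0') lnr; lra.
have M3 : M <= M ^+ 3 by rewrite exprS ler_peMr//; [lra|rewrite exprn_ege1].
have M23 : M ^+ 2 <= M ^+ 3 by rewrite ler_weXn2l.
have t1 : t <= 1 / 40 by have := ler_wpM2r (ltW t0') M1'; lra.
have c1 : M * t <= M ^+ 3 * t by rewrite ler_wpM2r// ltW.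
have c2 : M ^+ 2 * t <= M ^+ 3 * t by rewrite ler_wpM2r// ltW.
have c3 : (M * t) ^+ 2 <= 1 / 40 * (M ^+ 3 * t).
  by rewrite expr2; have := ler_wpM2r (ltW Mt0) Mu; lra.
have c4 : t * (M * t) <= 1 / 40 * (M ^+ 3 * t).
  by have := ler_wpM2r (ltW Mt0) t1; lra.
have -> : - 2 * (N * ln (1 - lam / k) - n * ln (1 - lam / n) + N * ln r - k * (r - 1))
    - Z ^+ 2 = - 2 * ((k * ln (1 - lam / k) + lam) + (N - k) * ln (1 - lam / k)
      - (n * ln (1 - lam / n) + lam) + (N - k) * ln r
      + (k * (ln r - q) + (K * q) ^+ 2 / 2)) + ((K * q) ^+ 2 - Z ^+ 2).
  by rewrite rE -/q; field.
move: b1 b2 b3 b4 q3 qZ; rewrite !ler_norml.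
move: (k * ln (1 - lam / k) + lam) (n * ln (1 - lam / n) + lam) ((N - k) * ln r)
  ((N - k) * ln (1 - lam / k)) (k * (ln r - q) + (K * q) ^+ 2 / 2)
  ((K * q) ^+ 2 - Z ^+ 2) => y1 y2 y3 y4 y5 y6.
move=> /andP[? ?] /andP[? ?] /andP[? ?] /andP[? ?] /andP[? ?] /andP[? ?].
apply/andP; split; lra.
Qed.

End Log_ratio_limit.

(** * Counting description of order statistics and closed form of the statistic *)

Section Order_statistics.
Context {R : realType}.
Variables (x : nat -> R) (n k : nat).
Hypothesis kn : (k < n)%N.
Implicit Types v g c p xp lam : R.

Local Notation Xnk := (order_stat x n (n - k)).
Local Notation S := (log_excess_sum x n k).

Definition exceed_count v : R := \sum_(i < n) (v < x i)%R%:R.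

Definition tail_log_sum v : R := \sum_(i < n) (v < x i)%R%:R * (ln (x i) - ln v).

Let s := sort <=%R (mkseq x n).
Let sorted_s : sorted <=%R s. Proof. exact: sort_le_sorted. Qed.
Let size_s : size s = n. Proof. by rewrite size_sort size_mkseq. Qed.

Let sum_sorted (f : R -> R) : \sum_(i < n) f (x i) = \sum_(y <- s) f y.
Proof.
rewrite (perm_big (mkseq x n)); last by rewrite perm_sort.
by rewrite big_map -[in RHS](subn0 n) -/(index_iota 0 n) big_mkord.
Qed.

Lemma order_stat_le v : (Xnk <= v) = (exceed_count v <= k%:R).
Proof.
have -> : exceed_count v = (count (> v) s)%:R.
  rewrite /exceed_count (sum_sorted (fun y => (v < y)%R%:R)) -sum1_count natr_sum.
  by rewrite [RHS]big_mkcond; apply: eq_bigr => y _; case: (v < y).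
rewrite ler_nat; have cle : count (<= v) s = (n - count (> v) s)%N.
  by rewrite count_le_gt size_s.
have cn : (count (> v) s <= n)%N by rewrite -size_s count_size.
apply/idP/idP => [|h]; last first.
  by rewrite /order_stat nth_count_le// cle; lia.
apply: contraTT; rewrite -ltnNge -ltNge => h.
by rewrite /order_stat nth_count_gt// cle size_s; lia.
Qed.

Let order_stat_ge i : (n - k <= i <= n)%N -> Xnk <= order_stat x n i.
Proof.
move=> /andP[i1 i2]; rewrite /order_stat.
by rewrite le_sorted_leq_nth// ?inE ?size_s; lia.
Qed.

(** Among the top [k] observations, those tied with the threshold contribute [ln 1 = 0], so summing
    over strict exceedances gives the same value. *)
Lemma log_excess_sumE : 0 < Xnk -> S = tail_log_sum Xnk.
Proof.
move=> a0; pose f y := (Xnk < y)%R%:R * (ln y - ln Xnk).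
rewrite /tail_log_sum (sum_sorted f) (big_nth 0) size_s.
rewrite (@big_cat_nat _ _ _ (n - k))//=; last exact: leq_subr.
rewrite [X in X + _]big_nat_cond [X in X + _]big1 ?add0r => [|i /andP[/andP[_ ik] _]]; last first.
  rewrite /f ltNge (_ : nth 0 s i <= Xnk) ?mul0r//.
  by rewrite /order_stat le_sorted_leq_nth// ?inE ?size_s; lia.
rewrite /log_excess_sum big_add1/= big_mkord (reindex_inj rev_ord_inj)/=.
have -> : \sum_(n - k <= i < n) f (nth 0 s i) = \sum_(i < k) f (nth 0 s (i + (n - k))).
  by rewrite -{1}[(n - k)%N]add0n big_addn subKn ?(ltnW kn)// big_mkord.
apply: eq_bigr => i _; have ik := ltn_ord i.
have -> : order_stat x n (n - (k - i.+1).+1 + 1) = nth 0 s (i + (n - k)).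
  by rewrite /order_stat; congr nth; lia.
have : Xnk <= nth 0 s (i + (n - k)).
  by rewrite /order_stat le_sorted_leq_nth// ?inE ?size_s; lia.
rewrite le_eqVlt /f => /predU1P[<-|h].
  by rewrite divff ?gt_eqF// ln1 ltxx mul0r.
by rewrite h mul1r ln_div// posrE//; exact: lt_trans h.
Qed.

Lemma log_excess_sum_ge0 : 0 < Xnk -> 0 <= S.
Proof.
move=> a0; rewrite log_excess_sumE//; apply: sumr_ge0 => i _.
have [h|_] := ltP Xnk (x i); last by rewrite mul0r.
by rewrite mul1r subr_ge0 ler_ln ?posrE// ?(ltW h)//; exact: lt_trans h.
Qed.

Let sum_lnB : 0 < Xnk ->
  \sum_(1 <= i < k.+1) (ln (order_stat x n (n - i + 1)) - ln Xnk) = S.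
Proof.
move=> a0; rewrite /log_excess_sum !big_nat; apply: eq_bigr => i /andP[i1 i2].
rewrite ln_div// posrE; apply: lt_le_trans a0 _; apply: order_stat_ge; lia.
Qed.

Lemma multiplier_eqE p xp lam : (0 < k)%N -> 0 < Xnk -> 0 < p ->
  let D := ln xp - ln Xnk in
  multiplier_eq x n k p xp lam <->
  [/\ lam < k%:R, 0 < S - lam * D & multiplier_fun k%:R n%:R S D p lam = 0].
Proof.
move=> k0 a0 p0 D.
have gE : gamma_bar x n k xp lam = k%:R / (S - lam * D).
  by rewrite /gamma_bar sum_lnB//; congr (_ / _); rewrite /D; ring.
have k0' : 0 < k%:R :> R by rewrite ltr0n.
have kn' : k%:R < n%:R :> R by rewrite ltr_nat.
have g0 : (0 < gamma_bar x n k xp lam) = (0 < S - lam * D).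
  by rewrite gE pmulr_rgt0// invr_gt0.
have eqE : lam < k%:R ->
    gamma_bar x n k xp lam * ln xp + ln (p / c_bar x n k xp lam) =
    multiplier_fun k%:R n%:R S D p lam.
  move=> lk; have r0 : 0 < (k%:R - lam) / (n%:R - lam) by rewrite divr_gt0//; lra.
  rewrite /c_bar ln_div ?posrE//; last by apply: mulr_gt0; rewrite ?powR_gt0.
  rewrite lnM ?posrE ?powR_gt0//.
  by rewrite ln_powR gE /multiplier_fun /D; ring.
split=> [[h1 h2 h3]|[h1 h2 h3]]; split=> //.
- by rewrite -g0.
- by rewrite -eqE.
- by rewrite eqE.
- by rewrite g0.
Qed.

Lemma ln_censored_lik g c : 0 < Xnk -> 0 < g -> 0 < c -> c * Xnk `^ (- g) < 1 ->
  ln (censored_lik x n k g c) =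
  exceed_count Xnk * (ln (c * Xnk `^ (- g)) + ln g - ln Xnk) - (g + 1) * S +
  (n%:R - exceed_count Xnk) * ln (1 - c * Xnk `^ (- g)).
Proof.
move=> a0 g0 c0; set q := c * _ => q1.
have q0 : 0 < q by rewrite mulr_gt0// powR_gt0.
have fE (i : 'I_n) : 0 < (c * g * x i `^ (- g - 1)) ^+ exceeds x n k i *
                 (1 - q) ^+ (1 - exceeds x n k i) /\
    ln ((c * g * x i `^ (- g - 1)) ^+ exceeds x n k i * (1 - q) ^+ (1 - exceeds x n k i)) =
    (Xnk < x i)%R%:R * (ln q + ln g - ln Xnk) - (g + 1) * ((Xnk < x i)%R%:R * (ln (x i) - ln Xnk))
    + (1 - (Xnk < x i)%R%:R) * ln (1 - q).
  rewrite /exceeds; have [h|h] := ltP Xnk (x i).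
    rewrite expr1 expr0 mulr1 subrr !mul0r addr0 !mul1r.
    have xi0 : 0 < x i by exact: lt_trans h.
    split; first by rewrite !mulr_gt0// powR_gt0.
    rewrite !lnM ?posrE ?mulr_gt0 ?powR_gt0// !ln_powR; ring.
  rewrite expr0 mul1r expr1 !mul0r mulr0 subr0 add0r subr0 mul1r; split => //.
  by rewrite subr_gt0.
rewrite /censored_lik -/q.
have lnP (r : seq 'I_n) (F : 'I_n -> R) : (forall i, 0 < F i) ->
    0 < \prod_(i <- r) F i /\ ln (\prod_(i <- r) F i) = \sum_(i <- r) ln (F i).
  move=> F0; elim: r => [|i r [r0 rE]]; first by rewrite !big_nil ln1.
  by rewrite !big_cons lnM ?posrE// rE mulr_gt0.
rewrite (lnP _ _ (fun i => (fE i).1)).2; under eq_bigr do rewrite (fE _).2.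
rewrite !big_split/= sumrN -!mulr_suml -mulr_sumr log_excess_sumE//.
by rewrite sumrB sumr_const card_ord.
Qed.

(** The count [N] is kept separate from [k], since ties at the threshold can make it smaller. *)
Lemma log_lik_ratioE p xp : (0 < k)%N -> 0 < Xnk -> 0 < S -> 0 < p < 1 ->
  let D := ln xp - ln Xnk in
  let lam := lambda_hat x n k p xp in
  let r := S / (S - lam * D) in
  let N := exceed_count Xnk in
  [/\ lam < k%:R, 0 < S - lam * D, multiplier_fun k%:R n%:R S D p lam = 0 &
  log_lik_ratio x n k p xp =
    - 2 * (N * ln (1 - lam / k%:R) - n%:R * ln (1 - lam / n%:R) + N * ln r
           - k%:R * (r - 1))].
Proof.
move=> k0 a0 S0 p01 D lam r N; have p0 : 0 < p by case/andP: p01.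
have k0' : 0 < k%:R :> R by rewrite ltr0n.
have kn' : k%:R < n%:R :> R by rewrite ltr_nat.
have hlam : multiplier_eq x n k p xp lam.
  have [l [hl _]] := multiplier_fun_root D k0' kn' S0 p01.
  apply: (@xgetPex _ 0 [set lam | multiplier_eq x n k p xp lam]).
  by exists l; apply/multiplier_eqE.
have [lk lS l0] := (multiplier_eqE xp lam k0 a0 p0).1 hlam.
split=> //; rewrite /log_lik_ratio /l2 /l1 -/lam.
have n0' : 0 < n%:R :> R by exact: lt_trans kn'.
have nl : 0 < n%:R - lam by lra.
have kl : 0 < k%:R - lam by lra.
have ghE : gamma_hat x n k = k%:R / S by rewrite /gamma_hat invfM invrK.
have gh0 : 0 < gamma_hat x n k by rewrite ghE divr_gt0.
have gbE : gamma_bar x n k xp lam = k%:R / (S - lam * D).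
  by rewrite /gamma_bar sum_lnB//; congr (_ / _); rewrite /D; ring.
have gb0 : 0 < gamma_bar x n k xp lam by rewrite gbE divr_gt0.
have qh : c_hat x n k * Xnk `^ (- gamma_hat x n k) = k%:R / n%:R.
  by rewrite /c_hat powRN mulfK// gt_eqF// powR_gt0.
have qb : c_bar x n k xp lam * Xnk `^ (- gamma_bar x n k xp lam) = (k%:R - lam) / (n%:R - lam).
  by rewrite /c_bar powRN mulrC mulKf// gt_eqF// powR_gt0.
have kn1 : k%:R / n%:R < 1 :> R by rewrite ltr_pdivrMr// mul1r.
have kln1 : (k%:R - lam) / (n%:R - lam) < 1 by rewrite ltr_pdivrMr// mul1r; lra.
rewrite !ln_censored_lik ?qh ?qb//; last 2 first.
- by rewrite /c_hat mulr_gt0 ?divr_gt0// powR_gt0.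
- by rewrite /c_bar mulr_gt0 ?divr_gt0// powR_gt0.
have -> : 1 - k%:R / n%:R = (n%:R - k%:R) / n%:R :> R by rewrite mulrBl divff// gt_eqF.
have -> : 1 - (k%:R - lam) / (n%:R - lam) = (n%:R - k%:R) / (n%:R - lam).
  by field; rewrite gt_eqF.
have -> : 1 - lam / k%:R = (k%:R - lam) / k%:R by rewrite mulrBl divff// gt_eqF.
have -> : 1 - lam / n%:R = (n%:R - lam) / n%:R by rewrite mulrBl divff// gt_eqF.
have nk : 0 < n%:R - k%:R :> R by lra.
rewrite /r ghE gbE !ln_div ?posrE// /N.
set y := ln (S - lam * D).
have -> : (k%:R / (S - lam * D) + 1) * S = k%:R * (S / (S - lam * D)) + S by ring.
have -> : (k%:R / S + 1) * S = k%:R + S by field; rewrite gt_eqF.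
ring.
Qed.

Lemma multiplier_eq_unique p xp : well_defined_sample x n k -> 0 < p < 1 ->
  exists! lam, multiplier_eq x n k p xp lam.
Proof.
case=> k0 _ a0 Sneq0 p01; have p0 : 0 < p by case/andP: p01.
have S0 : 0 < S by rewrite lt_neqAle eq_sym Sneq0 log_excess_sum_ge0.
have k0' : 0 < k%:R :> R by rewrite ltr0n.
have kn' : k%:R < n%:R :> R by rewrite ltr_nat.
have [l [hl lu]] := multiplier_fun_root (ln xp - ln Xnk) k0' kn' S0 p01.
exists l; split; first exact/multiplier_eqE.
by move=> l' /multiplier_eqE h; apply: lu; exact: h.
Qed.

End Order_statistics.

(** * Measurability of the statistic *)

Section Measurable_comparison.
Context {d : measure_display} {T : measurableType d} {R : realType}.

Lemma measurable_set_le (f g : T -> R) : measurable_fun setT f -> measurable_fun setT g ->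
  measurable [set w | f w <= g w].
Proof.
move=> mf mg; have := measurable_fun_ler mf mg measurableT (Y := [set true]).
by rewrite setTI; apply.
Qed.

Lemma measurable_set_lt (f g : T -> R) : measurable_fun setT f -> measurable_fun setT g ->
  measurable [set w | f w < g w].
Proof.
move=> mf mg; have := measurable_fun_ltr mf mg measurableT (Y := [set true]).
by rewrite setTI; apply.
Qed.

Lemma measurable_fun_le_set (D : set T) (f : T -> R) :
  (forall v, measurable (D `&` [set w | f w <= v])) -> measurable_fun D f.
Proof.
move=> h mD; apply: (measurability _ (RGenOInfty.measurableE R)) => //.
move=> _ [_ [v ->] <-].
rewrite (_ : _ `&` _ = D `\` (D `&` [set w | f w <= v])); first exact: measurableD.
apply/seteqP; split => w /=; rewrite in_itv/= andbT ltNge.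
  by move=> [Dw /negP h']; split => // -[].
by move=> [Dw h']; split => //; apply/negP => h''; apply: h'.
Qed.

End Measurable_comparison.

Section Measurable_statistics.
Context {d : measure_display} {T : measurableType d} {R : realType}.
Variables (P : probability T R) (X : nat -> {RV P >-> R}) (n k : nat).
Local Notation sample := (fun w i => X i w).
Local Notation Xnk w := (order_stat (sample w) n (n - k)).
Local Notation S w := (log_excess_sum (sample w) n k).

Let mX i : measurable_fun setT (X i). Proof. exact: measurable_funPT. Qed.

Lemma measurable_exceed_count v : measurable_fun setT (fun w => exceed_count (sample w) n v).
Proof.
apply: measurable_sum => i.
exact: (measurableT_comp (measurable_gt v) (mX i)).
Qed.

Lemma measurable_order_stat j : (0 < j <= n)%N ->
  measurable_fun setT (fun w => order_stat (sample w) n j).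
Proof.
move=> /andP[j0 jn]; apply: measurable_fun_le_set => v; rewrite setTI.
rewrite (_ : [set w | _] = [set w | exceed_count (sample w) n v <= (n - j)%:R]).
  by apply: measurable_set_le => //; exact: measurable_exceed_count.
have jn' : (n - j < n)%N by lia.
apply/seteqP; split => w /=; have := order_stat_le (sample w) jn' v;
  by rewrite subKn// => ->.
Qed.

Hypothesis kn : (k < n)%N.

Lemma measurable_order_statB : measurable_fun setT (fun w => Xnk w).
Proof. by apply: measurable_order_stat; lia. Qed.

Let mln (D : set T) (f : T -> R) : measurable_fun D f -> measurable_fun D (fun w => ln (f w)).
Proof. exact: measurableT_comp (@measurable_ln R). Qed.

Let S' w := tail_log_sum (sample w) n (Xnk w).

Let mS' : measurable_fun setT S'.
Proof.
apply: measurable_sum => i; apply: measurable_funM.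
  rewrite (_ : (fun w => _) = \1_[set w | Xnk w < X i w]).
    by apply: measurable_indic; apply: measurable_set_lt => //; exact: measurable_order_statB.
  apply/funext => w; rewrite indicE; congr (_%:R); congr nat_of_bool.
  by apply/idP/idP; rewrite inE.
by apply: measurable_funB; apply: mln => //; exact: measurable_order_statB.
Qed.

Let E := [set w | well_defined_sample (sample w) n k].

Let EE : (0 < k)%N -> E = [set w | 0 < Xnk w] `&` [set w | 0 < S' w].
Proof.
move=> k0; apply/seteqP; split => w /=.
  move=> [_ _ a0 S0]; split => //; rewrite /S' -log_excess_sumE//.
  by rewrite lt_neqAle eq_sym S0 log_excess_sum_ge0.
by move=> [a0 S0]; split => //; rewrite log_excess_sumE// gt_eqF.
Qed.

Lemma measurable_well_defined : measurable E.
Proof.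
have [k0|k0] := posnP k.
  by rewrite (_ : E = set0)//; apply/seteqP; split => w // -[]; rewrite k0.
rewrite EE//; apply: measurableI; apply: measurable_set_lt => //.
exact: measurable_order_statB.
Qed.

Section Fixed_candidate.
Variables (p xp : R).
Hypothesis p01 : 0 < p < 1.
Let D w := ln xp - ln (Xnk w).
Let lam w := lambda_hat (sample w) n k p xp.

Let mD : measurable_fun setT D.
Proof. by apply: measurable_funB => //; apply: mln; exact: measurable_order_statB. Qed.

Let ratioE w : E w ->
  [/\ lam w < k%:R, 0 < S' w - lam w * D w, multiplier_fun k%:R n%:R (S' w) (D w) p (lam w) = 0 &
  log_lik_ratio (sample w) n k p xp =
    - 2 * (exceed_count (sample w) n (Xnk w) * ln (1 - lam w / k%:R)
     - n%:R * ln (1 - lam w / n%:R)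
     + exceed_count (sample w) n (Xnk w) * ln (S' w / (S' w - lam w * D w))
           - k%:R * (S' w / (S' w - lam w * D w) - 1))].
Proof.
move=> Ew; have [k0 _ a0 S0] := Ew.
move: Ew; rewrite EE// => -[_ /= S'0].
rewrite /S' -log_excess_sumE// in S'0 *.
exact: log_lik_ratioE.
Qed.

(** Since [multiplier_fun] is increasing, for [t < k] the root is at most [t] exactly when [t] lies
    to the right of the domain or [multiplier_fun] is nonnegative at [t]; both conditions are
    explicit in [S'] and [D]. *)
Let measurable_lam : measurable_fun E lam.
Proof.
have [k0|k0] := posnP k.
  rewrite (_ : E = set0); first exact: measurable_fun_set0.
  by apply/seteqP; split => w // -[]; rewrite k0.
have k0' : 0 < k%:R :> R by rewrite ltr0n.
have kn' : k%:R < n%:R :> R by rewrite ltr_nat.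
apply: measurable_fun_le_set => t; have [kt|tk] := leP k%:R t.
  rewrite (_ : _ `&` _ = E); first exact: measurable_well_defined.
  apply/seteqP; split => w; first by case.
  move=> Ew; split => //=; have [lk _ _ _] := ratioE Ew; exact: (le_trans (ltW lk)).
pose c := ln p - ln ((k%:R - t) / (n%:R - t)).
have mSt : measurable_fun setT (fun w => S' w - t * D w).
  by apply: measurable_funB => //; exact: measurable_funM.
have mh : measurable_fun setT (fun w => k%:R * D w + c * (S' w - t * D w)).
  by apply: measurable_funD; exact: measurable_funM.
rewrite (_ : [set w | _] = [set w | lam w <= t]) //.
rewrite (_ : E `&` _ = E `&` (([set w | S' w - t * D w <= 0] `&` [set w | 0 < t]) `|`
   ([set w | 0 < S' w - t * D w] `&` [set w | 0 <= k%:R * D w + c * (S' w - t * D w)]))).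
  apply: measurableI; first exact: measurable_well_defined.
  apply: measurableU; apply: measurableI.
  - exact: measurable_set_le.
  - exact: measurable_set_lt.
  - exact: measurable_set_lt.
  - exact: measurable_set_le.
apply/seteqP; split => w [Ew].
all: have [lk lS l0 _] := ratioE Ew.
all: have S0 : 0 < S' w by move: Ew; rewrite EE// => -[].
  move=> /= lt; split => //; have [St|St] := leP (S' w - t * D w) 0.
    left; split => //=; rewrite ltNge; apply/negP => t0.
    have [D0|D0] := leP 0 (D w); first by have := mulr_le0_ge0 t0 D0; lra.
    by have := ler_wnM2r (ltW D0) lt; lra.
  right; split => //=.
  have : 0 <= multiplier_fun k%:R n%:R (S' w) (D w) p t.
    move: lt; rewrite le_eqVlt => /predU1P[<-|lt]; first by rewrite l0.
    by rewrite -l0 ltW//; exact: multiplier_fun_lt.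
  rewrite /multiplier_fun -addrA -/c => h; have := mulr_ge0 (ltW St) h.
  by rewrite mulrDr mulrC divfK ?gt_eqF// (mulrC c).
move=> h; split => //=; rewrite leNgt; apply/negP => tl.
case: h => -[/= h1 h2].
  have [D0|D0] := leP 0 (D w).
    by have := ler_wpM2r D0 (ltW tl); lra.
  by move: D0; rewrite -(pmulr_rlt0 _ h2); lra.
have := multiplier_fun_lt p k0' kn' tl lk h1 lS; rewrite l0 ltNge => /negP; apply.
rewrite /multiplier_fun -addrA -/c -(pmulr_rge0 _ h1).
by rewrite mulrDr mulrC divfK ?gt_eqF// (mulrC _ c).
Qed.

Lemma measurable_log_lik_ratio :
  measurable_fun E (fun w => log_lik_ratio (sample w) n k p xp).
Proof.
have [k0|k0] := posnP k.
  rewrite (_ : E = set0); first exact: measurable_fun_set0.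
  by apply/seteqP; split => w // -[]; rewrite k0.
have k0' : 0 < k%:R :> R by rewrite ltr0n.
have kn' : k%:R < n%:R :> R by rewrite ltr_nat.
pose N w := exceed_count (sample w) n (Xnk w).
have mN : measurable_fun E N.
  apply: measurable_funTS; apply: measurable_sum => i.
  rewrite (_ : (fun w => _) = \1_[set w | Xnk w < X i w]).
    by apply: measurable_indic; apply: measurable_set_lt => //; exact: measurable_order_statB.
  apply/funext => w; rewrite indicE; congr (_%:R); congr nat_of_bool.
  by apply/idP/idP; rewrite inE.
have mSE : measurable_fun E S' by exact: measurable_funTS.
have mDE : measurable_fun E D by exact: measurable_funTS.
have mc (a : R) : measurable_fun E (fun=> a) by exact: measurable_cst.
(* The multiplier equation rewrites [k (r - 1)] without a division by [S' - lam D], so that [G] is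
   built from measurable operations on all of [E]. *)
pose G w := - 2 * (N w * ln (1 - lam w / k%:R) - n%:R * ln (1 - lam w / n%:R)
     + N w * (ln (S' w) - ln (S' w - lam w * D w))
     + lam w * (ln p - (ln (k%:R - lam w) - ln (n%:R - lam w)))).
have mG : measurable_fun E G.
  apply: measurable_funM => //; apply: measurable_funD; last first.
    apply: measurable_funM => //; apply: measurable_funB => //.
    by apply: measurable_funB; apply: mln; exact: measurable_funB.
  apply: measurable_funD; last first.
    apply: measurable_funM => //; apply: measurable_funB; apply: mln => //.
    by apply: measurable_funB => //; exact: measurable_funM.
  apply: measurable_funB; apply: measurable_funM => //; apply: mln.
    by apply: measurable_funB => //; exact: measurable_funM.
  by apply: measurable_funB => //; exact: measurable_funM.
apply: eq_measurable_fun mG => w; rewrite inE => Ew; have [lk lS l0 ->] := ratioE Ew.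
have S0 : 0 < S' w by move: Ew; rewrite EE// => -[].
rewrite /G -/(N w); congr (_ * _).
have kl : 0 < k%:R - lam w by rewrite subr_gt0.
have nl : 0 < n%:R - lam w by rewrite subr_gt0; exact: lt_trans kn'.
rewrite -(ln_div S0 lS) -(ln_div kl nl); congr (_ + _).
have -> : ln p - ln ((k%:R - lam w) / (n%:R - lam w)) = - (k%:R * D w / (S' w - lam w * D w)).
  by move: l0; rewrite /multiplier_fun; lra.
by field; rewrite gt_eqF.
Qed.

End Fixed_candidate.
End Measurable_statistics.

(** * Replacing the random threshold by a deterministic level *)

Section Sample_approximation.
Context {R : realType}.
Variables (x : nat -> R) (n k : nat).
Hypothesis k0 : (0 < k)%N.
Hypothesis kn : (k < n)%N.
Variables (gamma u : R).
Hypothesis gamma0 : 0 < gamma.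
Hypothesis u0 : 0 < u.
Local Notation K := (Num.sqrt k%:R : R).
Local Notation Xnk := (order_stat x n (n - k)).
Local Notation S := (log_excess_sum x n k).
Local Notation N := (exceed_count x n).

Definition shifted_level s : R := u * expR (s / (gamma * K)).

Let k0' : 0 < k%:R :> R. Proof. by rewrite ltr0n. Qed.
Let K0 : 0 < K. Proof. by rewrite sqrtr_gt0. Qed.
Let K2 : K ^+ 2 = k%:R. Proof. by rewrite sqr_sqrtr// ltW. Qed.
Let gK0 : 0 < gamma * K. Proof. by rewrite mulr_gt0. Qed.

Let level_gt0 s : 0 < shifted_level s.
Proof. by rewrite mulr_gt0// expR_gt0. Qed.

(** Subgradient inequality: as a function of [ln v] the tail log sum is convex with slope
    [- N v]. *)
Lemma tail_log_sum_le v v' : 0 < v -> 0 < v' ->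
  tail_log_sum x n v' + (ln v' - ln v) * N v' <= tail_log_sum x n v.
Proof.
move=> v0 v'0; rewrite /tail_log_sum /exceed_count mulr_sumr -big_split/=.
apply: ler_sum => i _; have [h'|h'] := ltP v' (x i); last first.
  rewrite !mul0r mulr0 addr0; have [h|h] := ltP v (x i); last by rewrite mul0r.
  by rewrite mul1r subr_ge0 ler_ln ?posrE ?(ltW h)//; exact: lt_trans h.
rewrite mul1r mulr1 addrA subrK; have [h|h] := ltP v (x i); first by rewrite mul1r.
by rewrite mul0r subr_le0 ler_ln ?posrE//; exact: lt_trans h'.
Qed.

Lemma exceed_count_le v v' : v <= v' -> N v' <= N v.
Proof.
move=> vv'; apply: ler_sum => i _; rewrite ler_nat.
have [h|//] := ltP v' (x i); by rewrite (le_lt_trans vv' h).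
Qed.

Variables (J : nat) (eta M : R).
Hypothesis eta0 : 0 < eta.
Hypothesis JM : J%:R * eta = M.
Let grid (j : nat) : R := j%:R * eta - M.
Hypothesis gridP : forall j, (j <= J.*2)%N ->
  `|(N (shifted_level (grid j)) - N u) / K + grid j| <= eta.
Hypothesis centerP : `|(N u - k%:R) / K| <= M - 3 * eta.
Local Notation C := ((N u - k%:R) / K).

Let level_ge j : (j <= J.*2)%N -> Xnk <= shifted_level (grid j) -> C - grid j <= eta.
Proof.
move=> jJ; rewrite order_stat_le// => h.
have := gridP jJ; rewrite ler_norml => /andP[h1 h2].
have : (N (shifted_level (grid j)) - k%:R) / K <= 0.
  by rewrite pmulr_lle0 ?invr_gt0// subr_le0.
have -> : (N (shifted_level (grid j)) - k%:R) / K =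
  (N (shifted_level (grid j)) - N u) / K + C by rewrite -mulrDl addrA subrK.
by move: h1; lra.
Qed.

Let level_lt j : (j <= J.*2)%N -> shifted_level (grid j) < Xnk -> grid j - C <= eta.
Proof.
move=> jJ; rewrite ltNge order_stat_le// -ltNge => h.
have := gridP jJ; rewrite ler_norml => /andP[h1 h2].
have : 0 <= (N (shifted_level (grid j)) - k%:R) / K.
  by rewrite pmulr_lge0 ?invr_gt0// subr_ge0 ltW.
have -> : (N (shifted_level (grid j)) - k%:R) / K =
  (N (shifted_level (grid j)) - N u) / K + C by rewrite -mulrDl addrA subrK.
by move: h2; lra.
Qed.

(** The grid runs from [- M] to [M]. By the count estimates its lowest level is below the threshold
    and its highest one is not; take the first level reaching the threshold. *)
Let bracket : exists j, [/\ (j < J.*2)%N, shifted_level (grid j) < Xnk &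
  Xnk <= shifted_level (grid j.+1)].
Proof.
have cP := centerP; have e0 := eta0; move: cP; rewrite ler_norml => /andP[c1 c2].
have g0 : grid 0 = - M by rewrite /grid mul0r sub0r.
have gJ : grid J.*2 = M by rewrite /grid -muln2 natrM mulrAC JM; ring.
have low : shifted_level (grid 0) < Xnk.
  rewrite ltNge; apply/negP => /(level_ge (leq0n _)); rewrite g0; lra.
have up : Xnk <= shifted_level (grid J.*2).
  rewrite leNgt; apply/negP => /(level_lt (leqnn _)); rewrite gJ; lra.
have ex : exists j, (j <= J.*2)%N && (Xnk <= shifted_level (grid j)).
  by exists J.*2; rewrite leqnn.
case: (ex_minnP ex) => -[|j] /andP[jJ Xj] jmin.
  by move: low; rewrite ltNge Xj.
exists j; split => //; rewrite ltNge; apply/negP => h.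
by have := jmin j; rewrite h (ltnW jJ) => /(_ isT); rewrite ltnn.
Qed.

(** At log distance [s / (gamma K)] above [u] the count drops by about [K s], so the threshold,
    where the count is about [k], sits at [s] close to [C]. *)
Lemma order_stat_bracket : 0 < Xnk /\
  let s := gamma * K * (ln Xnk - ln u) in
  [/\ `|s| <= M, `|s - C| <= 2 * eta & k%:R - 3 * eta * K <= N Xnk <= k%:R].
Proof.
have [j [jJ h1 h2]] := bracket.
have a0 : 0 < Xnk by exact: lt_trans h1.
split=> // s.
have e0 := eta0.
have lnl t : ln (shifted_level t) = ln u + t / (gamma * K).
  by rewrite lnM ?posrE ?expR_gt0// expRK.
have s1 : grid j < s.
  move: h1; rewrite -ltr_ln ?posrE// lnl -ltrBrDl ltr_pdivrMr// mulrC.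
  by rewrite /s => h1; exact: h1.
have s2 : s <= grid j.+1.
  move: h2; rewrite -ler_ln ?posrE// lnl -lerBlDl ler_pdivlMr// mulrC.
  by rewrite /s => h2; exact: h2.
have b1 := level_lt (ltnW jJ) h1; have b2 := level_ge jJ h2.
have gS : grid j.+1 = grid j + eta by rewrite /grid -natr1 mulrDl mul1r addrAC.
have g0 : - M <= grid j by rewrite /grid lerBrDl addrN mulr_ge0// ltW.
have gM : grid j.+1 <= M.
  rewrite /grid lerBlDl -JM -mulrDl ler_pM2r// -natrD ler_nat addnn//.
rewrite gS in b2 s2 gM; split.
- by rewrite ler_norml; apply/andP; split; lra.
- by rewrite ler_norml; apply/andP; split; lra.
- rewrite -order_stat_le// lexx andbT; apply: le_trans (exceed_count_le h2).
  have := gridP jJ; rewrite ler_norml => /andP[h3 _].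
  have : - (3 * eta) <= (N (shifted_level (grid j.+1)) - k%:R) / K.
    have -> : (N (shifted_level (grid j.+1)) - k%:R) / K =
      (N (shifted_level (grid j.+1)) - N u) / K + C by rewrite -mulrDl addrA subrK.
    by move: h3; rewrite gS; lra.
  by rewrite ler_pdivlMr//; lra.
Qed.

Let tail_sumE : \sum_(i < n) score gamma u (x i) = gamma * tail_log_sum x n u - N u.
Proof.
rewrite /score /excess sumrB /tail_log_sum mulr_sumr; congr (_ - _).
by apply: eq_bigr => i _; rewrite mulrCA.
Qed.

Variables t p xp : R.
Hypothesis M1 : 1 <= M.
Hypothesis t0 : 0 < t.
Hypothesis eta_t : eta <= t.
Hypothesis tM : 40 * M ^+ 2 * t <= 1.
Hypothesis tL : 1 <= t * ln (k%:R / (n%:R * p)).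
Hypothesis tK : 1 <= t * K.
Hypothesis p01 : 0 < p < 1.
Hypothesis xpP : `|gamma * (ln xp - ln u) - ln (k%:R / (n%:R * p))| <= K^-1.
Local Notation zeta := ((\sum_(i < n) score gamma u (x i)) / K).
Hypothesis zetaM : `|zeta| <= M - 1.

(** Here the sample enters only through inequalities. They put [Z] within order [t] of [zeta] and
    verify the hypotheses of [log_ratio_expansion]. *)
Lemma log_lik_ratio_approx : well_defined_sample x n k /\
  `|log_lik_ratio x n k p xp - zeta ^+ 2| <= 410 * (M ^+ 3 * t).
Proof.
have [a0 [sM sC /andP[N1 N2]]] := order_stat_bracket.
set s := gamma * K * _ in sM sC.
have [M1' t0' e0 et] : [/\ 1 <= M, 0 < t, 0 < eta & eta <= t] by split.
have [tM' tK' zM] : [/\ 40 * M ^+ 2 * t <= 1, 1 <= t * K & `|zeta| <= M - 1] by split.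
have K0' := K0.
have cM : `|C| <= M by move: centerP; lra.
pose Z := (gamma * S - k%:R) / K.
have SE : gamma * S = K ^+ 2 + K * Z.
  by rewrite K2 /Z mulrC [X in _ + X]mulrC divfK ?gt_eqF// addrC subrK mulrC.
have M2 : M <= M ^+ 2 by rewrite expr2 ler_peMr//; lra.
have M1t : t <= M ^+ 2 * t by rewrite ler_peMl ?(ltW t0')// exprn_ege1.
(* Convexity, used from both sides, gives [gamma S = gamma * tail_log_sum x n u - K s] up to
   [M ^ 2]. The linear effect [- s] on [Z] is compensated by [C], the deviation of the count at
   [u]. *)
have Zz : `|Z - zeta| <= 3 * (M ^+ 2 * t).
  have low := tail_log_sum_le a0 u0; have up := tail_log_sum_le u0 a0.
  rewrite -log_excess_sumE// in low up.
  have sE : gamma * (ln Xnk - ln u) = s / K by rewrite /s; field; rewrite gt_eqF.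
  have NuE : N u = k%:R + K * C by rewrite mulrC divfK ?gt_eqF// addrC subrK.
  have ZE : Z - zeta = C - s + (gamma * S - gamma * tail_log_sum x n u + K * s) / K.
    by rewrite /Z tail_sumE; field; rewrite gt_eqF.
  have skE : s / K * k%:R = K * s.
    have kK : k%:R = K * K by rewrite -expr2 K2.
    have cancel (a b : R) : b != 0 -> a / b * (b * b) = b * a by move=> b0; field.
    rewrite -(cancel s K) ?gt_eqF//; congr (_ * _); exact: kK.
  have err : `|gamma * S - gamma * tail_log_sum x n u + K * s| <= M ^+ 2.
    move: low up => /(ler_wpM2l (ltW gamma0)) low /(ler_wpM2l (ltW gamma0)) up.
    rewrite mulrDr mulrA mulrBr -opprB -mulrBr sE NuE in low.
    rewrite mulrDr mulrA sE in up.
    have low' : - (s * C) <= gamma * S - gamma * tail_log_sum x n u + K * s.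
      have : - (s / K) * (k%:R + K * C) = - (K * s) - s * C.
        have expand (a b m c : R) : b != 0 -> a / b * m = b * a ->
            - (a / b) * (m + b * c) = - (b * a) - a * c.
          by move=> b0; rewrite mulrDr mulNr => ->; field.
        by apply: expand => //; rewrite gt_eqF.
      lra.
    have up' : gamma * S - gamma * tail_log_sum x n u + K * s <= s * ((k%:R - N Xnk) / K).
      have : s / K * N Xnk = K * s - s * ((k%:R - N Xnk) / K).
        by rewrite -skE; ring.
      lra.
    have b1 : `|s * C| <= M * M by rewrite normrM ler_pM.
    have b2 : `|s * ((k%:R - N Xnk) / K)| <= M * M.
      rewrite normrM ler_pM// ger0_norm; last by rewrite divr_ge0 ?(ltW K0')// subr_ge0.
      rewrite ler_pdivrMr//; apply: (@le_trans _ _ (3 * eta * K)); first lra.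
      rewrite ler_pM2r//; have := normr_ge0 C; have := centerP; lra.
    rewrite expr2; move: b1 b2; rewrite !ler_norml => /andP[? ?] /andP[? ?].
    by apply/andP; split; lra.
  rewrite ZE (le_trans (ler_normD _ _))//.
  rewrite normrM normfV (gtr0_norm K0').
  have : `|gamma * S - gamma * tail_log_sum x n u + K * s| / K <= M ^+ 2 * t.
    rewrite ler_pdivrMr// (le_trans err)// -mulrA ler_peMr// sqr_ge0//.
  by move: sC; rewrite distrC; lra.
have ZM : `|Z| <= M.
  by have := ler_normD (Z - zeta) zeta; rewrite subrK; lra.
have S0 : 0 < S.
  rewrite -(pmulr_rgt0 _ gamma0) SE (_ : _ + _ = K * (K + Z)); last by ring.
  rewrite mulr_gt0//; have : 40 * M ^+ 2 * t <= K * t by rewrite (mulrC K); lra.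
  rewrite ler_pM2r//; move: ZM; rewrite ler_norml => /andP[]; lra.
split; first by split => //; rewrite gt_eqF.
have [lk lS l0 ->] := log_lik_ratioE kn xp k0 a0 S0 p01.
move: lk lS l0; set D := _ - ln Xnk; set lam := lambda_hat _ _ _ _ _ => lk lS l0.
have lk' : lam < K ^+ 2 by rewrite K2.
have l0' : multiplier_fun (K ^+ 2) n%:R S D p lam = 0 by rewrite K2.
have K2n : K ^+ 2 < n%:R by rewrite K2 ltr_nat.
have tL' : 1 <= t * ln (K ^+ 2 / (n%:R * p)) by rewrite K2.
have Nk : `|N Xnk - K ^+ 2| <= 3 * (t * K).
  rewrite K2 ler_norml; apply/andP; split; last first.
    by move: N2 tK'; lra.
  have : eta * K <= t * K by rewrite ler_pM2r.
  lra.
pose e1 := gamma * D - ln (K ^+ 2 / (n%:R * p)).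
have DE : gamma * D = ln (K ^+ 2 / (n%:R * p)) + e1 by rewrite /e1 addrC subrK.
have e1M : `|K * e1| <= M + 1.
  have -> : K * e1 = K * (gamma * (ln xp - ln u) - ln (k%:R / (n%:R * p))) - s.
    by rewrite /e1 /D /s K2; ring.
  rewrite (le_trans (ler_normB _ _))// addrC lerD// normrM (gtr0_norm K0').
  by have := ler_wpM2l (ltW K0') xpP; rewrite divff// gt_eqF.
have h := log_ratio_expansion gamma0 K2n p01 M1' t0' tM' tL' tK' ZM SE DE e1M Nk lk' lS l0'.
rewrite K2 in h.
have Zz2 : `|Z ^+ 2 - zeta ^+ 2| <= 6 * (M ^+ 3 * t).
  rewrite subr_sqr normrM; have : `|Z + zeta| <= 2 * M.
    by have := ler_normD Z zeta; lra.
  move=> /(ler_pM (normr_ge0 _) (normr_ge0 _) Zz) => /le_trans; apply.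
  by rewrite le_eqVlt; apply/orP; left; apply/eqP; ring.
apply: (le_trans (ler_distD (Z ^+ 2) _ _)); apply: (le_trans (lerD h Zz2)).
have : 0 <= M ^+ 3 * t by rewrite mulr_ge0 ?(ltW t0')// exprn_ge0//; lra.
lra.
Qed.

End Sample_approximation.

(** * Chebyshev's inequality for sums of independent terms *)

Section Chebyshev.
Context {d : measure_display} {T : measurableType d} {R : realType}.
Variables (P : probability T R) (X : nat -> {RV P >-> R}).
Hypothesis indX : mutually_independent X.

(** Induction on [j]: integrating out the last, centred and independent term kills the cross
    product. *)
Let second_moment (f : R -> R) (B v : R) j : measurable_fun setT f ->
  (forall z, `|f z| <= B) ->
  (forall i, \int[P]_w f (X i w) = 0) ->
  (forall i, \int[P]_w (f (X i w) ^+ 2) <= v) ->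
  (\int[P]_w (partial_sum X f j w ^+ 2)%:E <= (j%:R * v)%:E)%E.
Proof.
move=> mf fB f0 fv; have mfX i : measurable_fun setT (f \o X i).
  by apply: measurableT_comp => //; exact: measurable_funPT.
have if1 i : P.-integrable setT (EFin \o (fun w => f (X i w))).
  by apply: (bounded_integrable _ (M := B)) => //; exact: mfX.
have if2 i : P.-integrable setT (EFin \o (fun w => f (X i w) ^+ 2)).
  apply: (bounded_integrable _ (M := B ^+ 2)).
    exact: (measurable_funX 2 (mfX i)).
  by move=> w; rewrite normrX lerXn2r ?nnegrE// (le_trans _ (fB 0)).
have ps i : measurable_fun setT (partial_sum X f i) by exact: measurable_partial_sum.
elim: j => [|j ih].
  rewrite mul0r integral0_eq// => w _; by rewrite /partial_sum big_ord0 expr0n.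
under eq_integral do rewrite partial_sumS.
have -> : (\int[P]_w ((partial_sum X f j w + f (X j w)) ^+ 2)%:E =
   \int[P]_w \int[P]_w' ((partial_sum X f j w + f (X j w')) ^+ 2)%:E)%E.
  apply: (@ge0_integral_independent_add _ _ _ P (partial_sum X f j) (f \o X j) (ps j)
    (mfX j) _ (fun z => z ^+ 2)).
  - exact: independent_partial_sum.
  - exact: measurable_funX.
  - by move=> z; exact: sqr_ge0.
have inner z : (\int[P]_w' ((z + f (X j w')) ^+ 2)%:E =
    (z ^+ 2)%:E + (\int[P]_w (f (X j w) ^+ 2))%:E)%E.
  have iz : P.-integrable setT (EFin \o (fun w : T => z ^+ 2)).
    exact: finite_measure_integrable_cst.
  have izf : P.-integrable setT (EFin \o (fun w => 2 * z * f (X j w))).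
    exact: (integrableZl measurableT (2 * z) (if1 j)).
  have izD : P.-integrable setT (EFin \o (fun w => z ^+ 2 + 2 * z * f (X j w))).
    exact: (integrableD measurableT iz izf).
  have E w' : ((z + f (X j w')) ^+ 2)%:E = (z ^+ 2 + 2 * z * f (X j w') + f (X j w') ^+ 2)%:E.
    by congr (_%:E); ring.
  under eq_integral do rewrite E.
  rewrite -EFin_Rintegral; last exact: (integrableD measurableT izD (if2 j)).
  rewrite (RintegralD measurableT izD (if2 j)) (RintegralD measurableT iz izf).
  rewrite (RintegralZl (2 * z) measurableT (if1 j)) f0 mulr0 addr0.
  by rewrite (Rintegral_cst_prob P) EFinD.
under eq_integral do rewrite inner.
have v0 : 0 <= \int[P]_w (f (X j w) ^+ 2) by apply: Rintegral_ge0 => w _; exact: sqr_ge0.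
rewrite ge0_integralD//.
- rewrite integral_cst// [X in (_ * X)%E]probability_setT mule1.
  rewrite -natr1 mulrDl mul1r EFinD; apply: leeD => //.
  by rewrite lee_fin.
- by move=> w _; rewrite lee_fin sqr_ge0.
- by apply/measurable_EFinP; exact: measurable_funX.
Qed.

Lemma chebyshev_partial_sum (f : R -> R) (B m v a : R) n : measurable_fun setT f ->
  (forall z, `|f z| <= B) ->
  (forall i, \int[P]_w f (X i w) = m) ->
  (forall i, \int[P]_w (f (X i w) ^+ 2) <= v) -> 0 < a ->
  fine (P [set w | a < `|partial_sum X f n w - n%:R * m|]) <= n%:R * v / a ^+ 2.
Proof.
move=> mf fB fm fv a0.
pose g z := f z - m.
have mg : measurable_fun setT g by exact: measurable_funB.
have mfX i : measurable_fun setT (f \o X i).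
  by apply: measurableT_comp => //; exact: measurable_funPT.
have if1 i : P.-integrable setT (EFin \o (fun w => f (X i w))).
  by apply: (bounded_integrable _ (M := B)) => //; exact: mfX.
have if2 i : P.-integrable setT (EFin \o (fun w => f (X i w) ^+ 2)).
  apply: (bounded_integrable _ (M := B ^+ 2)).
    exact: (measurable_funX 2 (mfX i)).
  by move=> w; rewrite normrX lerXn2r ?nnegrE// (le_trans _ (fB 0)).
have ic (c : R) : P.-integrable setT (EFin \o (fun w : T => c)).
  exact: finite_measure_integrable_cst.
have gB z : `|g z| <= B + `|m| by rewrite (le_trans (ler_normB _ _))// lerD2r.
have g0 i : \int[P]_w g (X i w) = 0.
  rewrite /g (RintegralB measurableT (if1 i) (ic m)) fm (Rintegral_cst_prob P).
  by rewrite subrr.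
have gv i : \int[P]_w (g (X i w) ^+ 2) <= v.
  have iz : P.-integrable setT (EFin \o (fun w => 2 * m * f (X i w))).
    exact: (integrableZl measurableT (2 * m) (if1 i)).
  have E w : g (X i w) ^+ 2 = f (X i w) ^+ 2 - (2 * m * f (X i w)) + m ^+ 2.
    by rewrite /g; ring.
  under eq_Rintegral do rewrite E.
  rewrite (RintegralD measurableT (integrableB measurableT (if2 i) iz) (ic _)).
  rewrite (RintegralB measurableT (if2 i) iz).
  rewrite (RintegralZl (2 * m) measurableT (if1 i)) fm (Rintegral_cst_prob P).
  by have := fv i; have := sqr_ge0 m; rewrite expr2; lra.
have psE w : partial_sum X f n w - n%:R * m = partial_sum X g n w.
  by rewrite /partial_sum /g sumrB sumr_const card_ord mulr_natl.
have mps : measurable_fun setT (partial_sum X g n) by exact: measurable_partial_sum.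
rewrite (_ : [set w | _] = [set w | a < `|partial_sum X g n w|]); last first.
  by apply/seteqP; split => w /=; rewrite psE.
set A := [set w | _].
have mA : measurable A.
  apply: measurable_set_lt => //.
  exact: (measurableT_comp (@normr_measurable R setT) mps).
rewrite ler_pdivlMr ?exprn_gt0// mulrC -lee_fin.
apply: le_trans (second_moment n mg gB g0 gv).
rewrite EFinM fineK; last exact: fin_num_measure.
rewrite -[X in (_ * P X)%E]setIT -integral_indic// -ge0_integralZl//; last 2 first.
- by apply/measurable_EFinP; exact: measurable_indic.
- by rewrite lee_fin sqr_ge0.
apply: ge0_le_integral => //.
- by move=> w _; rewrite -EFinM lee_fin mulr_ge0// sqr_ge0.
- by apply/measurable_EFinP; apply: measurable_funM => //; exact: measurable_indic.
- by apply/measurable_EFinP; exact: measurable_funX.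
- move=> w _; rewrite -EFinM lee_fin indicE; have [|_] := boolP (w \in A); last first.
    by rewrite mulr0 sqr_ge0.
  rewrite inE /A/= mulr1 => h; rewrite -(real_normK (num_real (partial_sum X g n w))).
  by rewrite lerXn2r ?nnegrE// ltW.
Qed.

End Chebyshev.

Lemma fine_probability_le d (T : measurableType d) (R : realType) (P : probability T R)
    (A B : set T) : measurable A -> measurable B -> A `<=` B -> fine (P A) <= fine (P B).
Proof.
by move=> mA mB AB; rewrite fine_le ?fin_num_measure// le_measure ?inE.
Qed.

(** * Concentration of exceedance counts *)

Section Exceedance_counts.
Context {d : measure_display} {T : measurableType d} {R : realType}.
Variables (P : probability T R) (X : nat -> {RV P >-> R}) (F : R -> R).
Hypothesis indX : mutually_independent X.
Hypothesis cdfX : forall i x, cdf (X i) x = (F x)%:E.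
Local Notation N w n v := (exceed_count (fun i => X i w) n v).

Lemma expR_quadratic (y : R) : `|y| <= 1 / 2 -> expR y <= 1 + y + 2 * y ^+ 2.
Proof.
rewrite ler_norml => /andP[y1 y2].
have h : 0 < 1 - y by lra.
have e1 : 1 - y <= expR (- y) by exact: expR_ge1Dx.
rewrite expRN in e1.
have : expR y <= (1 - y)^-1.
  by rewrite -[leLHS]invrK lef_pV2 ?posrE ?invr_gt0 ?expR_gt0.
move=> /le_trans; apply; rewrite -[leLHS]mul1r ler_pdivrMr//.
have : 0 <= y ^+ 2 * (1 - 2 * y) by rewrite mulr_ge0 ?sqr_ge0//; lra.
by rewrite !expr2; lra.
Qed.

Let Rintegral_gt i v : \int[P]_w ((v < X i w)%R%:R : R) = 1 - F v.
Proof.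
have mA : measurable [set w | v < X i w].
  by apply: measurable_set_lt => //; exact: measurable_funPT.
rewrite (_ : (fun w => _) = \1_[set w | v < X i w]).
  rewrite /Rintegral integral_indic// setIT -[RHS]/(fine (1 - F v)%:E).
  by congr fine; exact: (probability_gt (cdfX i)).
apply/funext => w; rewrite indicE; congr (_%:R); congr nat_of_bool.
by apply/idP/idP; rewrite inE.
Qed.

Let integrable_gt i v : P.-integrable setT (EFin \o (fun w => (v < X i w)%R%:R : R)).
Proof.
apply: (bounded_integrable _ (M := 1)).
  exact: (measurableT_comp (measurable_gt v) (measurable_funPT (X i))).
by move=> w; case: (v < X i w); rewrite ?normr1 ?normr0.
Qed.

Lemma exceed_count_chebyshev n v a : 0 < a ->
  fine (P [set w | a < `|N w n v - n%:R * (1 - F v)|]) <= n%:R * (1 - F v) / a ^+ 2.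
Proof.
move=> a0.
apply: (@chebyshev_partial_sum _ _ _ P X indX (fun z => (v < z)%R%:R) 1) => //.
- exact: measurable_gt.
- by move=> z; case: (v < z); rewrite ?normr1 ?normr0.
- move=> i; rewrite -(Rintegral_gt i v) le_eqVlt; apply/orP; left; apply/eqP.
  by apply: eq_Rintegral => w _; case: (v < X i w); rewrite ?expr1n ?expr0n.
Qed.

Lemma exceed_countB_chebyshev n u v a : 0 < a ->
  fine (P [set w | a < `|N w n v - N w n u - n%:R * (F u - F v)|]) <=
  n%:R * `|F u - F v| / a ^+ 2.
Proof.
move=> a0; pose f z : R := (v < z)%R%:R - (u < z)%R%:R.
have mE i : \int[P]_w f (X i w) = F u - F v.
  rewrite /f (RintegralB measurableT (integrable_gt i v) (integrable_gt i u)).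
  by rewrite !Rintegral_gt; ring.
have NE w : N w n v - N w n u = partial_sum X f n w.
  by rewrite /partial_sum /f sumrB.
rewrite (_ : [set w | _] = [set w | a < `|partial_sum X f n w - n%:R * (F u - F v)|]); last first.
  by apply/seteqP; split => w /=; rewrite NE.
apply: (@chebyshev_partial_sum _ _ _ P X indX f 1) => //.
- by apply: measurable_funB; exact: measurable_gt.
- by move=> z; rewrite /f; case: (v < z); case: (u < z);
    rewrite ?subrr ?subr0 ?sub0r ?normrN ?normr1 ?normr0.
(* A difference of two nested indicators has constant sign, so its square is itself or its opposite,
   and the second moment is [|F u - F v|]. *)
- move=> i; have [uv|vu] := leP u v.
    have f2 z : f z ^+ 2 = - 1 * f z.
      rewrite /f; have [h|_] := ltP v z; last by case: (u < z) => /=; ring.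
      by rewrite (le_lt_trans uv h); ring.
    under eq_Rintegral do rewrite f2.
    rewrite (RintegralZl (- 1) measurableT); last first.
      exact: (integrableB measurableT (integrable_gt i v) (integrable_gt i u)).
    by rewrite mE mulN1r -normrN ler_norm.
  have f2 z : f z ^+ 2 = f z.
    rewrite /f; have [h|_] := ltP u z; last by case: (v < z) => /=; ring.
    by rewrite (lt_trans vu h); ring.
  by under eq_Rintegral do rewrite f2; rewrite mE ler_norm.
Qed.

Section Level.
Variables (gamma : R) (n k : nat) (u e : R).
Hypothesis k0 : (0 < k)%N.
Hypothesis n0 : (0 < n)%N.
Hypothesis gamma0 : 0 < gamma.
Hypothesis tb : tail_bounds F gamma (k%:R / n%:R) u e.
Local Notation K := (Num.sqrt k%:R : R).

Let k0' : 0 < k%:R :> R. Proof. by rewrite ltr0n. Qed.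
Let n0' : 0 < n%:R :> R. Proof. by rewrite ltr0n. Qed.
Let K0 : 0 < K. Proof. by rewrite sqrtr_gt0. Qed.
Let K2 : K ^+ 2 = k%:R. Proof. by rewrite sqr_sqrtr// ltW. Qed.
Let e0 : 0 <= e. Proof. by case: tb. Qed.

Let count_mean s : - ln 2 <= s / K -> `|s / K| + e <= 1 / 2 ->
  k%:R * (1 - s / K - e) <=
  n%:R * (1 - F (shifted_level k gamma u s)) <=
  k%:R * (1 - s / K + e + 2 * (`|s / K| + e) ^+ 2).
Proof.
move=> s1 s2; case: tb => _ _ /(_ (s / K) s1).
rewrite (_ : u * expR (s / K / gamma) = shifted_level k gamma u s); last first.
  by rewrite /shifted_level; congr (_ * expR _); field; rewrite !gt_eqF.
move=> /andP[h1 h2].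
have nk (y : R) : n%:R * (k%:R / n%:R * y) = k%:R * y by field; rewrite gt_eqF.
have := ler_wpM2l (ltW n0') h1; have := ler_wpM2l (ltW n0') h2; rewrite !nk.
move: (s / K) s1 s2 => z z1 z2 g2 g1; apply/andP; split.
  apply: le_trans g1; rewrite ler_pM2l// (le_trans _ (expR_ge1Dx _))//; lra.
apply: (le_trans g2); rewrite ler_pM2l//.
have e0' := e0.
have n1 : `|- z + e| <= `|z| + e.
  by rewrite (le_trans (ler_normD _ _))// normrN (ger0_norm e0').
have : expR (- z + e) <= 1 + (- z + e) + 2 * (- z + e) ^+ 2 by apply: expR_quadratic; lra.
have : (- z + e) ^+ 2 <= (`|z| + e) ^+ 2.
  by rewrite -(real_normK (num_real (- z + e))) lerXn2r ?nnegrE// addr_ge0.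
lra.
Qed.

(** The mean of the count is within [K] of [k], which accounts for the extra 1, and its variance is
    at most [2 k]. *)
Lemma center_probability a : e <= 1 / 4 -> 2 * (K * e) <= 1 -> 0 < a ->
  fine (P [set w | a + 1 < `|(N w n u - k%:R) / K|]) <= 2 / a ^+ 2.
Proof.
move=> e4 Ke a0; have e0' := e0; have K0' := K0.
have ln2 : 0 <= ln 2 :> R by rewrite ln_ge0// ler1n.
have := @count_mean 0; rewrite /shifted_level mul0r mul0r expR0 mulr1 normr0 oppr_le0 ln2.
rewrite add0r subr0 => /(_ isT)/(_ _)/wrap[]; first lra.
move=> /andP[h1 h2].
have e2 : 2 * e ^+ 2 <= e by rewrite expr2; have := ler_wpM2r e0' e4; lra.
have up : n%:R * (1 - F u) <= k%:R * (1 + 2 * e).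
  by apply: (le_trans h2); rewrite ler_pM2l//; lra.
have mean : `|n%:R * (1 - F u) - k%:R| <= K.
  have : k%:R * (2 * e) <= K.
    have kK : k%:R = K * K by rewrite -expr2 K2.
    by rewrite [X in X * _ <= _]kK -mulrA -[leRHS]mulr1 ler_pM2l//; lra.
  rewrite ler_norml; move: h1; rewrite mulrBr mulr1; move: up; rewrite mulrDr mulr1.
  have : 0 <= k%:R * e by rewrite mulr_ge0// ltW.
  move=> ? ? ? ?; apply/andP; split; lra.
have aK : 0 < a * K by rewrite mulr_gt0.
apply: (@le_trans _ _ (fine (P [set w | a * K < `|N w n u - n%:R * (1 - F u)|]))).
  have mN : measurable_fun setT (fun w => N w n u) by exact: measurable_exceed_count.
  apply: fine_probability_le.
  - apply: measurable_set_lt => //.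
    apply: (measurableT_comp (@normr_measurable R setT)).
    by apply: measurable_funM => //; exact: measurable_funB.
  - apply: measurable_set_lt => //.
    apply: (measurableT_comp (@normr_measurable R setT)).
    exact: measurable_funB.
  - move=> w /=; rewrite normrM normfV (gtr0_norm K0') ltr_pdivlMr// => h.
    have := ler_distD (n%:R * (1 - F u)) (N w n u) k%:R.
    by move: mean; lra.
apply: (le_trans (exceed_count_chebyshev n u aK)).
rewrite exprMn K2 ler_pdivrMr ?mulr_gt0 ?exprn_gt0//.
rewrite mulrA divfK ?gt_eqF ?exprn_gt0//.
by apply: (le_trans up); rewrite mulrC ler_pM2r//; lra.
Qed.

(** The mean of the increment is [- K s] up to [K eta / 2], while its variance is only about
    [K |s|], which is small against [k]. The 12 is a variance factor 3 over the square of
    [1 / 2]. *)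
Lemma grid_probability s eta : 0 < eta -> `|s| + K * e <= 1 / 2 * K ->
  2 * (K * e) + 2 * (`|s| + K * e) ^+ 2 / K <= eta / 2 ->
  fine (P [set w | eta < `|(N w n (shifted_level k gamma u s) - N w n u) / K + s|]) <=
  12 * ((`|s| + K * e) / K) / eta ^+ 2.
Proof.
move=> eta0 sK small; have e0' := e0; have K0' := K0.
set v := shifted_level _ _ _ _.
have ln2 : 1 / 2 <= ln 2 :> R.
  have : ln (1 + (- 1 / 2)) <= - 1 / 2 :> R by apply: le_ln1Dx; lra.
  by rewrite (_ : 1 + - 1 / 2 = 2^-1) ?lnV ?posrE//; lra.
have sE : `|s / K| + e = (`|s| + K * e) / K.
  by rewrite normrM normfV (gtr0_norm K0'); field; rewrite gt_eqF.
have sK2 : `|s / K| + e <= 1 / 2 by rewrite sE ler_pdivrMr.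
have z2 : - ln 2 <= s / K.
  by have := ler_norm (- (s / K)); rewrite normrN; lra.
have /andP[v1 v2] := count_mean z2 sK2.
have := @count_mean 0; rewrite /shifted_level !mul0r expR0 mulr1 normr0 oppr_le0.
rewrite add0r subr0 => /(_ _)/wrap[]; first lra.
move=> /(_ _)/wrap[]; first by have := normr_ge0 (s / K); lra.
move=> /andP[u1 u2].
rewrite -/v in v1 v2.
set y := `|s / K| + e in v2 sK2 sE.
have ey : e <= y by rewrite /y lerDr.
have y2 : 2 * y ^+ 2 <= y by rewrite expr2; have := ler_wpM2r (le_trans e0' ey) sK2; lra.
have e2 : e ^+ 2 <= y ^+ 2 by rewrite lerXn2r ?nnegrE//; lra.
have mean1 : `|n%:R * (F u - F v) + k%:R * (s / K)| <= k%:R * (2 * e + 2 * y ^+ 2).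
  rewrite ler_norml; have := ler_wpM2l (ltW k0') e2; have := mulr_ge0 (ltW k0') e0'.
  have := mulr_ge0 (ltW k0') (sqr_ge0 y).
  by move=> ? ? ?; apply/andP; split; lra.
have kK : k%:R = K * K by rewrite -expr2 K2.
have mean : `|n%:R * (F u - F v) + s * K| <= eta / 2 * K.
  have -> : s * K = k%:R * (s / K).
    have cancel (a b : R) : b != 0 -> a * b = b * b * (a / b) by move=> b0; field.
    by rewrite (cancel s K) ?gt_eqF//; congr (_ * _); exact/esym.
  apply: (le_trans mean1).
  apply: le_trans (ler_wpM2r (ltW K0') small).
  rewrite [X in X * _ <= _]kK sE le_eqVlt; apply/orP; left; apply/eqP.
  by field; rewrite gt_eqF.
have var : n%:R * `|F u - F v| <= k%:R * (3 * y).
  rewrite -[X in X * `|_|](gtr0_norm n0') -normrM.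
  have z1 : `|k%:R * (s / K)| <= k%:R * `|s / K| by rewrite normrM (gtr0_norm k0').
  have yE : k%:R * y = k%:R * `|s / K| + k%:R * e by rewrite -mulrDr.
  have := ler_wpM2l (ltW k0') y2; have := ler_wpM2l (ltW k0') ey.
  move: mean1 z1; rewrite !ler_norml => /andP[? ?] /andP[? ?] ? ?; apply/andP; split; lra.
have aK : 0 < eta / 2 * K by rewrite mulr_gt0// divr_gt0.
apply: (@le_trans _ _ (fine (P [set w | eta / 2 * K < `|N w n v - N w n u - n%:R * (F u - F v)|]))).
  have mN z : measurable_fun setT (fun w => N w n z) by exact: measurable_exceed_count.
  apply: fine_probability_le.
  - apply: measurable_set_lt => //.
    apply: (measurableT_comp (@normr_measurable R setT)).
    by apply: measurable_funD => //; apply: measurable_funM => //; exact: measurable_funB.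
  - apply: measurable_set_lt => //.
    apply: (measurableT_comp (@normr_measurable R setT)).
    by apply: measurable_funB => //; exact: measurable_funB.
  - move=> w /= h.
    have E : ((N w n v - N w n u) / K + s) * K =
       (N w n v - N w n u - n%:R * (F u - F v)) + (n%:R * (F u - F v) + s * K).
      by field; rewrite gt_eqF.
    have : eta * K < `|((N w n v - N w n u) / K + s) * K|.
      by rewrite normrM [X in _ < _ * X]gtr0_norm// ltr_pM2r.
    by rewrite E => /lt_le_trans/(_ (ler_normD _ _)); lra.
apply: (le_trans (exceed_countB_chebyshev n u v aK)).
rewrite ler_pdivrMr ?exprn_gt0// exprMn K2 -sE.
apply: (le_trans var); rewrite le_eqVlt; apply/orP; left; apply/eqP.
by field; rewrite gt_eqF.
Qed.

End Level.
End Exceedance_counts.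

Section Probability_bounds.
Context {d : measure_display} {T : measurableType d} {R : realType}.
Variable P : probability T R.

Lemma fine_probability_setU (A B : set T) : measurable A -> measurable B ->
  fine (P (A `|` B)) <= fine (P A) + fine (P B).
Proof.
move=> mA mB; rewrite -lee_fin EFinD !fineK ?fin_num_measure//; last exact: measurableU.
exact: measureU2.
Qed.

Lemma fine_probability_bigsetU (B : nat -> set T) (m : nat) (e : R) :
  (forall j, (j < m)%N -> measurable (B j)) ->
  (forall j, (j < m)%N -> fine (P (B j)) <= e) ->
  fine (P (\big[setU/set0]_(j < m) B j)) <= m%:R * e.
Proof.
elim: m => [|m ih] mB Be; first by rewrite big_ord0 measure0 mul0r.
rewrite big_ord_recr/=; apply: (le_trans (fine_probability_setU _ _)).
- by apply: bigsetU_measurable => i _; apply: mB; rewrite ltnS ltnW.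
- exact: mB.
- rewrite -natr1 mulrDl mul1r lerD ?Be// ih// => j jm; [apply: mB|apply: Be];
    exact: (ltn_trans jm).
Qed.

Lemma fine_probability_setC (A : set T) : measurable A ->
  fine (P (~` A)) = 1 - fine (P A).
Proof.
by move=> mA; rewrite probability_setC// fineB ?fin_num_measure.
Qed.

End Probability_bounds.

(** * Central limit theorem for the scores and the event of good approximation *)

Section Good_event.
Context {d : measure_display} {T : measurableType d} {R : realType}.
Variables (P : probability T R) (X : nat -> {RV P >-> R}) (F : R -> R) (gamma : R).
Variables (k : nat -> nat) (p u e : nat -> R).
Hypothesis indX : mutually_independent X.
Hypothesis cdfX : forall i x, cdf (X i) x = (F x)%:E.
Hypothesis F_nd : {homo F : x y / x <= y}.
Hypothesis F_rc : forall y c, (forall z, y < z -> c <= F z) -> c <= F y.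
Hypothesis F_Ny : forall e : R, 0 < e -> exists y, F y < e.
Hypothesis F_y : forall e : R, 0 < e -> exists y, 1 - F y < e.
Hypothesis F_lt1 : forall y, F y < 1.
Hypothesis gamma0 : 0 < gamma.
Hypothesis p01 : forall n, 0 < p n < 1.
Local Notation K n := (Num.sqrt (k n)%:R : R).
Local Notation L n := (ln ((k n)%:R / (n%:R * p n))).
Hypothesis k_lt : \forall n \near \oo, (0 < k n < n)%N.
Hypothesis K_large : forall B : R, \forall n \near \oo, B <= K n.
Hypothesis L_large : forall B : R, \forall n \near \oo, B <= L n.
Hypothesis tb : \forall n \near \oo, tail_bounds F gamma ((k n)%:R / n%:R) (u n) (e n).
Hypothesis Ke0 : K n * e n @[n --> \oo] --> (0 : R).

Definition scaled_score n x : R := score gamma (u n) x / K n.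

Local Notation zeta n w := (partial_sum X (scaled_score n) n w).

Let measurable_scaled_score n : measurable_fun setT (scaled_score n).
Proof. by apply: measurable_funM => //; exact: measurable_score. Qed.

Let Ke_small (c : R) : 0 < c -> \forall n \near \oo, K n * e n <= c.
Proof.
move=> c0; have /cvgrPdist_le/(_ c c0) := Ke0; apply: filterS => n.
by rewrite sub0r normrN => h; rewrite (le_trans _ h)// ler_norm.
Qed.

Let expR_bounds (x : R) : 0 <= x <= 1 / 2 -> expR x - expR (- x) <= 3 * x /\ expR x <= 2.
Proof.
move=> /andP[x0 x1]; have h1 := expR_ge1Dx (- x).
have h2 : expR x <= 1 + x + 2 * x ^+ 2 by apply: expR_quadratic; rewrite ger0_norm.
have h3 : 2 * x ^+ 2 <= x by rewrite expr2; have := ler_wpM2r x0 x1; lra.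
by split; lra.
Qed.

Lemma score_clt (c eps : R) : 0 <= c -> 0 < eps -> \forall n \near \oo,
  `|fine (P [set w | `|zeta n w| <= c]) - normal_within c| <= eps.
Proof.
have half : 0 < 1 / 2 :> R by lra.
have far : \forall n \near \oo, [/\ (0 < k n < n)%N,
    tail_bounds F gamma ((k n)%:R / n%:R) (u n) (e n), K n * e n <= 1 / 2 & 1 <= K n].
  have h3 := Ke_small half; have h4 := K_large 1.
  near=> n; split.
  - by near: n; exact: k_lt.
  - by near: n; exact: tb.
  - by near: n; exact: h3.
  - by near: n; exact: h4.
(* Moments of the score divided by powers of [K], using [exp e - exp (- e) <= 3 e] and [exp e <= 2];
   after multiplication by [n] all three tend to 0. *)
pose m1 n : R := 3 * (K n * e n) / n%:R.
pose m2 n : R := 9 * (K n * e n) / n%:R.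
pose m3 n : R := 14 / K n / n%:R.
have ints n i : (0 < k n < n)%N -> tail_bounds F gamma ((k n)%:R / n%:R) (u n) (e n) ->
   [/\ P.-integrable setT (EFin \o (scaled_score n \o X i)),
        P.-integrable setT (EFin \o (fun w => scaled_score n (X i w) ^+ 2)) &
        P.-integrable setT (EFin \o (fun w => `|scaled_score n (X i w)| ^+ 3))] /\
   [/\ \int[P]_w scaled_score n (X i w) = (K n)^-1 * \int[P]_w score gamma (u n) (X i w),
       \int[P]_w (scaled_score n (X i w) ^+ 2) =
         (K n)^-1 ^+ 2 * \int[P]_w (score gamma (u n) (X i w) ^+ 2) &
       \int[P]_w (`|scaled_score n (X i w)| ^+ 3) =
         `|(K n)^-1| ^+ 3 * \int[P]_w (`|score gamma (u n) (X i w)| ^+ 3)].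
  move=> /andP[k0 kn] tbn.
  have s0 : 0 <= (k n)%:R / n%:R :> R by rewrite divr_ge0.
  have [i1 i2 i3] := score_integrable (cdfX i) gamma0 s0 tbn.
  have E1 w : scaled_score n (X i w) = (K n)^-1 * score gamma (u n) (X i w).
    by rewrite /scaled_score mulrC.
  have E2 w : scaled_score n (X i w) ^+ 2 = (K n)^-1 ^+ 2 * score gamma (u n) (X i w) ^+ 2.
    by rewrite E1 exprMn.
  have E3 w : `|scaled_score n (X i w)| ^+ 3 =
     `|(K n)^-1| ^+ 3 * `|score gamma (u n) (X i w)| ^+ 3.
    by rewrite E1 normrM exprMn.
  split; split.
  - rewrite (_ : scaled_score n \o X i = (fun w => (K n)^-1 * score gamma (u n) (X i w))).
      exact: (integrableZl measurableT _ i1).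
    exact/funext.
  - by under eq_fun do rewrite E2; exact: (integrableZl measurableT _ i2).
  - by under eq_fun do rewrite E3; exact: (integrableZl measurableT _ i3).
  - by under eq_Rintegral do rewrite E1; exact: (RintegralZl _ measurableT i1).
  - by under eq_Rintegral do rewrite E2; exact: (RintegralZl _ measurableT i2).
  - by under eq_Rintegral do rewrite E3; exact: (RintegralZl _ measurableT i3).
have nm (f g : nat -> R) : (forall n, (0 < n)%N -> n%:R * f n = g n) ->
    g n @[n --> \oo] --> (0 : R) -> n%:R * f n @[n --> \oo] --> (0 : R).
  move=> fg; apply: cvg_trans; apply: near_eq_cvg; near=> n; rewrite fg//.
  by near: n; exact: nbhs_infty_gt.
have canc (a : R) n : (0 < n)%N -> n%:R * (a / n%:R) = a.
  by move=> n0; rewrite mulrC divfK// pnatr_eq0 -lt0n.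
move: c eps; apply: (array_clt indX measurable_scaled_score (m1 := m1) (m2 := m2) (m3 := m3)).
- apply: filterS far => n [kn tbn _ _] i _.
  by have [] := ints n i kn tbn.
- apply: filterS far => n [kn tbn Ke K1] i _.
  have [_ [-> -> ->]] := ints n i kn tbn; have /andP[k0 kn'] := kn.
  have s0 : 0 <= (k n)%:R / n%:R :> R by rewrite divr_ge0.
  have [j1 j2 j3] := score_moments (cdfX i) gamma0 s0 tbn.
  have K0 : 0 < K n by lra.
  have k0' : 0 < (k n)%:R :> R by rewrite ltr0n.
  have n0' : 0 < n%:R :> R by rewrite ltr0n; exact: leq_ltn_trans kn'.
  have kK : (k n)%:R = K n ^+ 2 by rewrite sqr_sqrtr// ltW.
  have e0 : 0 <= e n by case: tbn.
  have [x1 x2] : expR (e n) - expR (- e n) <= 3 * e n /\ expR (e n) <= 2.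
    apply: expR_bounds; rewrite e0/= (le_trans _ Ke)//.
    by rewrite ler_peMl.
  have ni : 0 <= n%:R^-1 :> R by rewrite invr_ge0 ltW.
  rewrite kK in j1 j2 j3.
  move: (\int[P]_w score _ _ _) (\int[P]_w (score _ _ _ ^+ 2))
    (\int[P]_w (`|score _ _ _| ^+ 3)) j1 j2 j3 => I1 I2 I3 j1 j2 j3.
  move: (expR (e n)) (expR (e n) - expR (- e n)) x1 x2 j1 j2 j3 => E2 E1 x1 x2 j1 j2 j3.
  rewrite /m1 /m2 /m3; clear kK.
  move: (K n) K1 K0 Ke j1 j2 j3 => L K1 K0 Ke j1 j2 j3.
  have Li : 0 < L^-1 by rewrite invr_gt0.
  split.
  + rewrite normrM gtr0_norm// (le_trans (ler_wpM2l (ltW Li) j1))//.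
    have -> : L^-1 * (L ^+ 2 / n%:R * E1) = E1 * (L * n%:R^-1) by field; rewrite !gt_eqF.
    have -> : 3 * (L * e n) / n%:R = 3 * e n * (L * n%:R^-1) by ring.
    by rewrite ler_wpM2r// mulr_ge0// ltW.
  + rewrite (_ : _ - _ = L^-1 ^+ 2 * (I2 - L ^+ 2 / n%:R)); last by field; rewrite !gt_eqF.
    rewrite normrM ger0_norm ?sqr_ge0// (le_trans (ler_wpM2l (sqr_ge0 _) j2))//.
    have -> : L^-1 ^+ 2 * (3 * (L ^+ 2 / n%:R * E1)) = 3 * E1 * n%:R^-1.
      by field; rewrite !gt_eqF.
    rewrite ler_wpM2r//; have : e n <= L * e n by rewrite ler_peMl.
    by move: x1; lra.
  + rewrite gtr0_norm// (le_trans (ler_wpM2l (exprn_ge0 3 (ltW Li)) j3))//.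
    have -> : L^-1 ^+ 3 * (7 * (L ^+ 2 / n%:R * E2)) = 7 * E2 * (L^-1 * n%:R^-1).
      by field; rewrite !gt_eqF.
    have -> : 14 / L / n%:R = 14 * (L^-1 * n%:R^-1) by ring.
    by rewrite ler_wpM2r ?mulr_ge0 ?(ltW Li)//; move: x2; lra.
- apply: (nm m1 (fun n => 3 * (K n * e n))); first by move=> n n0; exact: canc.
  by rewrite -(mulr0 3); apply: cvgMr.
- apply: (nm m2 (fun n => 9 * (K n * e n))); first by move=> n n0; exact: canc.
  by rewrite -(mulr0 9); apply: cvgMr.
- apply: (nm m3 (fun n => 14 / K n)); first by move=> n n0; exact: canc.
  rewrite -(mulr0 14); apply: cvgMr; apply/cvgrPdist_le => del del0.
  have h := K_large (Num.max 1 del^-1); near=> n.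
  have : Num.max 1 del^-1 <= K n by near: n; exact: h.
  rewrite ge_max => /andP[K1 Kd].
  have K0 : 0 < K n by exact: lt_le_trans K1.
  rewrite sub0r normrN gtr0_norm ?invr_gt0// -[leRHS]invrK lef_pV2 ?posrE ?invr_gt0//.
Unshelve. all: by end_near. Qed.

Let center_probability_le n (M eta eps : R) : (0 < k n < n)%N ->
  tail_bounds F gamma ((k n)%:R / n%:R) (u n) (e n) -> e n <= 1 / 4 -> K n * e n <= 1 / 2 ->
  0 < eps -> 3 * eta <= 1 -> 3 + 8 / eps <= M ->
  fine (P [set w | M - 3 * eta <
    `|(exceed_count (fun i => X i w) n (u n) - (k n)%:R) / K n|]) <= eps / 4.
Proof.
move=> /andP[k0 kn] tbn e4 Ke eps0 eta3 Me.
have n0 : (0 < n)%N by exact: leq_ltn_trans kn.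
have e8 : 0 < 8 / eps by rewrite divr_gt0.
have a0 : 0 < M - 3 * eta - 1 by lra.
have Ke2 : 2 * (K n * e n) <= 1 by lra.
have := center_probability indX cdfX k0 n0 gamma0 tbn e4 Ke2 a0.
rewrite subrK => /le_trans; apply.
have a8 : 8 / eps <= M - 3 * eta - 1 by lra.
have a1 : 1 <= M - 3 * eta - 1 by lra.
rewrite ler_pdivrMr ?exprn_gt0//.
rewrite ler_pdivrMr// in a8.
have : (M - 3 * eta - 1) * 1 * eps <= (M - 3 * eta - 1) ^+ 2 * eps.
  by rewrite ler_pM2r// expr2 ler_pM2l.
by rewrite mulr1; lra.
Qed.

Let grid_probability_le n (s M eta dl : R) : (0 < k n < n)%N ->
  tail_bounds F gamma ((k n)%:R / n%:R) (u n) (e n) -> `|s| <= M -> 1 <= M ->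
  0 < eta -> 0 < dl -> K n * e n <= eta / 16 -> eta <= 1 -> 2 * (M + 1) <= K n ->
  8 * (M + 1) ^+ 2 / eta <= K n -> 12 * (M + 1) / (eta ^+ 2 * dl) <= K n ->
  fine (P [set w | eta < `|(exceed_count (fun i => X i w) n
      (shifted_level (k n) gamma (u n) s)
    - exceed_count (fun i => X i w) n (u n)) / K n + s|]) <= dl.
Proof.
move=> /andP[k0 kn] tbn sM M1 eta0 dl0 Ke eta1 KM K8 K12.
have n0 : (0 < n)%N by exact: leq_ltn_trans kn.
have K0 : 0 < K n by lra.
have e0 : 0 <= e n by case: tbn.
have Ke00 : 0 <= K n * e n by rewrite mulr_ge0// ltW.
have s0 := normr_ge0 s.
have h0 : 0 <= `|s| + K n * e n by rewrite addr_ge0.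
have h1 : `|s| + K n * e n <= 1 / 2 * K n by lra.
have hM : `|s| + K n * e n <= M + 1 by lra.
have h2 : 2 * (K n * e n) + 2 * (`|s| + K n * e n) ^+ 2 / K n <= eta / 2.
  have q : (`|s| + K n * e n) ^+ 2 <= (M + 1) ^+ 2.
    by rewrite lerXn2r ?nnegrE// (le_trans h0).
  rewrite ler_pdivrMr// in K8.
  have : 2 * (`|s| + K n * e n) ^+ 2 / K n <= eta / 4 by rewrite ler_pdivrMr//; lra.
  by lra.
have := grid_probability indX cdfX k0 n0 gamma0 tbn eta0 h1 h2.
move=> /le_trans; apply; rewrite ler_pdivrMr ?exprn_gt0// mulrA ler_pdivrMr//.
rewrite ler_pdivrMr ?mulr_gt0 ?exprn_gt0// in K12.
by apply: (@le_trans _ _ (12 * (M + 1))); [rewrite ler_pM2l|rewrite [leRHS]mulrC (mulrC dl)].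
Qed.

Let clt_complement (q Q eps : R) : `|q - Q| <= eps / 4 -> 1 - eps / 4 <= Q ->
  1 - q <= eps / 2.
Proof. by rewrite ler_norml => /andP[]; lra. Qed.

Let three_bounds (q1 q2 q3 q4 q eps : R) : q1 <= eps / 2 -> q2 <= eps / 4 ->
  q3 <= eps / 4 -> q4 <= q2 + q3 -> q <= q1 + q4 -> 1 - eps <= 1 - q.
Proof. lra. Qed.

(** The complement of the good event is a union of three kinds of failures: [zeta] too large, the
    count at [u] far from [k], and a bad count increment at one of finitely many levels. The
    parameters [M], [t] and the grid are fixed before [n] grows. *)
Lemma good_event (eps tau : R) : 0 < eps -> 0 < tau -> \forall n \near \oo,
  exists G : set T, [/\ measurable G, 1 - eps <= fine (P G) & forall w, G w ->
    well_defined_sample (fun i => X i w) n (k n) /\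
    `|log_lik_ratio (fun i => X i w) n (k n) (p n) (survival_inv F (p n))
      - zeta n w ^+ 2| <= tau].
Proof.
move=> eps0 tau0; have eps4 : 0 < eps / 4 by rewrite divr_gt0.
have [c c0 cE] := normal_within_cvg1 eps4.
have e8 : 0 < 8 / eps by rewrite divr_gt0.
(* Large enough that [c <= M - 1] and that the central count deviates by more than [M - 3 eta] with
   probability at most [eps / 4]. *)
have [M [M1 Mc Me]] : exists M : R, [/\ 1 <= M, 3 + c <= M & 3 + 8 / eps <= M].
  by exists (3 + c + 8 / eps); split; lra.
have M0 : 0 < M by lra.
have [t [t0 tM ttau]] : exists t : R,
    [/\ 0 < t, 40 * M ^+ 2 * t <= 1 & 410 * (M ^+ 3 * t) <= tau].
  have ex (a b : R) : 0 < a -> 0 < b -> exists t : R, [/\ 0 < t, b * t <= 1 & a * t <= tau].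
    move=> a0 b0; exists (Num.min b^-1 (tau / a)); split.
    - by rewrite lt_min invr_gt0 b0 divr_gt0.
    - by rewrite mulrC -ler_pdivlMr// mul1r ge_min lexx.
    - by rewrite mulrC -ler_pdivlMr// ge_min lexx orbT.
  have b0 : 0 < 40 * M ^+ 2 by apply: mulr_gt0; [lra|exact: exprn_gt0].
  have a0 : 0 < 410 * M ^+ 3 by apply: mulr_gt0; [lra|exact: exprn_gt0].
  have [t [t0 tb' ta]] := ex _ _ a0 b0; exists t; split; [exact: t0|exact: tb'|].
  by rewrite mulrA.
have t40 : t <= 1 / 40.
  have : 40 * t <= 40 * M ^+ 2 * t.
    by rewrite -mulrA ler_pM2l// ler_peMl ?(ltW t0)// exprn_ege1.
  by lra.
have [J [eta [eta0 JM etat]]] : exists (J : nat) (eta : R),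
    [/\ 0 < eta, J%:R * eta = M & eta <= t].
  exists (Num.truncn (M / t)).+1, (M / (Num.truncn (M / t)).+1%:R).
  have J0 : 0 < (Num.truncn (M / t)).+1%:R :> R by rewrite ltr0n.
  split; first by rewrite divr_gt0.
    by rewrite mulrC divfK// gt_eqF.
  rewrite ler_pdivrMr// mulrC -ler_pdivrMr//.
  by have /andP[_ /ltW] := truncn_itv (divr_ge0 (ltW M0) (ltW t0)).
pose m := (J.*2).+1.
have m0 : 0 < m%:R :> R by rewrite ltr0n.
(* The share of [eps / 4] allotted to each of the [m] grid points. *)
have [dl [dl0 dlE]] : exists dl : R, 0 < dl /\ m%:R * dl = eps / 4.
  by exists (eps / 4 / m%:R); split; [rewrite divr_gt0|rewrite mulrC divfK// gt_eqF].
have eta16 : 0 < eta / 16 by rewrite divr_gt0.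
have eta_small : [/\ eta <= 1, 3 * eta <= 1, eta / 16 <= 1 / 4 & eta / 16 <= 1 / 2].
  by split; lra.
have [eta1 eta3 eta4 eta2] := eta_small.
have cM1 : c <= M - 1 by lra.
have M2 : 1 <= 2 * (M + 1) by lra.
have t1 : 1 <= 1 / t by rewrite ler_pdivlMr//; lra.
have [Kmin [Km1 Km2 Km3 Km4]] : exists B : R, [/\ 1 / t <= B, 2 * (M + 1) <= B,
    8 * (M + 1) ^+ 2 / eta <= B & 12 * (M + 1) / (eta ^+ 2 * dl) <= B].
  exists (Num.max (Num.max (1 / t) (2 * (M + 1)))
    (Num.max (8 * (M + 1) ^+ 2 / eta) (12 * (M + 1) / (eta ^+ 2 * dl)))).
  by split; rewrite !le_max lexx ?orbT.
have near1 := K_large Kmin.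
have near2 := L_large (1 / t).
have near3 := Ke_small eta16.
have near4 := score_clt (ltW c0) eps4.
near=> n.
have kn : (0 < k n < n)%N by near: n; exact: k_lt.
have tbn : tail_bounds F gamma ((k n)%:R / n%:R) (u n) (e n) by near: n; exact: tb.
have Kn : Kmin <= K n by near: n; exact: near1.
have Ln : 1 / t <= L n by near: n; exact: near2.
have Ken : K n * e n <= eta / 16 by near: n; exact: near3.
have cltn : `|fine (P [set w | `|zeta n w| <= c]) - normal_within c| <= eps / 4.
  by near: n; exact: near4.
have /andP[k0 kltn] := kn.
have n0 : (0 < n)%N by exact: leq_ltn_trans kltn.
have K1 : 1 <= K n by exact: (le_trans M2 (le_trans Km2 Kn)).
have K0 : 0 < K n by exact: lt_le_trans K1.
have e0 : 0 <= e n by case: tbn.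
have Kt : 1 <= t * K n.
  by rewrite mulrC -ler_pdivrMr// (le_trans _ Kn).
have Lt : 1 <= t * L n by rewrite mulrC -ler_pdivrMr.
have Ke_e : e n <= K n * e n by rewrite ler_peMl.
have L1 : 1 / K n <= L n.
  by rewrite (le_trans _ (le_trans t1 Ln))// ler_pdivrMr// mul1r.
pose Nw w v := exceed_count (fun i => X i w) n v.
pose grid (j : nat) : R := j%:R * eta - M.
pose lev (j : nat) := shifted_level (k n) gamma (u n) (grid j).
pose B1 := [set w | c < `|zeta n w|].
pose B2 := [set w | M - 3 * eta < `|(Nw w (u n) - (k n)%:R) / K n|].
pose B3 (j : nat) := [set w | eta < `|(Nw w (lev j) - Nw w (u n)) / K n + grid j|].
have mnorm (f : T -> R) : measurable_fun setT f -> measurable_fun setT (fun w => `|f w|).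
  exact: (measurableT_comp (@normr_measurable R setT)).
have mNw v : measurable_fun setT (fun w => Nw w v) by exact: measurable_exceed_count.
have mz : measurable_fun setT (fun w => zeta n w).
  exact: (measurable_partial_sum X (measurable_scaled_score n) n).
have mB1 : measurable B1 by apply: measurable_set_lt => //; exact: mnorm.
have mB2 : measurable B2.
  apply: measurable_set_lt => //; apply: mnorm; apply: measurable_funM => //.
  exact: measurable_funB.
have mB3 j : measurable (B3 j).
  apply: measurable_set_lt => //; apply: mnorm; apply: measurable_funD => //.
  by apply: measurable_funM => //; exact: measurable_funB.
pose B4 := \big[setU/set0]_(j < m) B3 j.
have mB4 : measurable B4 by apply: bigsetU_measurable => j _; exact: mB3.
have P1 : fine (P B1) <= eps / 2.
  have -> : B1 = ~` [set w | `|zeta n w| <= c].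
    by apply/seteqP; split => w; rewrite /B1/= ltNge => /negP.
  rewrite fine_probability_setC; first exact: clt_complement cltn cE.
  by apply: measurable_set_le => //; exact: mnorm.
have P2 : fine (P B2) <= eps / 4.
  apply: center_probability_le => //; first exact: (le_trans Ke_e (le_trans Ken eta4)).
  exact: (le_trans Ken eta2).
have gridM j : (j < m)%N -> `|grid j| <= M.
  rewrite /m ltnS => jJ; rewrite ler_norml /grid; apply/andP; split.
    by rewrite lerBrDl addrN mulr_ge0// ltW.
  rewrite lerBlDl; apply: (@le_trans _ _ ((J.*2)%:R * eta)).
    by rewrite ler_pM2r// ler_nat.
  by rewrite -addnn natrD mulrDl JM.
have P3 j : (j < m)%N -> fine (P (B3 j)) <= dl.
  move=> /gridM gM; apply: (grid_probability_le kn tbn gM M1 eta0 dl0 Ken eta1).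
  - exact: le_trans Kn.
  - exact: le_trans Kn.
  - exact: le_trans Kn.
have P4 : fine (P B4) <= eps / 4.
  have := fine_probability_bigsetU (fun j _ => mB3 j) P3.
  by rewrite dlE.
exists (~` (B1 `|` (B2 `|` B4))).
have mB : measurable (B1 `|` (B2 `|` B4)) by apply: measurableU => //; exact: measurableU.
split; first exact: measurableC.
  rewrite fine_probability_setC//.
  exact: (three_bounds P1 P2 P4 (fine_probability_setU P mB2 mB4)
    (fine_probability_setU P mB1 (measurableU _ _ mB2 mB4))).
move=> w Gw.
have zc : `|zeta n w| <= c by rewrite leNgt; apply/negP => h; apply: Gw; left.
have cP : `|(Nw w (u n) - (k n)%:R) / K n| <= M - 3 * eta.
  by rewrite leNgt; apply/negP => h; apply: Gw; right; left.
have gP j : (j <= J.*2)%N -> `|(Nw w (lev j) - Nw w (u n)) / K n + grid j| <= eta.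
  move=> jJ; rewrite leNgt; apply/negP => h; apply: Gw; right; right.
  have jm : (j < m)%N by [].
  by rewrite /B4 (bigD1 (Ordinal jm))//=; left.
have u0 : 0 < u n by case: tbn.
have zE : zeta n w = (\sum_(i < n) score gamma (u n) (X i w)) / K n.
  by rewrite /partial_sum mulr_suml.
have kn0 : 0 < (k n)%:R / n%:R :> R by rewrite divr_gt0// ltr0n.
have LE : ln ((k n)%:R / n%:R / p n) = L n by rewrite -mulrA -invfM.
(* Half of [1 / K]; the other half absorbs the bias, since [K e <= 1 / 2]. *)
pose kap := (2 * K n)^-1.
have kap0 : 0 < kap by rewrite invr_gt0 mulr_gt0.
have ek : e n + kap <= (K n)^-1.
  rewrite -(ler_pM2l K0) mulrDr divff ?gt_eqF//.
  have -> : K n * kap = 1 / 2 by rewrite /kap; field; rewrite gt_eqF.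
  rewrite -lerBrDr (_ : 1 - 1 / 2 = 1 / 2); last by field.
  exact: (le_trans Ken eta2).
have ekL : e n + kap <= ln ((k n)%:R / n%:R / p n) by rewrite LE (le_trans ek)// -div1r.
have [xp0 xpP] := survival_inv_bounds F_nd F_rc F_Ny F_y gamma0 tbn kn0 (p01 n) kap0 ekL.
rewrite LE in xpP.
have xpP' := le_trans xpP ek.
have zM : `|(\sum_(i < n) score gamma (u n) (X i w)) / K n| <= M - 1.
  by rewrite -zE (le_trans zc).
have [wd app] := log_lik_ratio_approx k0 kltn gamma0 u0 eta0 JM gP cP M1 t0 etat tM Lt Kt
   (p01 n) xpP' zM.
split => //; rewrite zE; exact: le_trans ttau.
Unshelve. all: by end_near. Qed.

End Good_event.

(** * The chi-square distribution function *)

Section Chi_square.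
Context {R : realType}.

Lemma chi_square1_lt0 (x : R) : x < 0 -> @chi_square1 R `]-oo, x]%classic = 0%E.
Proof.
move=> x0; rewrite /chi_square1 /pushforward (_ : _ @^-1` _ = set0) ?measure0//.
apply/seteqP; split => // z /=; rewrite in_itv/= => zx.
by have := sqr_ge0 z; lra.
Qed.

Lemma chi_square1_ge0 (x : R) : 0 <= x ->
  @chi_square1 R `]-oo, x]%classic = (normal_within (Num.sqrt x))%:E.
Proof.
move=> x0; rewrite /chi_square1 /pushforward /normal_within fineK ?fin_num_measure//.
congr (normal_prob _ _ _); apply/seteqP; split => z /=; rewrite !in_itv/= -ler_norml.
  by rewrite -ler_sqrt// sqrtr_sqr.
by move=> h; rewrite -(real_normK (num_real z)) -(sqr_sqrtr x0) lerXn2r ?nnegrE ?sqrtr_ge0.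
Qed.

End Chi_square.

(** * Order, continuity and limits of the distribution function *)

Section Distribution_function.
Context {d : measure_display} {T : measurableType d} {R : realType}.
Variables (P : probability T R) (Y : {RV P >-> R}) (F : R -> R).
Hypothesis cdfY : forall x, cdf Y x = (F x)%:E.

Let F_fine : F = fine \o cdf Y.
Proof. by apply/funext => x /=; rewrite cdfY. Qed.

Lemma cdf_homo : {homo F : x y / x <= y}.
Proof. by move=> x y xy; rewrite -lee_fin -!cdfY cdf_nondecreasing. Qed.

Lemma cdf_right_ge y c : (forall z, y < z -> c <= F z) -> c <= F y.
Proof.
move=> h; have cv := @cdf_right_continuous _ _ _ _ Y y.
rewrite -lee_fin -cdfY -(cvg_lim _ cv)//; apply: lime_ge; first by apply/cvg_ex; eexists; exact: cv.
near=> z; rewrite cdfY lee_fin; apply: h; near: z; exact: nbhs_right_gt.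
Unshelve. all: by end_near. Qed.

Lemma cdf_small (e : R) : 0 < e -> exists y, F y < e.
Proof.
move=> e0; have cv : F x @[x --> -oo] --> (0 : R).
  by rewrite F_fine; apply: fine_cvg; exact: cvg_cdfNy0.
exact: (filter_ex (cvgr_lt _ cv _ e0)).
Qed.

Lemma cdf_large (e : R) : 0 < e -> exists y, 1 - F y < e.
Proof.
move=> e0; have cv : F x @[x --> +oo] --> (1 : R).
  by rewrite F_fine; apply: fine_cvg; exact: cvg_cdfy1.
have e1 : 1 - e < 1 by lra.
by have [y] := filter_ex (cvgr_gt _ cv _ e1); exists y; lra.
Qed.

End Distribution_function.

(** * From the scores to the likelihood ratio in distribution *)

Section Conclusion.
Context {d : measure_display} {T : measurableType d} {R : realType}.
Variables (P : probability T R) (E : nat -> set T) (Y zeta : nat -> T -> R).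
Hypothesis mE : forall n, measurable (E n).
Hypothesis mY : forall n, measurable_fun (E n) (Y n).
Hypothesis mz : forall n, measurable_fun setT (zeta n).
Hypothesis clt : forall c eps : R, 0 <= c -> 0 < eps -> \forall n \near \oo,
  `|fine (P [set w | `|zeta n w| <= c]) - normal_within c| <= eps.
Hypothesis approx : forall eps tau : R, 0 < eps -> 0 < tau -> \forall n \near \oo,
  exists G : set T, [/\ measurable G, 1 - eps <= fine (P G) &
    forall w, G w -> E n w /\ `|Y n w - zeta n w ^+ 2| <= tau].

Let cvg_probability (A : nat -> set T) (l : R) : (forall n, measurable (A n)) ->
  fine (P (A n)) @[n --> \oo] --> l -> P (A n) @[n --> \oo] --> l%:E.
Proof.
move=> mA Al; apply: cvg_EFin => //.
by near=> n; rewrite fin_num_measure.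
Unshelve. all: by end_near. Qed.

Let fine_le1 (A : set T) : measurable A -> fine (P A) <= 1.
Proof.
by move=> mA; rewrite -lee_fin fineK ?fin_num_measure// probability_le1.
Qed.

Let fine_ge0' (A : set T) : 0 <= fine (P A).
Proof. exact: fine_ge0. Qed.

(** A Slutsky argument: up to a set of small probability, [Y <= x] lies between [|zeta| <= c - r]
    and [|zeta| <= c + r] with [c] the square root of [x], and the limit is Lipschitz in [c]. *)
Lemma cvg_in_distribution_chi_square1 : cvg_in_distribution_on P E Y (@chi_square1 R).
Proof.
have mEY n x : measurable (E n `&` [set w | Y n w <= x]).
  have := mY (mE n) (measurable_itv `]-oo, x]).
  by congr measurable; apply/seteqP; split => w /=; rewrite in_itv.
have split_le (A G B : set T) : measurable A -> measurable G -> measurable B ->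
    A `&` G `<=` B -> fine (P A) <= fine (P B) + (1 - fine (P G)).
  move=> mA mG mB AGB; rewrite -fine_probability_setC//.
  apply: le_trans (fine_probability_setU P mB (measurableC mG)).
  apply: fine_probability_le => //; first exact: measurableU _ _ mB (measurableC mG).
  by move=> w Aw; have [Gw|] := pselect (G w); [left; apply: AGB|right].
have mzc n (c : R) : measurable [set w | `|zeta n w| <= c].
  apply: measurable_set_le => //.
  exact: (measurableT_comp (@normr_measurable R setT) (mz n)).
split => // [|x _].
  apply: cvg_probability => //; apply/cvgrPdist_le => eps eps0.
  have := approx eps0 ltr01; apply: filterS => n [G [mG PG GE]].
  have := fine_le1 (mE n); have : fine (P G) <= fine (P (E n)).
    by apply: fine_probability_le => // w /GE[].
  by rewrite ler_norml => ? ?; apply/andP; split; lra.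
have [x0|x0] := ltP x 0.
  rewrite chi_square1_lt0//; apply: cvg_probability => //; apply/cvgrPdist_le => eps eps0.
  have xn : 0 < - x / 2 by lra.
  have := approx eps0 xn; apply: filterS => n [G [mG PG GE]].
  rewrite sub0r normrN ger0_norm//.
  have h : (E n `&` [set w | Y n w <= x]) `&` G `<=` set0.
    move=> w [[_ /= Yx] /GE[_]]; rewrite ler_norml => /andP[h _].
    by have := sqr_ge0 (zeta n w); lra.
  have := split_le _ _ _ (mEY n x) mG measurable0 h.
  by rewrite measure0/=; lra.
rewrite chi_square1_ge0//; apply: cvg_probability => //; apply/cvgrPdist_le => eps eps0.
set c := Num.sqrt x.
have c0 : 0 <= c by exact: sqrtr_ge0.
have c2 : c ^+ 2 = x by rewrite sqr_sqrtr.
(* With tolerance [r ^ 2] on [Y - zeta ^ 2], the inclusions follow from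
   [c ^ 2 + r ^ 2 <= (c + r) ^ 2] and, when [r <= c], [(c - r) ^ 2 + r ^ 2 <= c ^ 2]. *)
have [r [r0 re rc]] : exists r : R, [/\ 0 < r, 4 * r <= eps & 0 < c -> r <= c].
  move: c0; rewrite le_eqVlt => /predU1P[<-|c0].
    by exists (eps / 4); split; [lra|lra|rewrite ltxx].
  exists (Num.min c (eps / 4)); split.
  - by rewrite lt_min c0; lra.
  - have : Num.min c (eps / 4) <= eps / 4 by rewrite ge_min lexx orbT.
    by lra.
  - by rewrite ge_min lexx.
have r2 : 0 < r ^+ 2 by rewrite exprn_gt0.
have eps4 : 0 < eps / 4 by lra.
have cr0 : 0 <= c + r by lra.
have near1 := approx eps4 r2; have near2 := clt cr0 eps4.
have near3 : \forall n \near \oo, 0 < c ->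
    `|fine (P [set w | `|zeta n w| <= c - r]) - normal_within (c - r)| <= eps / 4.
  have [c0'|c0'] := ltP 0 c; last by near=> n.
  have cr : 0 <= c - r by rewrite subr_ge0; exact: rc.
  by apply: filterS (clt cr eps4) => n h _.
near=> n.
have [G [mG PG GE]] : exists G : set T, [/\ measurable G, 1 - eps / 4 <= fine (P G) &
    forall w, G w -> E n w /\ `|Y n w - zeta n w ^+ 2| <= r ^+ 2].
  by near: n; exact: near1.
have up : fine (P (E n `&` [set w | Y n w <= x])) <= normal_within c + eps.
  have h : (E n `&` [set w | Y n w <= x]) `&` G `<=` [set w | `|zeta n w| <= c + r].
    move=> w [[_ /= Yx] /GE[_]]; rewrite ler_norml => /andP[h _].
    rewrite -(@ler_pXn2r _ 2) ?nnegrE// real_normK ?num_real//.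
    rewrite sqrrD c2; have := mulr_ge0 c0 (ltW r0); lra.
  have := split_le _ _ _ (mEY n x) mG (mzc n _) h.
  have : `|fine (P [set w | `|zeta n w| <= c + r]) - normal_within (c + r)| <= eps / 4.
    by near: n; exact: near2.
  have := normal_withinD c0 (ltW r0).
  by rewrite ler_norml => ? /andP[? ?]; lra.
have low : normal_within c - eps <= fine (P (E n `&` [set w | Y n w <= x])).
  have [c0'|c0'] := ltP 0 c; last first.
    have -> : c = 0 by apply/eqP; rewrite eq_le c0' c0.
    by rewrite normal_within0; have := fine_ge0' (E n `&` [set w | Y n w <= x]); lra.
  have rc' := rc c0'.
  have h : [set w | `|zeta n w| <= c - r] `&` G `<=` E n `&` [set w | Y n w <= x].
    move=> w [/= zc /GE[Ew]]; rewrite ler_norml => /andP[_ h]; split => //=.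
    have : zeta n w ^+ 2 <= (c - r) ^+ 2.
      by rewrite -(real_normK (num_real (zeta n w))) lerXn2r ?nnegrE// subr_ge0.
    have : r * r <= c * r by rewrite ler_pM2r.
    by rewrite -c2 !expr2 in h *; lra.
  have := split_le _ _ _ (mzc n _) mG (mEY n x) h.
  have : `|fine (P [set w | `|zeta n w| <= c - r]) - normal_within (c - r)| <= eps / 4.
    by move: c0'; near: n; exact: near3.
  have cr : 0 <= c - r by rewrite subr_ge0.
  have := normal_withinD cr (ltW r0); rewrite subrK.
  by rewrite ler_norml => ? /andP[? ?]; lra.
by rewrite ler_norml; apply/andP; split; lra.
Unshelve. all: by end_near. Qed.

End Conclusion.

Theorem theorem3 (d : measure_display) (T : measurableType d) (R : realType)
    (P : probability T R) (X : nat -> {RV P >-> R})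
    (F e A : R -> R) (gamma rho : R) (p : nat -> R) (k : nat -> nat)
    (iidX : iid_with_cdf X F)
    (gamma_gt0 : 0 < gamma)
    (sv_e : slowly_varying e)
    (tailF : forall x : R, 0 < x -> 1 - F x = e x * x `^ (- gamma))
    (rho_lt0 : rho < 0)
    (A_to0 : A t @[t --> +oo] --> (0 : R))
    (second_order : forall x : R, 0 < x ->
      (tail_quantile F (t * x) / tail_quantile F t - x `^ (gamma^-1)) / A t
        @[t --> +oo] --> x `^ (gamma^-1) * ((x `^ rho - 1) / rho))
    (p01 : forall n, 0 < p n < 1)
    (p_to0 : p n @[n --> \oo] --> (0 : R))
    (k_oo : k n @[n --> \oo] --> \oo)
    (k_small : (k n)%:R / n%:R @[n --> \oo] --> (0 : R))
    (kA_to0 : Num.sqrt (k n)%:R * A (n%:R / (k n)%:R) @[n --> \oo] --> (0 : R))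
    (np_small : (fun n => n%:R * p n : R^o) =o_\oo (fun n => (k n)%:R : R^o))
    (log_small : ln ((k n)%:R / (n%:R * p n)) / Num.sqrt (k n)%:R
        @[n --> \oo] --> 0) :
  (forall (n : nat) (w : T) (xp : R), 0 < xp ->
     well_defined_sample (fun i => X i w) n (k n) ->
     exists! lam : R, multiplier_eq (fun i => X i w) n (k n) (p n) xp lam) /\
  cvg_in_distribution_on P
    (fun n => [set w | well_defined_sample (fun i => X i w) n (k n)])
    (fun n w => log_lik_ratio (fun i => X i w) n (k n) (p n)
                  (survival_inv F (p n)))
    (@chi_square1 R).
Proof.
have [indX cdfX] := iidX.
split=> [n w xp xp0 wd|].
  have kn : (k n < n)%N by case: wd.
  exact: multiplier_eq_unique.
have F_nd := cdf_homo (cdfX 0%N); have F_rc := cdf_right_ge (cdfX 0%N).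
have F_Ny := cdf_small (cdfX 0%N); have F_y := cdf_large (cdfX 0%N).
have [_ e_gt0 _] := sv_e.
(* The tail is positive far out because [e] is eventually positive, hence everywhere by
   monotonicity. *)
have F_lt1 y : F y < 1.
  have [t [ty t1 et]] : exists t : R, [/\ y <= t, 0 < t & 0 < e t].
    have h1 : \forall t \near +oo, y <= t by apply: nbhs_pinfty_ge; rewrite num_real.
    have h2 : \forall t \near +oo, 0 < t :> R by apply: nbhs_pinfty_gt; rewrite num_real.
    by have [t [[? ?] ?]] := filter_ex (filterI (filterI h1 h2) e_gt0); exists t.
  apply: (le_lt_trans (F_nd _ _ ty)); rewrite -subr_gt0 tailF//.
  by rewrite mulr_gt0// powR_gt0.
have k_gt m : \forall n \near \oo, (m <= k n)%N by move/cvgnyPge : k_oo; apply.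
have k_lt : \forall n \near \oo, (0 < k n < n)%N.
  have h1 := k_gt 1%N; have h2 := cvgr_lt _ k_small _ ltr01.
  near=> n; have k0 : (0 < k n)%N by near: n; exact: h1.
  have n0 : (0 < n)%N by near: n; exact: nbhs_infty_gt.
  rewrite k0/= -(ltr_nat R) -[ltRHS]mul1r -ltr_pdivrMr ?ltr0n//.
  by near: n; exact: h2.
have K_large (B : R) : \forall n \near \oo, B <= Num.sqrt (k n)%:R.
  apply: filterS (k_gt (Num.truncn (B ^+ 2)).+1) => n kn.
  apply: (le_trans (ler_norm B)); rewrite -sqrtr_sqr ler_wsqrtr//.
  have /andP[_ /ltW h] := truncn_itv (sqr_ge0 B).
  by apply: (le_trans h); rewrite ler_nat.
(* This is [n p = o(k)] with constant [exp (- B)]. *)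
have L_large (B : R) : \forall n \near \oo, B <= ln ((k n)%:R / (n%:R * p n)).
  have h : \forall n \near \oo, `|n%:R * p n| <= expR (- B) * `|(k n)%:R|.
    by move/eqoP : np_small => /(_ _ (expR_gt0 (- B))).
  near=> n; have /andP[p0 _] := p01 n.
  have n0 : 0 < n%:R :> R by rewrite ltr0n; near: n; exact: nbhs_infty_gt.
  have k0 : 0 < (k n)%:R :> R by rewrite ltr0n; near: n; exact: (k_gt 1%N).
  have np0 : 0 < n%:R * p n by rewrite mulr_gt0.
  rewrite -[leLHS]expRK ler_ln ?posrE ?expR_gt0 ?divr_gt0// ler_pdivlMr//.
  rewrite -ler_pdivlMl ?expR_gt0// -expRN -[n%:R * p n]ger0_norm ?(ltW np0)//.
  by rewrite -[(k n)%:R]ger0_norm//; near: n; exact: h.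
have [u [D [D0 tb]]] := second_order_tail_bounds F_nd F_rc F_Ny F_y F_lt1 gamma_gt0
  rho_lt0 A_to0 second_order k_oo k_small.
pose err n := D * `|A (n%:R / (k n)%:R)|.
have Ke0 : Num.sqrt (k n)%:R * err n @[n --> \oo] --> (0 : R).
  rewrite -(mulr0 D) -(normr0 R).
  rewrite (_ : (fun n => _) =
     (fun n => D * `|Num.sqrt (k n)%:R * A (n%:R / (k n)%:R)|)); last first.
    by apply/funext => n; rewrite /err normrM ger0_norm ?sqrtr_ge0//; ring.
  by apply: cvgMr; exact: cvg_norm.
apply: (@cvg_in_distribution_chi_square1 _ _ _ P _ _
  (fun n => partial_sum X (scaled_score gamma k u n) n)).
(* For [n <= k n] no sample is well defined and the event is empty. *)
- move=> n; have [kn|nk] := ltnP (k n) n; first exact: measurable_well_defined.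
  rewrite (_ : [set w | _] = set0)//; apply/seteqP; split => w // -[_].
  by rewrite ltnNge nk.
- move=> n; have [kn|nk] := ltnP (k n) n; first exact: measurable_log_lik_ratio.
  rewrite (_ : [set w | _] = set0); first exact: measurable_fun_set0.
  by apply/seteqP; split => w // -[_]; rewrite ltnNge nk.
- move=> n; apply: measurable_partial_sum.
  by apply: measurable_funM => //; exact: measurable_score.
- exact: (score_clt indX cdfX gamma_gt0 k_lt K_large tb Ke0).
- exact: (good_event indX cdfX F_nd F_rc F_Ny F_y gamma_gt0 p01 k_lt K_large L_large tb Ke0).
Unshelve. all: by end_near. Qed.
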